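(* The following decision problem is $\Pi_2\mathbb{R}$-complete (under polynomial-time many-one reductions): given sets $A$, $B$, each a Cartesian product of copies of $\mathbb{R}$ and $[-1,1]$, and a polynomial map $g:A\to B$ (with integer coefficients), decide whether $g$ is surjective onto $B$. This remains true even if $g$ is required to be a polynomial map of degree at most $8$.
   Context: A polynomial map $g$ is given by its component polynomials, each written as a sum of monomials with binary-encoded integer coefficients, with the promise $g(A)\subseteq B$. $\Pi_2\mathbb{R}$ (also written $\forall\exists\mathbb{R}$) is the class of decision problems polynomial-time many-one reducible to the set of true sentences of the form $(\forall x)(\exists y)\ \psi(x,y)$, where $x,y$ are tuples of real variables and $\psi$ is a quantifier-free formula built using $\wedge,\vee$ from atomic predicates $t\bowtie 0$ with $t$ a term built from the variables and $0,1$ using $+,\cdot$, and $\bowtie\in\{<,\leq,=,\geq,>\}$. *)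

(* Defs.v *)
From Corelib Require Import BinNums.
From HB Require Import structures.
From mathcomp Require Import all_boot all_order all_algebra.
From mathcomp Require Import classical_sets functions reals.
From mathcomp Require Import mpoly.

Set Implicit Arguments.
Unset Strict Implicit.
Unset Printing Implicit Defensive.

Import Order.TTheory GRing.Theory Num.Theory.

Definition word := seq bool.

(** * Deterministic multi-tape Turing machines *)

Inductive direction := MoveLeft | Stay | MoveRight.

Section Tapes.
Variable sym : Type.

(* A two-way infinite tape of [option sym], [None] being the blank.  The cells
   to the left of the head are listed from the head outwards, and [tape_right]
   starts with the scanned cell; cells beyond either list are blank. *)
Record tape := Tape { tape_left : seq (option sym); tape_right : seq (option sym) }.

Definition tape_read (t : tape) : option sym := head None (tape_right t).

Definition tape_write (a : option sym) (t : tape) : tape :=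
  Tape (tape_left t) (a :: behead (tape_right t)).

Definition tape_move (d : direction) (t : tape) : tape :=
  let: Tape l r := t in
  match d with
  | MoveLeft => Tape (behead l) (head None l :: r)
  | Stay => t
  | MoveRight => Tape (head None r :: l) (behead r)
  end.

End Tapes.

(* The tape alphabet consists of the blank, the two bits and the finitely many
   extra symbols of [tm_extra]; there are [tm_ntapes.+1] tapes. *)
Record machine := Machine {
  tm_extra : finType;
  tm_state : finType;
  tm_ntapes : nat;
  tm_start : tm_state;
  tm_halted : pred tm_state;
  tm_delta : tm_state ->
    {ffun 'I_tm_ntapes.+1 -> option (bool + tm_extra)} ->
    tm_state * ('I_tm_ntapes.+1 -> option (bool + tm_extra) * direction)
}.

Section Run.
Variable M : machine.

Definition tm_config : Type :=
  tm_state M * ('I_(tm_ntapes M).+1 -> tape (bool + tm_extra M)).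

Definition tm_init (w : word) : tm_config :=
  (tm_start M,
   fun i => Tape [::] (if i == ord0 then [seq Some (inl b) | b <- w] else [::])).

Definition tm_step (c : tm_config) : tm_config :=
  let: (q, ts) := c in
  if tm_halted q then c else
  let: (q', act) := tm_delta q [ffun i => tape_read (ts i)] in
  (q', fun i => tape_move (act i).2 (tape_write (act i).1 (ts i))).

Fixpoint leading_bits (s : seq (option (bool + tm_extra M))) : word :=
  if s is Some (inl b) :: s' then b :: leading_bits s' else [::].

(* The output is the maximal block of bits on the last tape that starts at the
   scanned cell and extends to the right. *)
Definition tm_output (c : tm_config) : word :=
  leading_bits (tape_right (c.2 ord_max)).

Definition tm_computes_within (T : nat) (w v : word) : Prop :=
  let c := iter T tm_step (tm_init w) in
  tm_halted c.1 /\ tm_output c = v.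

End Run.

Definition polytime (f : word -> word) : Prop :=
  exists (M : machine) (c d : nat),
    forall w, tm_computes_within M (c * size w ^ d + c) w (f w).

(** * Decision problems, possibly with a promise, and many-one reductions *)

(* [accepts] is only meaningful on the words satisfying [promise]. *)
Record problem := Problem { promise : word -> Prop; accepts : word -> Prop }.

Definition language (L : word -> Prop) : problem := Problem (fun=> True) L.

Definition reduces (P Q : problem) : Prop :=
  exists2 f : word -> word, polytime f &
    forall w, promise P w ->
      promise Q (f w) /\ (accepts P w <-> accepts Q (f w)).

(** * Prefix-free encodings *)

Definition enc_seq (T : Type) (enc : T -> word) (s : seq T) : word :=
  foldr (fun x w => true :: enc x ++ w) [:: false] s.

Definition enc_unary (n : nat) : word := nseq n true ++ [:: false].

(* Binary digits, least significant first, without superfluous zeros. *)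
Fixpoint pos_digits (p : positive) : word :=
  match p with
  | xH => [:: true]
  | xO p => false :: pos_digits p
  | xI p => true :: pos_digits p
  end.

Definition digits (n : nat) : word :=
  if bin_of_nat n is Npos p then pos_digits p else [::].

Definition enc_binary (n : nat) : word := enc_seq (fun b => [:: b]) (digits n).

Definition enc_int (z : int) : word :=
  match z with
  | Posz n => false :: enc_binary n
  | Negz n => true :: enc_binary n.+1
  end.

(** * Sentences (forall x)(exists y) psi(x, y) over the reals *)

Inductive rterm (V : Type) :=
  | TVar of V
  | TZero
  | TOne
  | TAdd of rterm V & rterm V
  | TMul of rterm V & rterm V.

Arguments TZero {V}.
Arguments TOne {V}.

Inductive comparison := CLt | CLe | CEq | CGe | CGt.

(* [FAtom c t] is the atomic predicate comparing [t] with 0. *)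
Inductive rformula (V : Type) :=
  | FAtom of comparison & rterm V
  | FAnd of rformula V & rformula V
  | FOr of rformula V & rformula V.

Record sentence := Sentence {
  s_forall : nat;
  s_exists : nat;
  s_matrix : rformula ('I_s_forall + 'I_s_exists)
}.

Section Semantics.
Local Open Scope ring_scope.
Variable R : realType.

Fixpoint eval_term (V : Type) (v : V -> R) (t : rterm V) : R :=
  match t with
  | TVar i => v i
  | TZero => 0
  | TOne => 1
  | TAdd t1 t2 => eval_term v t1 + eval_term v t2
  | TMul t1 t2 => eval_term v t1 * eval_term v t2
  end.

Definition compare0 (c : comparison) (a : R) : Prop :=
  match c with
  | CLt => a < 0
  | CLe => a <= 0
  | CEq => a = 0
  | CGe => a >= 0
  | CGt => a > 0
  end.

Fixpoint holds (V : Type) (v : V -> R) (phi : rformula V) : Prop :=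
  match phi with
  | FAtom c t => compare0 c (eval_term v t)
  | FAnd phi1 phi2 => holds v phi1 /\ holds v phi2
  | FOr phi1 phi2 => holds v phi1 \/ holds v phi2
  end.

Definition true_sentence (S : sentence) : Prop :=
  forall x : 'rV[R]_(s_forall S), exists y : 'rV[R]_(s_exists S),
    holds (fun i => match i with inl j => x 0 j | inr k => y 0 k end)
      (s_matrix S).

End Semantics.

Fixpoint enc_term (V : Type) (enc_var : V -> word) (t : rterm V) : word :=
  match t with
  | TVar i => [:: false; false] ++ enc_var i
  | TZero => [:: false; true; false]
  | TOne => [:: false; true; true]
  | TAdd t1 t2 => [:: true; false] ++ enc_term enc_var t1 ++ enc_term enc_var t2
  | TMul t1 t2 => [:: true; true] ++ enc_term enc_var t1 ++ enc_term enc_var t2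
  end.

Definition enc_comparison (c : comparison) : word :=
  match c with
  | CLt => [:: false; false]
  | CLe => [:: false; true]
  | CEq => [:: true; false]
  | CGe => [:: true; true; false]
  | CGt => [:: true; true; true]
  end.

Fixpoint enc_formula (V : Type) (enc_var : V -> word) (phi : rformula V) : word :=
  match phi with
  | FAtom c t => false :: enc_comparison c ++ enc_term enc_var t
  | FAnd phi1 phi2 =>
      [:: true; false] ++ enc_formula enc_var phi1 ++ enc_formula enc_var phi2
  | FOr phi1 phi2 =>
      [:: true; true] ++ enc_formula enc_var phi1 ++ enc_formula enc_var phi2
  end.

Definition enc_variable (n m : nat) (i : 'I_n + 'I_m) : word :=
  match i with
  | inl j => false :: enc_unary j
  | inr k => true :: enc_unary k
  end.

(* The numbers of quantified variables are written in unary, as the length of a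
   sentence accounts for each of the variables it quantifies. *)
Definition enc_sentence (S : sentence) : word :=
  enc_unary (s_forall S) ++ enc_unary (s_exists S) ++
  enc_formula (@enc_variable _ _) (s_matrix S).

Definition true_sentences (R : realType) : problem :=
  language (fun w => exists2 S, w = enc_sentence S & true_sentence R S).

Definition in_Pi2R (R : realType) (P : problem) : Prop :=
  reduces P (true_sentences R).

Definition Pi2R_complete (R : realType) (P : problem) : Prop :=
  in_Pi2R R P /\ forall Q : problem, in_Pi2R R Q -> reduces Q P.

(** * Surjectivity of polynomial maps between products of lines and segments *)

Inductive factor := Line | Segment.

(* Component [j] of the map is the sum of the monomials [c * X^e], for [(c, e)]
   in the list [tnth i_map j]. *)
Record instance := Instance {
  i_dom : nat;
  i_cod : nat;
  i_A : i_dom.-tuple factor;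
  i_B : i_cod.-tuple factor;
  i_map : i_cod.-tuple (seq (int * 'X_{1..i_dom}))
}.

Section Surjectivity.
Local Open Scope ring_scope.
Local Open Scope classical_set_scope.

Definition poly_of_monomials (n : nat) (s : seq (int * 'X_{1..n})) : {mpoly int[n]} :=
  \sum_(ce <- s) ce.1 *: 'X_[ce.2].

Definition component (I : instance) (j : 'I_(i_cod I)) : {mpoly int[i_dom I]} :=
  poly_of_monomials (tnth (i_map I) j).

(* [msize] is the total degree plus one (and 0 for the zero polynomial). *)
Definition degree_le (d : nat) (I : instance) : Prop :=
  forall j : 'I_(i_cod I), (msize (component j) <= d.+1)%N.

Variable R : realType.

Definition factor_set (F : factor) : set R :=
  match F with
  | Line => setT
  | Segment => `[-1, 1]
  end.

Definition box (n : nat) (A : n.-tuple factor) : set 'rV[R]_n :=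
  [set x | forall i, factor_set (tnth A i) (x 0 i)].

Definition poly_map (I : instance) (x : 'rV[R]_(i_dom I)) : 'rV[R]_(i_cod I) :=
  \row_j mmap intr (fun i => x 0 i) (component j).

Definition well_defined (I : instance) : Prop :=
  set_fun (box (i_A I)) (box (i_B I)) (@poly_map I).

Definition surjective_instance (I : instance) : Prop :=
  set_surj (box (i_A I)) (box (i_B I)) (@poly_map I).

End Surjectivity.

Definition enc_factor (F : factor) : word :=
  match F with
  | Line => [:: false]
  | Segment => [:: true]
  end.

Definition enc_monomial (n : nat) (ce : int * 'X_{1..n}) : word :=
  enc_int ce.1 ++ enc_seq enc_binary ce.2.

Definition enc_instance (I : instance) : word :=
  enc_seq enc_factor (i_A I) ++ enc_seq enc_factor (i_B I) ++
  enc_seq (enc_seq (@enc_monomial _)) (i_map I).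

Definition surjectivity_restricted (R : realType) (C : instance -> Prop) : problem :=
  Problem
    (fun w => exists I, [/\ w = enc_instance I, well_defined R I & C I])
    (fun w => exists I, w = enc_instance I /\ surjective_instance R I).

Definition surjectivity (R : realType) : problem :=
  surjectivity_restricted R (fun=> True).

Definition surjectivity_degree (R : realType) (d : nat) : problem :=
  surjectivity_restricted R (degree_le d).

(* Main.v *)
(* Both problems are compared with the truth of systems of quadratic equations
   [v_i v_j + v_k = v_l] in which some variables are universally and all others
   existentially quantified.  A formula becomes such a system by evaluating its
   terms gate by gate, after [t < 0] has been replaced by [1 + a^2 t = 0],
   [t <= 0] by [a^2 + t = 0], disjunctions by products and conjunctions by sums
   of squares.  Surjectivity is expressed in the same way; a point of [-1, 1] in
   the codomain is parametrised by [2 c / (1 + c^2)], and one in the domain is an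
   [a] such that [1 - a^2] is a square.

   Conversely, let [P] be the sum of the squares of the defects of the equations
   and of the square of a fresh variable [s].  The map sending [(v, z, w, s)] to
   the universal variables in [v], followed by [h1 = z w - 1] and
   [h2 = h1 z^2 - w P], has a value with last coordinates [(0, 0)] only if [w] is
   nonzero and [P = 0], that is, if [v] solves the system.  All other values of
   [(h1, h2)] are attained for every [v], since [s] makes [P] positive and it
   then remains to solve a real cubic in [z].

   The translations are written in a language of stacks of bits whose only loop
   repeats its body [N] times, for one bound [N] linear in the size of the input;
   its programs are compiled to Turing machines, and running times are polynomial
   because of the shape of the language alone. *)
Require Import Defs.
From mathcomp Require Import all_boot all_order all_algebra.
From mathcomp Require Import boolp classical_sets functions reals mpoly.
From mathcomp Require Import zify ring lra.

Set Implicit Arguments.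
Unset Strict Implicit.
Unset Printing Implicit Defensive.

Import Order.TTheory GRing.Theory Num.Theory.

(** For fixed [P > 0] the map sending [(z, w)] to [(h1, h2)] takes the plane exactly onto the plane
    minus the origin. This is what the hardness proof needs: if a system has no solution over some
    universal values, [P] is positive there but may come arbitrarily close to 0 as [v] varies, and
    the construction works for every positive [P], however small. The instances produced have only
    [Line] factors, so the promise on them is immediate; segments are met only in the membership
    proof.

    The two reductions treat their input differently. Membership starts from a promise problem, so
    its program may assume that it reads the encoding of an instance. Hardness starts from a
    language, so a word that encodes no sentence has to be recognised and sent to a false system.
    Hence the parser of sentences is proved sound as well as complete, while the reader of instances
    has no error states. *)

Definition polybounded (f : nat -> nat) : Prop :=
  exists c d, forall n, f n <= c * n.+1 ^ d.

Lemma polybounded_const c : polybounded (fun=> c).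
Proof. by exists c, 0 => n; rewrite expn0 muln1. Qed.

Lemma polybounded_id : polybounded id.
Proof. by exists 1, 1 => n; rewrite expn1 mul1n. Qed.

Lemma polybounded_add f g :
  polybounded f -> polybounded g -> polybounded (fun n => f n + g n).
Proof.
move=> [c [d fP]] [c' [d' gP]]; exists (c + c'), (d + d') => n; rewrite mulnDl.
apply: leq_add; [apply: leq_trans (fP n) _ | apply: leq_trans (gP n) _].
  by rewrite leq_mul2l leq_pexp2l ?leq_addr ?orbT.
by rewrite leq_mul2l leq_pexp2l ?leq_addl ?orbT.
Qed.

Lemma polybounded_mul f g :
  polybounded f -> polybounded g -> polybounded (fun n => f n * g n).
Proof.
move=> [c [d fP]] [c' [d' gP]]; exists (c * c'), (d + d') => n.
by rewrite expnD mulnACA; apply: leq_mul.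
Qed.

Lemma leq_expl m n d : m <= n -> m ^ d <= n ^ d.
Proof. by case: d => // d le_mn; rewrite leq_exp2r. Qed.

Lemma polybounded_comp f g :
  polybounded f -> polybounded g -> polybounded (fun n => g (f n)).
Proof.
move=> [c [d fP]] [c' [d' gP]]; exists (c' * c.+1 ^ d'), (d * d') => n.
apply: leq_trans (gP _) _; rewrite -mulnA leq_mul2l expnM -expnMn.
apply/orP; right; apply: leq_expl; rewrite mulSn -add1n.
by apply: leq_add; [rewrite expn_gt0 | apply: fP].
Qed.

(** The base [n.+1] of [polybounded] is positive, which gives closure under sums and products. To
    return to the form used by [polytime], [n.+1 <= 2 * n] handles positive [n], and the additive
    constant covers [n = 0]. *)
Lemma polybounded_std f :
  polybounded f -> exists c d, forall n, f n <= c * n ^ d + c.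
Proof.
move=> [c [d fP]]; exists (c * 2 ^ d), d => n; apply: leq_trans (fP n) _.
case: n => [|n]; first by rewrite exp1n muln1; have := expn_gt0 2 d; nia.
apply: leq_trans (leq_addr _ _); rewrite -mulnA -expnMn leq_mul2l.
by apply/orP; right; apply: leq_expl; lia.
Qed.

Lemma polybounded_monomial c d : polybounded (fun n => c * n ^ d + c).
Proof.
apply: polybounded_add (polybounded_const c).
by exists c, d => n; rewrite leq_mul2l leq_expl ?orbT.
Qed.

(** * A loop language over stacks of bits *)

Definition store := nat -> word.

Definition upd (s : store) (i : nat) (v : word) : store :=
  fun j => if j == i then v else s j.

Inductive cmd :=
  | Skip
  | Push of nat & bool
  | Pop of nat
  | Seq of cmd & cmd
  | If of nat & cmd & cmd & cmd
  | Loop of cmd.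

(* Every loop is executed exactly [N] times: no running time analysis of
   individual programs is needed. *)
Fixpoint exec (N : nat) (c : cmd) (s : store) : store :=
  match c with
  | Skip => s
  | Push i b => upd s i (b :: s i)
  | Pop i => upd s i (behead (s i))
  | Seq c1 c2 => exec N c2 (exec N c1 s)
  | If i c0 cF cT =>
      match s i with
      | [::] => exec N c0 s
      | b :: _ => if b then exec N cT s else exec N cF s
      end
  | Loop c => iter N (exec N c) s
  end.

Fixpoint regs_lt (B : nat) (c : cmd) : bool :=
  match c with
  | Skip => true
  | Push i _ | Pop i => i < B
  | Seq c1 c2 => regs_lt B c1 && regs_lt B c2
  | If i c0 cF cT => [&& i < B, regs_lt B c0, regs_lt B cF & regs_lt B cT]
  | Loop c => regs_lt B c
  end.

Fixpoint depth (c : cmd) : nat :=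
  match c with
  | Skip | Push _ _ | Pop _ => 0
  | Seq c1 c2 => maxn (depth c1) (depth c2)
  | If _ c0 cF cT => maxn (depth c0) (maxn (depth cF) (depth cT))
  | Loop c => (depth c).+1
  end.

(** A bound on the steps of the compiled code that depends on [N] alone and not on the store, so the
    branches of a test are all charged. A loop pays for [N] rounds with a test and a jump back, one
    failing test, and [N.+1] steps that rewind its counter. *)
Fixpoint ctime (N : nat) (c : cmd) : nat :=
  match c with
  | Skip => 0
  | Push _ _ => 2
  | Pop _ => 1
  | Seq c1 c2 => ctime N c1 + ctime N c2
  | If _ c0 cF cT => 2 + ctime N c0 + ctime N cF + ctime N cT
  | Loop c => N * (ctime N c + 2) + N + 2
  end.

Lemma ctime_polybounded c : polybounded (fun N => ctime N c).
Proof.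
elim: c => [|i b|i|c1 H1 c2 H2|i c0 H0 cF HF cT HT|c H] /=;
  do ?[exact: polybounded_const | exact: polybounded_id
      | apply: polybounded_add | apply: polybounded_mul | by []].
Qed.

Fixpoint clen (c : cmd) : nat :=
  match c with
  | Skip => 0
  | Push _ _ => 2
  | Pop _ => 1
  | Seq c1 c2 => clen c1 + clen c2
  | If _ c0 cF cT => (clen c0 + clen cF + clen cT).+3
  | Loop c => (clen c).+3
  end.

(** * Compilation to flow charts *)

Section Flow.
Variable X : finType.
Let sym := option (bool + X).

(* Tapes as pairs of streams, so that trailing blanks do not matter. *)
Definition ftape : Type := (nat -> sym) * (nat -> sym).

Definition fread (t : ftape) : sym := t.2 0.
Definition scons (a : sym) (f : nat -> sym) : nat -> sym :=
  fun n => if n is n'.+1 then f n' else a.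
Definition stail (f : nat -> sym) : nat -> sym := fun n => f n.+1.
Definition fwrite (a : sym) (t : ftape) : ftape := (t.1, scons a (stail t.2)).
Definition fmove (d : direction) (t : ftape) : ftape :=
  match d with
  | MoveLeft => (stail t.1, scons (t.1 0) t.2)
  | Stay => t
  | MoveRight => (scons (t.2 0) t.1, stail t.2)
  end.

Definition abs_tape (t : tape (bool + X)) : ftape :=
  (nth None (tape_left t), nth None (tape_right t)).

Lemma scons_tail f : scons (f 0) (stail f) = f.
Proof. by apply: funext => -[]. Qed.

Lemma scons_nth a s : scons a (nth None s) = nth None (a :: s).
Proof. by apply: funext => -[]. Qed.

Lemma stail_nth s : stail (nth None s) = nth None (behead s).
Proof. by apply: funext => i; case: s => //=; rewrite /stail /= !nth_nil. Qed.

Lemma nth0_head (s : seq sym) : nth None s 0 = head None s.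
Proof. by case: s. Qed.

Lemma abs_read t : fread (abs_tape t) = tape_read t.
Proof. by rewrite /fread /abs_tape /= nth0_head. Qed.

Lemma abs_write a t : abs_tape (tape_write a t) = fwrite a (abs_tape t).
Proof. by rewrite /abs_tape /fwrite /= stail_nth scons_nth. Qed.

Lemma abs_move d t : abs_tape (tape_move d t) = fmove d (abs_tape t).
Proof.
by case: t d => l r [] //; rewrite /abs_tape /fmove /= ?nth0_head stail_nth scons_nth.
Qed.

Lemma fwrite_read t : fwrite (fread t) t = t.
Proof. by case: t => l r; rewrite /fwrite /fread /= scons_tail. Qed.

Lemma fwrite_same a t : fread t = a -> fwrite a t = t.
Proof. by move=> <-; apply: fwrite_read. Qed.

Definition bits (s : word) : seq sym := [seq Some (inl b) | b <- s].
Definition stk (s : word) : ftape := (fun=> None, nth None (bits s)).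
(** A loop counter is a block of marks, [p] of them left of the head. Counting moves the head across
    the block and erases nothing, so rewinding makes the counter ready for the next use of the same
    loop. *)
Definition ctr (p q : nat) : ftape :=
  (nth None (bits (nseq p true)), nth None (bits (nseq q true))).

Lemma ctr0 q : ctr 0 q = stk (nseq q true).
Proof. by rewrite /ctr /stk /=; congr pair; apply: funext => i; rewrite nth_nil. Qed.

Definition instr : Type := nat * (sym -> sym * direction * nat).
Definition jump (pc : nat) : instr := (0, fun s => (s, Stay, pc)).

Definition flow_config : Type := nat * (nat -> ftape).

Definition fupd (T : nat -> ftape) (i : nat) (t : ftape) : nat -> ftape :=
  fun j => if j == i then t else T j.

Definition fstep (code : seq instr) (c : flow_config) : flow_config :=
  let: (pc, T) := c in
  if pc < size code then
    let: (i, f) := nth (jump 0) code pc in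
    let: (a, d, pc') := f (fread (T i)) in
    (pc', fupd T i (fmove d (fwrite a (T i))))
  else c.

Lemma fupd_id T i : fupd T i (T i) = T.
Proof. by apply: funext => j; rewrite /fupd; case: eqP => // ->. Qed.

(* [B + d] is the tape of the counter of a loop nested in [d] other loops. *)
Fixpoint compile (B off d : nat) (c : cmd) : seq instr :=
  match c with
  | Skip => [::]
  | Push i b =>
      [:: (i, fun s => (s, MoveLeft, off.+1));
          (i, fun=> (Some (inl b), Stay, off.+2))]
  | Pop i => [:: (i, fun=> (None, MoveRight, off.+1))]
  | Seq c1 c2 => compile B off d c1 ++ compile B (off + clen c1) d c2
  | If i c0 cF cT =>
      let oF := (off + clen c0).+2 in
      let oT := (oF + clen cF).+1 in
      let e := oT + clen cT in
      (i, fun s => (s, Stay, match s with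
                             | Some (inl true) => oT
                             | Some (inl false) => oF
                             | _ => off.+1
                             end)) ::
      compile B off.+1 d c0 ++ jump e :: compile B oF d cF ++ jump e :: compile B oT d cT
  | Loop c =>
      let r := (off + clen c).+2 in
      (B + d, fun s => if s is None then (s, MoveLeft, r)
                       else (s, MoveRight, off.+1)) ::
      compile B off.+1 d.+1 c ++
      [:: jump off;
          (B + d, fun s => if s is None then (s, MoveRight, r.+1)
                           else (s, MoveLeft, r))]
  end.

Lemma size_compile B off d c : size (compile B off d c) = clen c.
Proof.
elim: c off d => //= [c1 H1 c2 H2|i c0 H0 cF HF cT HT|c H] off d.
- by rewrite size_cat H1 H2.
- by rewrite size_cat /= H0 size_cat /= HF HT; lia.
- by rewrite size_cat /= H; lia.
Qed.

Definition instr_wf (J L : nat) (x : instr) : Prop :=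
  x.1 < J /\ forall s, (x.2 s).2 <= L.

Fixpoint all_wf (J L : nat) (s : seq instr) : Prop :=
  if s is x :: s' then instr_wf J L x /\ all_wf J L s' else True.

Lemma all_wf_cat J L s1 s2 : all_wf J L (s1 ++ s2) <-> all_wf J L s1 /\ all_wf J L s2.
Proof. by elim: s1 => [|x s1 IH] /=; tauto. Qed.

Lemma all_wf_nth J L s k : all_wf J L s -> k < size s -> instr_wf J L (nth (jump 0) s k).
Proof. by elim: s k => [|x s IH] [|k] //= [] // wx ws; apply: IH. Qed.

Lemma compile_all_wf B J L off d c : 0 < B -> regs_lt B c -> B + d + depth c <= J ->
  off + clen c <= L -> all_wf J L (compile B off d c).
Proof.
move=> B0; elim: c off d => [|i b|i|c1 H1 c2 H2|i c0 H0 cF HF cT HT|c H] off d /=.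
- by [].
- by move=> ? ? ?; do !split => //= *; lia.
- by move=> ? ? ?; do !split => //= *; lia.
- by move=> /andP[? ?] ? ?; apply/all_wf_cat; split; [apply: H1 | apply: H2]; lia.
- move=> /and4P[? ? ? ?] ? ?; split; first split => /=; first lia.
    by move=> [[[]|]|]; lia.
  apply/all_wf_cat; split; first by apply: H0; lia.
  split; first by split => //= *; lia.
  apply/all_wf_cat; split; first by apply: HF; lia.
  split; first by split => //= *; lia.
  by apply: HT; lia.
- move=> ? ? ?; split; first by split => /= [|[?|]] /=; lia.
  apply/all_wf_cat; split; first by apply: H; lia.
  split; first by split => [|?] /=; lia.
  by split=> //; split => /= [|[?|]] /=; lia.
Qed.

Fixpoint code_at (code : seq instr) (off : nat) (blk : seq instr) : Prop :=
  if blk is x :: blk' then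
    [/\ off < size code, nth (jump 0) code off = x & code_at code off.+1 blk']
  else True.

Lemma code_at_cat code off b1 b2 :
  code_at code off (b1 ++ b2) <->
  code_at code off b1 /\ code_at code (off + size b1) b2.
Proof.
elim: b1 off => [|x b1 IH] off /=; first by rewrite addn0; tauto.
rewrite addnS -addSn; split.
  by move=> [? ?] /IH[? ?].
by move=> [[? ? ?] ?]; split=> //; apply/IH.
Qed.

Lemma code_at_pre pre blk post :
  code_at (pre ++ blk ++ post) (size pre) blk.
Proof.
elim: blk pre => [|x blk IH] pre //=; split.
- by rewrite !size_cat /=; lia.
- by rewrite nth_cat ltnn subnn.
- by have := IH (rcons pre x); rewrite size_rcons cat_rcons.
Qed.

Lemma fstep_at code off x T :
  code_at code off [:: x] ->
  fstep code (off, T) =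
    let: (a, d, pc') := x.2 (fread (T x.1)) in
    (pc', fupd T x.1 (fmove d (fwrite a (T x.1)))).
Proof. by case: x => i f [/= -> -> _]. Qed.

Lemma fstep_jump code off e T :
  code_at code off [:: jump e] -> fstep code (off, T) = (e, T).
Proof. by move=> /fstep_at ->; rewrite /= fwrite_read fupd_id. Qed.

Lemma stk_push b s :
  fwrite (Some (inl b)) (fmove MoveLeft (fwrite (fread (stk s)) (stk s))) = stk (b :: s).
Proof.
by rewrite fwrite_read /fwrite /stk /=; congr pair; apply: funext => -[].
Qed.

Lemma stk_pop s : fmove MoveRight (fwrite None (stk s)) = stk (behead s).
Proof.
rewrite /stk /fmove /fwrite /=; congr pair; first by apply: funext => -[].
by apply: funext => i; case: s => //=; rewrite /stail /= ?nth_nil.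
Qed.

Lemma ctr_right p q :
  fmove MoveRight (fwrite (fread (ctr p q.+1)) (ctr p q.+1)) = ctr p.+1 q.
Proof. by rewrite fwrite_read /ctr /fmove /= stail_nth scons_nth. Qed.

Lemma ctr_left p q :
  fmove MoveLeft (fwrite (fread (ctr p.+1 q)) (ctr p.+1 q)) = ctr p q.+1.
Proof. by rewrite fwrite_read /ctr /fmove /= stail_nth scons_nth. Qed.

Lemma ctr_turn q : fmove MoveRight (fmove MoveLeft (ctr 0 q)) = ctr 0 q.
Proof. by rewrite /ctr /fmove /=; congr pair; apply: funext => -[|[]]. Qed.

Lemma fread_stk s : fread (stk s) = if s is b :: _ then Some (inl b) else None.
Proof. by case: s. Qed.

Definition regs_of (B : nat) (s : store) (T : nat -> ftape) : nat -> ftape :=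
  fun j => if j < B then stk (s j) else T j.

Lemma regs_of_upd B s T i v :
  i < B -> fupd (regs_of B s T) i (stk v) = regs_of B (upd s i v) T.
Proof.
move=> iB; apply: funext => j; rewrite /fupd /regs_of /upd.
by case: eqP => // ->; rewrite iB.
Qed.

Lemma iter_trans (A : Type) (f : A -> A) k1 k2 x y z :
  iter k1 f x = y -> iter k2 f y = z -> iter (k2 + k1) f x = z.
Proof. by rewrite iterD => -> ->. Qed.

(** A mark under the head of the counter sends control into the body; the blank behind the last mark
    starts the rewinding, which ends by stepping right from the blank in front of the first mark.
    The body relies only on the counters beyond [B + d], so its specification survives the changes
    on tape [B + d]. *)
Lemma loopP B N c off d code t :
  code_at code off (compile B off d (Loop c)) ->
  (forall s T, (forall j, d < j < d.+1 + depth c -> T (B + j) = ctr 0 N) ->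
    exists2 k, k <= t & iter k (fstep code) (off.+1, regs_of B s T) =
      (off.+1 + clen c, regs_of B (exec N c s) T)) ->
  forall s T, (forall j, d <= j < d + (depth c).+1 -> T (B + j) = ctr 0 N) ->
  exists2 k, k <= N * (t + 2) + N + 2 &
    iter k (fstep code) (off, regs_of B s T) =
    (off + (clen c).+3, regs_of B (iter N (exec N c) s) T).
Proof.
move=> /= [oC nC /code_at_cat[_]]; rewrite size_compile => -[oJ nJ [oR nR _]] IH s T TP.
have regsB s' T' : regs_of B s' T' (B + d) = T' (B + d).
  by rewrite /regs_of ltnNge leq_addr.
have fupdB s' T' x : fupd (regs_of B s' T') (B + d) x = regs_of B s' (fupd T' (B + d) x).
  apply: funext => j; rewrite /fupd /regs_of; case: eqP => // ->.
  by rewrite ltnNge leq_addr.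
have fupdd T' x : fupd T' (B + d) x (B + d) = x by rewrite /fupd eqxx.
(* Here [p] rounds are done and [q] remain, with the head of the counter between them. *)
have iterP p q : p + q = N -> exists2 k, k <= q * (t + 2) &
    iter k (fstep code) (off, regs_of B (iter p (exec N c) s) (fupd T (B + d) (ctr p q))) =
    (off, regs_of B (iter N (exec N c) s) (fupd T (B + d) (ctr N 0))).
  elim: q p => [|q IHq] p pqN.
    by exists 0 => //; rewrite -pqN addn0.
  have [|k1 k1le E1] := IH (iter p (exec N c) s) (fupd T (B + d) (ctr p.+1 q)).
    by move=> j jP; rewrite /fupd ifN; [apply: TP|]; lia.
  have [|k2 k2le E2] := IHq p.+1; first by lia.
  exists (k2 + (1 + (k1 + 1))); first by nia.
  apply: (iter_trans _ E2); apply: (@iter_trans _ _ (k1 + 1)).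
    apply: (iter_trans _ E1).
    rewrite /= oC nC /= regsB fupdd.
    have -> : fread (ctr p q.+1) = Some (inl true) by [].
    rewrite fupdB; congr (_, regs_of _ _ _); apply: funext => j; rewrite /fupd.
    by case: eqP => // _; apply: ctr_right.
  by apply: fstep_jump; split.
(* Rewinding crosses the [p] marks to the left and needs one more step to turn around on the
   blank. *)
have back p q : p + q = N -> iter p.+1 (fstep code)
    ((off + clen c).+2, regs_of B (iter N (exec N c) s)
       (fupd T (B + d) (fmove MoveLeft (ctr p q)))) =
    (off + (clen c).+3, regs_of B (iter N (exec N c) s) T).
  elim: p q => [|p IHp] q pqN.
    rewrite /= -addSn oR nR regsB fupdd.
    have -> : fread (fmove MoveLeft (ctr 0 q)) = None by [].
    rewrite fwrite_same // fupdB ctr_turn !addnS.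
    congr (_, regs_of _ _ _); apply: funext => j; rewrite /fupd.
    by case: eqP => // ->; rewrite TP; [congr ctr; lia | lia].
  rewrite iterSr -(IHp q.+1); last by lia.
  congr (iter _ _ _); rewrite /fstep -addSn oR nR regsB fupdd.
  have -> : fread (fmove MoveLeft (ctr p.+1 q)) = Some (inl true) by [].
  rewrite fupdB !addSn; congr (_, regs_of _ _ _).
  apply: funext => j; rewrite /fupd; case: eqP => // _.
  rewrite fwrite_same //; congr (fmove _ _).
  by rewrite -[in RHS]ctr_left fwrite_read.
have [|k1 k1le E1] := iterP 0 N; first by rewrite add0n.
exists (N.+1 + (1 + k1)); first by lia.
have E0 : fupd T (B + d) (ctr 0 N) = T.
  by rewrite -(TP d) ?fupd_id //; lia.
rewrite /= E0 in E1.
apply: (iter_trans _ (back N 0 (addn0 _))); apply: (iter_trans E1).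
rewrite /= oC nC /= regsB fupdd; have -> : fread (ctr N 0) = None by [].
rewrite fupdB; congr (_, regs_of _ _ _).
apply: funext => j; rewrite /fupd; case: eqP => // _.
by rewrite fwrite_same.
Qed.

(** The same [T] occurs before and after the run: every counter is back in its initial position when
    the code ends, which is what allows a loop body to be run again. *)
Lemma compileP B N c off d s T code :
  regs_lt B c -> code_at code off (compile B off d c) ->
  (forall j, d <= j < d + depth c -> T (B + j) = ctr 0 N) ->
  exists2 k, k <= ctime N c &
    iter k (fstep code) (off, regs_of B s T) =
    (off + clen c, regs_of B (exec N c s) T).
Proof.
elim: c off d s T => [|i b|i|c1 H1 c2 H2|i c0 H0 cF HF cT HT|c H] off d s T.
- by move=> _ _ _; exists 0; rewrite ?addn0.
- move=> /= iB [o1 n1 [o2 n2 _]] _; exists 2 => //=.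
  rewrite o1 n1 /= o2 n2 /= addn2; congr pair.
  rewrite -regs_of_upd // -stk_push; apply: funext => j; rewrite /fupd.
  by case: eqP => // _; rewrite eqxx /regs_of iB.
- move=> /= iB [o1 n1 _] _; exists 1 => //=.
  rewrite o1 n1 addn1 -regs_of_upd // -stk_pop; congr pair.
  by rewrite {2}/regs_of iB.
- move=> /= /andP[r1 r2] /code_at_cat[A1]; rewrite size_compile => A2 HT.
  have [|k1 k1le E1] := H1 off d s T r1 A1.
    by move=> j jP; apply: HT; lia.
  have [|k2 k2le E2] := H2 (off + clen c1) d (exec N c1 s) T r2 A2.
    by move=> j jP; apply: HT; lia.
  exists (k2 + k1); first lia.
  by apply: iter_trans E1 _; rewrite E2 addnA.
- move=> /= /and4P[iB r0 rF rT] [o1 n1 /code_at_cat[A0]]; rewrite size_compile.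
  move=> /= [oj nj /code_at_cat[AF]]; rewrite size_compile => /= -[oj' nj' AT] HC.
  set e := _ + clen cT in n1 nj nj'.
  have -> : off + (clen c0 + clen cF + clen cT).+3 = e by rewrite /e; lia.
  have step1 : iter 1 (fstep code) (off, regs_of B s T) =
    (match s i with [::] => off.+1 | b :: _ =>
       if b then ((off + clen c0).+2 + clen cF).+1 else (off + clen c0).+2 end,
     regs_of B s T).
    rewrite /= o1 n1 /= fwrite_read fupd_id; congr pair.
    by rewrite /regs_of iB fread_stk; case: (s i) => [|[]].
  case Esi: (s i) step1 => [|[] l] step1.
  + have [|k kle E] := H0 off.+1 d s T r0 A0.
      by move=> j jP; apply: HC; lia.
    exists (1 + (k + 1)); first lia.
    rewrite iterD (iter_trans step1 E).
    by rewrite /= oj nj /= fwrite_read fupd_id.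
  + have [||k kle E] := HT (((off + clen c0).+2 + clen cF).+1) d s T rT.
    * by move: AT; rewrite !addSn.
    * by move=> j jP; apply: HC; lia.
    exists (k + 1); first lia.
    by apply: iter_trans step1 E.
  + have [||k kle E] := HF ((off + clen c0).+2) d s T rF.
    * by move: AF; rewrite !addSn.
    * by move=> j jP; apply: HC; lia.
    exists (1 + (k + 1)); first lia.
    rewrite iterD (iter_trans step1 E).
    by rewrite !addSn in oj' nj' *; rewrite /= oj' nj' /= fwrite_read fupd_id.
- move=> /= rc cE TP; apply: (loopP cE) => // s' T' TP'.
  case: cE => [_ _ /code_at_cat[A _]].
  by apply: (H off.+1 d.+1 s' T' rc A) => j jP; apply: TP'; lia.
Qed.

End Flow.

(** * Running a flow chart after a Turing machine *)

Section FlowAfter.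
Variables (M : machine) (code : seq (instr (tm_extra M))) (J : nat).
Hypothesis code_wf : all_wf J.+1 (size code) code.

Let a := tm_ntapes M.
Let sym := option (bool + tm_extra M).

(* Tape [j] of the flow chart is the [j]-th tape counted from the last one, so
   that its tape [J] is the output tape of [M]. *)
Definition own (j : nat) : 'I_(a + J).+1 := inord (a + J - j).
Definition low (i : 'I_a.+1) : 'I_(a + J).+1 := inord i.

(** A halting state of [M] does not halt the combined machine; it costs one handover step that
    writes back what it reads and starts the flow chart, and the machine halts when the program
    counter leaves the code. *)
Definition flow_after : machine :=
  @Machine (tm_extra M) (tm_state M + 'I_(size code).+1)%type (a + J)
    (inl (tm_start M))
    (fun q => if q is inr pc then size code <= pc else false)
    (fun q reads =>
       match q with
       | inl q =>
           if tm_halted q then (inr ord0, fun i => (reads i, Stay))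
           else let: (q', act) := tm_delta q [ffun i => reads (low i)] in
             (inl q', fun i : 'I_(a + J).+1 =>
                if i <= a then act (inord i) else (reads i, Stay))
       | inr pc =>
           let: (i, f) := nth (jump _ 0) code pc in
           let r := f (reads (own i)) in
           (inr (inord r.2), fun j => if j == own i then r.1 else (reads j, Stay))
       end).

Lemma low_val i : low i = i :> nat.
Proof. by rewrite /low inordK // ltnS; have := ltn_ord i; lia. Qed.

Lemma own_val j : own j = a + J - j :> nat.
Proof. by rewrite /own inordK // ltnS leq_subr. Qed.

Lemma own_inj j j' : j <= J -> j' <= J -> (own j == own j') = (j == j').
Proof. by move=> jJ jJ'; rewrite -val_eqE /= !own_val; apply/eqP/eqP; lia. Qed.

Lemma abs_keep (t : tape (bool + tm_extra M)) :
  abs_tape (tape_move Stay (tape_write (tape_read t) t)) = abs_tape t.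
Proof. by rewrite abs_move abs_write -abs_read fwrite_read. Qed.

(** The tapes beyond those of [M] are compared as streams: each step writes a blank back onto them,
    which turns an empty list of cells into a list with one explicit blank. *)
Definition sim_low (c : tm_config M) (c' : tm_config flow_after) : Prop :=
  [/\ c'.1 = inl c.1, forall i, c'.2 (low i) = c.2 i
    & forall i : 'I_(a + J).+1, a < i -> abs_tape (c'.2 i) = stk _ [::]].

Lemma sim_low_init w : sim_low (tm_init M w) (tm_init flow_after w).
Proof.
split=> //= i.
  by rewrite -!val_eqE /= low_val.
rewrite -val_eqE /=; case: eqP => [->//|_] _.
by rewrite /abs_tape /stk /=; congr pair; apply: funext => k; rewrite nth_nil.
Qed.

Lemma sim_low_step c c' : sim_low c c' -> ~~ tm_halted c.1 ->
  sim_low (tm_step c) (tm_step c').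
Proof.
case: c c' => [q ts] [q' ts'] [/= -> Hlow Hhi] nh /=; rewrite (negPf nh) /tm_step /=.
have -> : [ffun i => ([ffun i0 => tape_read (ts' i0)] : {ffun _ -> sym}) (low i)] =
    [ffun i => tape_read (ts i)].
  by apply/ffunP => i; rewrite !ffunE Hlow.
case: tm_delta => q1 act; split=> //= i.
  have lei : low i <= a by rewrite low_val -ltnS.
  have -> : inord (low i) = i by apply/val_inj; rewrite /= inordK ?ltnS // low_val.
  by rewrite lei Hlow.
by move=> ai; rewrite leqNgt ai /= ffunE (@abs_keep (ts' i)) Hhi.
Qed.

(** [M] idles once it has halted, whereas the combined machine goes on with the flow chart. The
    simulation is therefore stopped at the first halting time [t] instead of [T]. *)
Lemma sim_low_halt T c c' : sim_low c c' -> tm_halted (iter T (@tm_step M) c).1 ->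
  exists2 t, t <= T &
    sim_low (iter T (@tm_step M) c) (iter t (@tm_step flow_after) c').
Proof.
have fixed T' (c0 : tm_config M) : tm_halted c0.1 -> iter T' (@tm_step M) c0 = c0.
  by case: c0 => q ts h; elim: T' => //= T' ->; rewrite /tm_step /= h.
elim: T c c' => [|T IH] c c' sim h; first by exists 0.
have [hc|nhc] := boolP (tm_halted c.1).
  by exists 0 => //; rewrite fixed.
rewrite iterSr in h *.
have [t le st] := IH _ _ (sim_low_step sim nhc) h.
by exists t.+1 => //; rewrite !iterSr.
Qed.

Definition sim_own (c : flow_config (tm_extra M)) (c' : tm_config flow_after) : Prop :=
  [/\ c.1 <= size code, c'.1 = inr (inord c.1)
    & forall j, j <= J -> abs_tape (c'.2 (own j)) = c.2 j].

Lemma sim_own_step c c' : sim_own c c' -> sim_own (fstep code c) (tm_step c').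
Proof.
case: c c' => [pc T] [q ts] [/= pcle -> HT] /=; rewrite inordK ?ltnS //.
case: ltnP => [lt|ge]; last by split=> //=; rewrite inordK.
have [iJ fL] := all_wf_nth code_wf lt.
case: nth iJ fL => i f /= iJ fL.
rewrite ffunE -abs_read HT ?ltnS //.
have := fL (fread (T i)); case E : (f _) => [[b d] pc'] /= pc'L.
split=> // j jJ.
change (abs_tape (tape_move (if own j == own i then (b, d) else
  (([ffun i => tape_read (ts i)] : {ffun _ -> sym}) (own j), Stay)).2
  (tape_write (if own j == own i then (b, d) else
  (([ffun i => tape_read (ts i)] : {ffun _ -> sym}) (own j), Stay)).1 (ts (own j)))) =
  fupd T i (fmove d (fwrite b (T i))) j).
rewrite own_inj // /fupd; case: eqP => [->|_].
  by rewrite abs_move abs_write HT.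
by rewrite ffunE (@abs_keep (ts (own j))) HT.
Qed.

Lemma sim_own_iter k c c' : sim_own c c' ->
  sim_own (iter k (fstep code) c) (iter k (@tm_step flow_after) c').
Proof. by elim: k => //= k IH sim; apply/sim_own_step/IH. Qed.

Lemma sim_handover c c' : sim_low c c' -> tm_halted c.1 ->
  exists2 T : nat -> ftape _, sim_own (0, T) (tm_step c') &
    T J = abs_tape (c.2 ord_max) /\ forall j, j < J -> T j = stk _ [::].
Proof.
case: c c' => [q ts] [q' ts'] [/= -> Hlow Hhi] h; rewrite h /=.
exists (fun j => abs_tape (ts' (own j))).
  split=> //=; first by congr inr; apply/val_inj; rewrite /= inordK.
  by move=> j jJ; rewrite ffunE (@abs_keep (ts' (own j))).
split.
  have -> : own J = low ord_max by apply/val_inj; rewrite /= own_val low_val /=; lia.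
  by rewrite Hlow.
by move=> j jJ; rewrite Hhi // own_val; lia.
Qed.

Lemma flow_after_fixed (c : tm_config flow_after) k :
  tm_halted c.1 -> iter k (@tm_step flow_after) c = c.
Proof. by case: c => q ts h; elim: k => //= k ->; rewrite /tm_step h. Qed.

End FlowAfter.

Lemma size_tape_step M (c : tm_config M) i :
  size (tape_right ((tm_step c).2 i)) <= size (tape_right (c.2 i)) + 2.
Proof.
case: c => q ts; rewrite /tm_step; case: ifP => [_|_] /=; first lia.
case: tm_delta => q' act /=.
case: (ts i) => l r; case: (act i) => [s d]; rewrite /tape_write /=.
by case: d; case: r => [|? ?] /=; lia.
Qed.

(** The running time bounds the length of the output, hence the input length of whatever runs
    next. *)
Lemma size_tm_output M T w :
  size (tm_output (iter T (@tm_step M) (tm_init M w))) <= size w + 2 * T.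
Proof.
have lb s : size (@leading_bits M s) <= size s.
  by elim: s => [|[[b|x]|] s IH] //=; rewrite ltnS.
apply: leq_trans (lb _) _.
suff H i : size (tape_right ((iter T (@tm_step M) (tm_init M w)).2 i)) <= size w + 2 * T.
  exact: H.
elim: T => [|T IH] /=; last by apply: leq_trans (size_tape_step _ _) _; lia.
by case: eqP => _; rewrite /= ?size_map; lia.
Qed.

(** * Programs compute polynomial time functions *)

(** The reversal comes from pushing the bits of the tape on a stack in the order in which they are
    read. *)
Definition program_init (w : word) : store := fun i => if i == 1 then rev w else [::].

(* The program finds its input, reversed, in register 1 and leaves its output
   in register 0. *)
Definition program_computes (K : nat) (c : cmd) (g : word -> word) : Prop :=
  forall w, exec (K * size w + K) c (program_init w) 0 = g w.

Definition seqc (s : seq cmd) : cmd := foldr Seq Skip s.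

Lemma exec_seqc N s st : exec N (seqc s) st = foldl (fun st c => exec N c st) st s.
Proof. by elim: s st => //= c s IH st; rewrite IH. Qed.

Lemma code_at_blocks X (x y : instr X) b1 b2 b3 b4 code :
  code = x :: b1 ++ y :: b2 ++ y :: b3 ++ b4 ->
  let o2 := 1 + (size b1).+1 in let o3 := o2 + (size b2).+1 in
  [/\ code_at code 1 b1, code_at code o2 b2, code_at code o3 b3,
      code_at code (o3 + size b3) b4 &
      code_at code (1 + size b1) [:: y] /\ code_at code (o2 + size b2) [:: y]].
Proof.
move=> cE o2 o3.
have : code_at code 0 (x :: b1 ++ y :: b2 ++ y :: b3 ++ b4).
  have H b : code = b -> code_at code 0 b.
    by move=> <-; have := code_at_pre [::] code [::]; rewrite cats0.
  exact: H.
rewrite -(cat1s x) => /code_at_cat[_ /code_at_cat[A1]].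
rewrite -(cat1s y (b2 ++ _)) => /code_at_cat[A2 /code_at_cat[]].
rewrite add0n -[size [:: _]]/1 in A1 A2 * => A3.
rewrite -(cat1s y (b3 ++ _)) => /code_at_cat[A4 /code_at_cat[]].
rewrite -[size [:: _]]/1 -[1 + size b1 + 1]addnA addn1 in A3 A4 *.
by rewrite -[_ + size b2 + 1]addnA addn1.
Qed.

Section PolytimeProgram.
Variables (X : finType) (B K : nat) (c : cmd).
Hypotheses (B2 : 1 < B) (cB : regs_lt B c).
Let D := depth c.
Let J := B + D.
Let sym := option (bool + X).

(** Run once per input bit and once more at the end, this leaves [K * size w + K] marks on each of
    the [D] counter tapes, so the loop bound is set up without any arithmetic. *)
Definition push_counters : cmd :=
  seqc [seq Push j true | j <- flatten (nseq K (iota B D))].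
Definition read_bit (b : bool) : cmd := Seq (Push 1 b) push_counters.

Let oF := 1.
Let oT := oF + (clen (read_bit false)).+1.
Let oI := oT + (clen (read_bit true)).+1.
Let oM := oI + clen push_counters.

(** While the input is read from tape [J], the counters of [c] are ordinary registers, so this phase
    is compiled with [J] registers. Then [c] is compiled with [B] registers and finds its counters
    filled on the tapes from [B] to [J - 1]. *)
Definition whole_code : seq (instr X) :=
  (J, fun s => match s with
               | Some (inl true) => (s, MoveRight, oT)
               | Some (inl false) => (s, MoveRight, oF)
               | _ => (s, Stay, oI)
               end) ::
  compile X J oF 0 (read_bit false) ++ jump X 0 ::
  compile X J oT 0 (read_bit true) ++ jump X 0 ::
  compile X J oI 0 push_counters ++ compile X B oM 0 c.

Lemma regs_push_counters : regs_lt J push_counters /\ depth push_counters = 0.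
Proof.
rewrite /push_counters; elim: K => //= k [IHr IHd].
rewrite map_cat; move: IHr IHd; set s := [seq _ | j <- flatten _] => IHr IHd.
have: all (fun j => j < J) (iota B D).
  by apply/allP => j; rewrite mem_iota /J => /andP[].
elim: (iota B D) => //= j l IH /andP[jJ /IH[lr ld]].
by rewrite jJ lr ld.
Qed.

Lemma exec_push_counters N s j :
  exec N push_counters s j =
    if B <= j < J then nseq K true ++ s j else s j.
Proof.
rewrite /push_counters exec_seqc; elim: K s => [|k IH] s; first by case: ifP.
rewrite /= map_cat foldl_cat IH {IH} /J.
have E l s' : uniq l -> foldl (fun st c => exec N c st) s' [seq Push j true | j <- l] j =
    if j \in l then true :: s' j else s' j.
  elim: l s' => //= x l IH s' /andP[xl ul]; rewrite IH // /upd inE.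
  by case: eqP => [->|]; rewrite ?(negPf xl).
rewrite E ?iota_uniq // mem_iota; case: (B <= j < B + D) => //.
by elim: k => //= k ->.
Qed.

Lemma size_whole_code : size whole_code = oM + clen c.
Proof.
rewrite /whole_code /= size_cat /= size_cat /= size_cat !size_compile /oM /oI /oT /oF.
by rewrite /read_bit /=; lia.
Qed.

Lemma whole_code_wf : all_wf J.+1 (size whole_code) whole_code.
Proof.
have [pr pd] := regs_push_counters.
have J0 : 1 < J by rewrite /J; lia.
rewrite size_whole_code; set L := oM + _.
have o1 : oF + clen (read_bit false) <= L by rewrite /L /oM /oI /oT; lia.
have o2 : oT + clen (read_bit true) <= L by rewrite /L /oM /oI; lia.
have o3 : oI + clen push_counters <= L by rewrite /L /oM; lia.
split.
  split; first by [].
  by move=> [[[]|]|] /=; lia.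
apply/all_wf_cat; split.
  by apply: compile_all_wf => //; rewrite /= ?pr ?pd ?J0 ?andbT //; lia.
split; first by split.
apply/all_wf_cat; split.
  by apply: compile_all_wf => //; rewrite /= ?pr ?pd ?J0 ?andbT //; lia.
split; first by split.
apply/all_wf_cat; split.
  by apply: compile_all_wf => //; rewrite /= ?pr ?pd ?J0 ?andbT //; lia.
by apply: compile_all_wf; rewrite // /J; lia.
Qed.

Lemma whole_code_at :
  [/\ code_at whole_code oF (compile X J oF 0 (read_bit false)),
      code_at whole_code oT (compile X J oT 0 (read_bit true)),
      code_at whole_code oI (compile X J oI 0 push_counters),
      code_at whole_code oM (compile X B oM 0 c) &
      code_at whole_code (oF + clen (read_bit false)) [:: jump X 0] /\
      code_at whole_code (oT + clen (read_bit true)) [:: jump X 0]].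
Proof.
have [] := @code_at_blocks X _ (jump X 0) (compile X J oF 0 (read_bit false))
  (compile X J oT 0 (read_bit true)) (compile X J oI 0 push_counters)
  (compile X B oM 0 c) whole_code (erefl _).
by rewrite !size_compile.
Qed.

End PolytimeProgram.

Lemma leading_bits_nth M (r : seq (option (bool + tm_extra M))) (v : word) :
  nth None r =1 nth None (bits _ v) -> leading_bits r = v.
Proof.
elim: r v => [|x r IH] [|b v] //= E.
- by have := E 0.
- by have := E 0 => /= ->.
- have /= -> := E 0; congr cons; apply: IH => i; exact: (E i.+1).
Qed.

Section PolytimeComposition.
Variables (M : machine) (B K : nat) (c : cmd).
Hypotheses (B2 : 1 < B) (cB : regs_lt B c).
Let X := tm_extra M.
Let D := depth c.
Let J := B + D.
Let code := whole_code X B K c.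
Let R := ctime 0 (read_bit B K c true).

(** The reader stops at the first cell that does not hold a bit, just as [leading_bits] does, so
    what [M] left behind that cell does no harm. *)
Lemma read_input r (L : nat -> option (bool + X)) s T :
  T J = (L, nth None r) ->
  exists2 k, k <= size (@leading_bits M r) * (R + 2) + 1 &
  exists T', iter k (fstep code) (0, regs_of J s T) =
    (1 + (clen (read_bit B K c false)).+1 + (clen (read_bit B K c true)).+1,
     regs_of J (foldl (fun s b => exec 0 (read_bit B K c b) s) s (leading_bits r)) T').
Proof.
have [AF AT _ _ [jF jT]] := whole_code_at X B K c.
have [pr pd] := regs_push_counters B K c.
have J1 : 1 < J by rewrite /J; lia.
have JJ s' T' : regs_of J s' T' J = T' J by rewrite /regs_of ltnn.
elim: r L s T => [|x r IH] L s T TJ.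
  exists 1 => //=; exists T; rewrite -/J JJ TJ /= /fwrite /=; congr pair.
  apply: funext => j; rewrite /fupd; case: eqP => // ->; rewrite JJ TJ.
  by congr pair; apply: funext => -[].
have readE : fread (regs_of J s T J) = x by rewrite JJ TJ.
have fupdJ s' T' y : fupd (regs_of J s' T') J y = regs_of J s' (fupd T' J y).
  by apply: funext => j; rewrite /fupd /regs_of; case: eqP => // ->; rewrite ltnn.
have bitP b o : x = Some (inl b) ->
    code_at code o (compile X J o 0 (read_bit B K c b)) ->
    code_at code (o + clen (read_bit B K c b)) [:: jump X 0] ->
    fstep code (0, regs_of J s T) = (o, regs_of J s (fupd T J (fmove MoveRight (T J)))) ->
    exists2 k, k <= R + 2 & exists2 T', T' J = fmove MoveRight (T J) &
      iter k (fstep code) (0, regs_of J s T) =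
      (0, regs_of J (exec 0 (read_bit B K c b) s) T').
  move=> xE Ab jb st1.
  have [||k kle E] := @compileP X J 0 (read_bit B K c b) o 0 s (fupd T J (fmove MoveRight (T J))) code _ Ab.
  - by rewrite /= J1.
  - by move=> j; rewrite /= pd; lia.
  exists (1 + (k + 1)); first by move: kle; rewrite /R /=; lia.
  exists (fupd T J (fmove MoveRight (T J))); first by rewrite /fupd eqxx.
  rewrite iterD [iter (k + 1) _ _](iter_trans (k1 := 1) st1 E).
  by rewrite /=; apply: fstep_jump.
case: x TJ readE bitP => [[b|y]|] TJ readE bitP; first last.
- exists 1 => //=; exists T; rewrite -/J readE /=; congr pair.
  by rewrite fwrite_same // fupd_id.
- exists 1 => //=; exists T; rewrite -/J readE /=; congr pair.
  by rewrite fwrite_same // fupd_id.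
have [|||k kle [T' T'J E]] := bitP b
   (if b then 1 + (clen (read_bit B K c false)).+1 else 1) (erefl _).
- by case: (b).
- by case: (b).
- rewrite /fstep /= -/J readE -fupdJ.
  by case: (b) readE => readE; rewrite fwrite_same // JJ.
have [|k' k'le [T'' E'']] := IH (scons (Some (inl b)) L) (exec 0 (read_bit B K c b) s) T'.
  by rewrite T'J TJ /fmove /= stail_nth.
exists (k' + k); first by rewrite /=; lia.
by exists T''; apply: iter_trans E _; rewrite E''.
Qed.

Lemma read_store w s j :
  foldl (fun s b => exec 0 (read_bit B K c b) s) s w j =
    if j == 1 then rev w ++ s 1 else
    if B <= j < J then nseq (K * size w) true ++ s j else s j.
Proof.
elim: w s => [|b w IH] s /=; first by rewrite muln0; case: eqP => [->//|_]; case: ifP.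
rewrite IH !exec_push_counters // /upd /= rev_cons cat_rcons.
case: (j =P 1) => [_|_]; first by rewrite leqNgt B2.
rewrite -/D -/J; case: (B <= j < J) => //.
by rewrite catA -nseqD addnC -mulnS.
Qed.

Lemma run_program r (L : nat -> option (bool + X)) T g w :
  leading_bits r = w ->
  exec (K * size w + K) c (program_init w) 0 = g ->
  T J = (L, nth None r) -> (forall j, j < J -> T j = stk _ [::]) ->
  exists2 k, k <= size w * (R + 2) + 1 + R + ctime (K * size w + K) c &
  exists2 T', iter k (fstep code) (0, T) = (size code, T') & T' 0 = stk _ g.
Proof.
move=> wE gE TJ Tlow.
have [_ _ AI AM _] := whole_code_at X B K c.
have [pr pd] := regs_push_counters B K c.
have [k1 k1le [T1 E1]] := read_input (fun=> [::]) TJ.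
rewrite wE in E1 k1le.
set s1 := foldl _ _ _ in E1.
have [||k2 k2le E2] := @compileP X J 0 _ _ 0 s1 T1 _ _ AI.
- exact: pr.
- by move=> j; rewrite pd; lia.
set s2 := exec 0 _ s1 in E2; set N := K * size w + K in gE *.
have s2E j : s2 j = if j == 1 then rev w else
    if B <= j < J then nseq N true else [::].
  rewrite /s2 exec_push_counters // -/J /s1 read_store.
  case: eqP => [->|_]; first by rewrite leqNgt B2 /= cats0.
  by rewrite -/D -/J; case: (B <= j < J) => //; rewrite cats0 -nseqD addnC.
have [|k3 k3le E3] := @compileP X B N _ _ 0 (program_init w) (regs_of J s2 T1) _ cB AM.
  move=> j /andP[_ jP]; rewrite /regs_of ltn_add2l jP s2E ctr0.
  rewrite leq_addr ltn_add2l jP ifN //; lia.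
(* After the reading phase the registers below [B] already have their values from [program_init w];
   the tapes from [B] on are now seen as counters. *)
have TE : regs_of B (program_init w) (regs_of J s2 T1) = regs_of J s2 T1.
  apply: funext => j; rewrite /regs_of; case: ltnP => // jB.
  rewrite (leq_trans jB) ?leq_addr // s2E /program_init; case: eqP => // _.
  by rewrite leqNgt jB.
have T0E : regs_of J (fun=> [::]) T = T.
  by apply: funext => j; rewrite /regs_of; case: ltnP => // /Tlow ->.
rewrite T0E in E1; rewrite TE in E3.
exists (k3 + (k2 + k1)).
  by move: k1le k2le k3le; rewrite /R /=; lia.
exists (regs_of B (exec N c (program_init w)) (regs_of J s2 T1)).
  rewrite /code size_whole_code //; apply: (iter_trans _ E3).
  by apply: iter_trans E1 E2.
by rewrite /regs_of ifT ?gE //; lia.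
Qed.

End PolytimeComposition.

Theorem polytime_comp_program B K c f g : 1 < B -> regs_lt B c ->
  polytime f -> program_computes K c g -> polytime (fun w => g (f w)).
Proof.
move=> B2 cB [M [c0 [d0 fP]]] gP.
pose T0 n := c0 * n ^ d0 + c0.
pose R := ctime 0 (read_bit B K c true).
have [h1 [h2 hP]] : polybounded (fun m => m * (R + 2) + 1 + R + ctime (K * m + K) c).
  apply: polybounded_add; first by do ?[exact: polybounded_const | exact: polybounded_id
      | apply: polybounded_add | apply: polybounded_mul].
  by apply: (@polybounded_comp (fun m => K * m + K) (fun N => ctime N c)); [do ?[exact: polybounded_const | exact: polybounded_id
      | apply: polybounded_add | apply: polybounded_mul] | apply: ctime_polybounded].
(* [n + 2 * T0 n] bounds the length of [f w], and the summand 1 is the handover step. *)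
have [cc [dd ccP]] : exists c d, forall n,
    T0 n + 1 + h1 * (n + 2 * T0 n).+1 ^ h2 <= c * n ^ d + c.
  apply: polybounded_std; apply: polybounded_add.
    by apply: polybounded_add; [exact: polybounded_monomial | exact: polybounded_const].
  apply: (@polybounded_comp (fun n => n + 2 * T0 n) (fun m => h1 * m.+1 ^ h2)).
    apply: polybounded_add; first exact: polybounded_id.
    by apply: polybounded_mul; [exact: polybounded_const | exact: polybounded_monomial].
  by exists h1, h2.
exists (flow_after (whole_code (tm_extra M) B K c) (B + depth c)), cc, dd => w.
have wf := whole_code_wf (tm_extra M) K B2 cB.
have [hw ow] := fP w.
have [t tle simt] := sim_low_halt
  (sim_low_init (whole_code (tm_extra M) B K c) (B + depth c) w) hw.
have [T simT [TJ Tlow]] := sim_handover simt hw.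
have [k kle [T' E T'0]] := run_program B2 cB ow (gP _) TJ Tlow.
have szf : size (f w) <= size w + 2 * T0 (size w).
  by rewrite -ow; apply: size_tm_output.
have := @sim_own_iter M _ _ wf k _ _ simT; rewrite E => -[_ q1 q2].
have hle : k + 1 + t <= cc * size w ^ dd + cc.
  apply: leq_trans (ccP _); have := hP (size (f w)).
  have : h1 * (size (f w)).+1 ^ h2 <= h1 * (size w + 2 * T0 (size w)).+1 ^ h2.
    by rewrite leq_mul2l leq_expl ?orbT.
  by move: kle tle; rewrite -/R -/(T0 _); lia.
set c1 := iter k _ _ in q1 q2.
(* The machine has halted after [k + 1 + t] steps, so running on to the time bound changes
   nothing. *)
have fin : iter (cc * size w ^ dd + cc) (@tm_step (flow_after (whole_code (tm_extra M) B K c) (B + depth c)))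
    (tm_init _ w) = c1.
  rewrite -(subnK hle) iterD iterD iterD.
  by rewrite flow_after_fixed // q1 /= inordK.
rewrite /tm_computes_within fin; split; first by rewrite q1 /= inordK.
apply: leading_bits_nth => i.
have E0 := etrans (q2 0 (leq0n _)) T'0.
have ownE : own M (B + depth c) 0 = ord_max.
  by apply/val_inj; rewrite /= own_val subn0.
rewrite ownE in E0.
have E1 : nth None (tape_right (c1.2 ord_max)) = nth None (bits _ (g (f w))).
  exact: (congr1 snd E0).
by rewrite -E1.
Qed.

(** A machine with a single tape that is halted from the start: its input tape is its output
    tape. *)
Lemma polytime_id : polytime id.
Proof.
exists (@Machine void unit 0 tt (fun=> true) (fun q _ => (q, fun=> (None, Stay)))), 0, 0 => w.
by split=> //=; rewrite /tm_output /=; elim: w => //= b w ->.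
Qed.

(** * Subroutines *)

Definition una (k : nat) : word := nseq k true.
Definition sto (l : seq word) : store := nth [::] l.

Arguments exec : simpl never.
Arguments una : simpl never.

Lemma unaS k : una k.+1 = true :: una k. Proof. by []. Qed.
Lemma una0 : una 0 = [::]. Proof. by []. Qed.
Lemma size_una k : size (una k) = k. Proof. exact: size_nseq. Qed.
Lemma cons_una k : true :: una k = una k.+1. Proof. by []. Qed.
Lemma una_cat k l : una k ++ una l = una (k + l).
Proof. by rewrite /una nseqD. Qed.

Lemma upd_sto l i v : upd (sto l) i v = sto (set_nth [::] l i v).
Proof. by apply: funext => j; rewrite /upd /sto nth_set_nth. Qed.

Lemma stoE l i : sto l i = nth [::] l i. Proof. by []. Qed.

Lemma exec_skip N s : exec N Skip s = s. Proof. by []. Qed.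
Lemma exec_seq N c1 c2 s : exec N (Seq c1 c2) s = exec N c2 (exec N c1 s).
Proof. by []. Qed.
Lemma exec_push N i b s : exec N (Push i b) s = upd s i (b :: s i).
Proof. by []. Qed.
Lemma exec_pop N i s : exec N (Pop i) s = upd s i (behead (s i)).
Proof. by []. Qed.
Lemma exec_loop N c s : exec N (Loop c) s = iter N (exec N c) s.
Proof. by []. Qed.
Lemma exec_if N i c0 cF cT s : exec N (If i c0 cF cT) s =
  match s i with
  | [::] => exec N c0 s
  | b :: _ => if b then exec N cT s else exec N cF s
  end.
Proof. by []. Qed.

Definition execE := (exec_seq, exec_push, exec_pop, exec_skip, exec_if, upd_sto, stoE).

Notation "c1 ;; c2" := (Seq c1 c2) (at level 61, right associativity).

(** The way to reason about loops with a fixed number of rounds: the body reaches its result within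
    [k] rounds and idles from then on. *)
Lemma iter_stable (A : Type) (f : A -> A) k N s s' :
  k <= N -> iter k f s = s' -> f s' = s' -> iter N f s = s'.
Proof.
move=> le E fix_s'; rewrite -(subnK le) iterD E.
by elim: (N - k) => //= m ->.
Qed.

Lemma iter_count (A : Type) (f : A -> A) (S : nat -> nat -> A) N a b :
  (forall a b, f (S a.+1 b) = S a b.+1) -> (forall b, f (S 0 b) = S 0 b) ->
  a <= N -> iter N f (S a b) = S 0 (a + b).
Proof.
move=> fS f0 le; apply: (iter_stable le) => //.
elim: a b {le} => // a IH b; rewrite iterSr fS IH; congr S; lia.
Qed.

Ltac upd_ext :=
  let j := fresh "j" in
  apply: funext => j; rewrite /upd;
  repeat match goal with
  | |- context [?x == ?y] => case: (x =P y) => [?|?]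
  end; try subst j; rewrite ?eqxx; try done; try congruence.

(** Subroutines are locked so that simplification treats them as primitive commands, each with its
    own execution lemma. *)
Definition Clear (i : nat) : cmd := locked (Loop (Pop i)).

Lemma exec_clear N i s : size (s i) <= N -> exec N (Clear i) s = upd s i [::].
Proof.
move=> szN; rewrite /Clear -lock exec_loop.
have E : s = upd s i (s i) by upd_ext.
rewrite [in LHS]E; apply: (iter_stable szN); last by rewrite exec_pop; upd_ext.
elim: (s i) {E szN} => // b w IH; rewrite [size _]/= iterSr exec_pop -IH.
by congr (iter _ _ _); upd_ext.
Qed.

(* Register 2 is the scratch register of the subroutines; it is empty between
   calls. *)
Definition Dup (i o : nat) : cmd := locked
  (Loop (If i Skip Skip (Pop i ;; Push 2 true ;; Push o true)) ;;
   Loop (If 2 Skip Skip (Pop 2 ;; Push i true))).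

Lemma exec_dup_upd N i o k s : i != 2 -> o != 2 -> i != o ->
  s i = una k -> s 2 = [::] -> k <= N ->
  exec N (Dup i o) s = upd s o (una k ++ s o).
Proof.
move=> /eqP i2 /eqP o2 /eqP io si s2 kN; rewrite /Dup -lock exec_seq !exec_loop.
pose S1 a b := upd (upd (upd s i (una a)) 2 (una b)) o (una b ++ s o).
have sE : s = S1 k 0 by rewrite /S1; upd_ext.
rewrite [in LHS]sE (@iter_count _ _ S1) //; first last.
- by move=> b; rewrite exec_if /S1 /upd !(introF eqP io, introF eqP i2) eqxx.
- move=> a b; rewrite exec_if {1}/S1 /upd !(introF eqP io, introF eqP i2) eqxx.
  rewrite unaS /= !execE /S1; upd_ext.
pose S2 b a := upd (upd (upd s i (una a)) 2 (una b)) o (una k ++ s o).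
have -> : S1 0 (k + 0) = S2 k 0 by rewrite /S1 addn0.
rewrite (@iter_count _ _ S2) //; first last.
- move=> b; rewrite exec_if /S2 /upd /=.
  by rewrite !ifN_eqC //; apply/eqP.
- move=> a b; rewrite exec_if {1}/S2 /upd.
  rewrite (introF eqP (not_eq_sym o2)) eqxx unaS /= !execE /S2; upd_ext.
rewrite /S2 addn0; upd_ext.
Qed.

Lemma exec_dup N i o k s : [&& i != 2, o != 2 & i != o] ->
  s i = una k -> s 2 = [::] -> k <= N ->
  exec N (Dup i o) s = upd s o (una k ++ s o).
Proof. by case/and3P; apply: exec_dup_upd. Qed.

Definition Set_ (o i : nat) : cmd := locked (Clear o ;; Dup i o).

Lemma exec_set N i o k s : [&& i != 2, o != 2 & i != o] ->
  s i = una k -> s 2 = [::] -> k <= N -> size (s o) <= N ->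
  exec N (Set_ o i) s = upd s o (una k).
Proof.
move=> ne si s2 kN oN; rewrite /Set_ -lock exec_seq exec_clear // (exec_dup (k := k)) //.
- by rewrite /upd eqxx cats0; upd_ext.
- by case/and3P: ne => _ _ /negPf ne; rewrite /upd ne.
- by case/and3P: ne => _ ne _; rewrite /upd eq_sym (negPf ne).
Qed.

(** The last bit is pushed first, so that [w] can be read from the top of [o]. Because output is
    pushed on a stack, all programs produce it from its end to its beginning. *)
Definition Emit (o : nat) (w : word) : cmd :=
  locked (foldr (fun b c => c ;; Push o b) Skip w).

Lemma exec_emit N o w s : exec N (Emit o w) s = upd s o (w ++ s o).
Proof.
rewrite /Emit -lock; elim: w => [|b w IH] /=; first by rewrite exec_skip; upd_ext.
by rewrite exec_seq IH exec_push; upd_ext; rewrite eqxx.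
Qed.

Definition Move (i o : nat) : cmd := locked
  (Loop (If i Skip (Pop i ;; Push o false) (Pop i ;; Push o true))).

Lemma exec_move N i o s : i != o -> size (s i) <= N ->
  exec N (Move i o) s = upd (upd s i [::]) o (rev (s i) ++ s o).
Proof.
move=> io szN; rewrite /Move -lock exec_loop.
pose S w v := upd (upd s i w) o v.
have {1}-> : s = S (s i) (s o) by rewrite /S; upd_ext.
rewrite -/(S [::] (rev (s i) ++ s o)).
apply: (iter_stable szN); last first.
  by rewrite exec_if /S /upd (negPf io) eqxx.
elim: (s i) (s o) {szN} => // b w IH v.
rewrite [size _]/= iterSr rev_cons cat_rcons -IH; congr (iter _ _ _).
rewrite exec_if {1}/S /upd (negPf io) eqxx.
by move/eqP: io => io; case: b; rewrite !execE /S; upd_ext.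
Qed.

(** Made for [enc_seq] and [enc_unary]: it consumes the [true] in front of each entry and stops at
    the closing [false], which stays on [u]. *)
Definition WhileT (u : nat) (body : cmd) : cmd :=
  locked (Loop (If u Skip Skip (Pop u ;; body))).

(* [S r a] is the store in which the input still to be read is [r]. *)
Lemma whileT_seq (A T : Type) (enc : T -> word) (S : word -> A -> store)
    (I : word -> A -> Prop) (step : A -> T -> A) N u body :
  (forall r a, S r a u = r) ->
  (forall r a, I r a -> size r <= N) ->
  (forall b r a, upd (S (b :: r) a) u r = S r a) ->
  (forall r a x, I (true :: enc x ++ r) a ->
     exec N body (S (enc x ++ r) a) = S r (step a x) /\ I r (step a x)) ->
  forall s a r, I (enc_seq enc s ++ r) a ->
  exec N (WhileT u body) (S (enc_seq enc s ++ r) a) = S (false :: r) (foldl step a s)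
  /\ I (false :: r) (foldl step a s).
Proof.
move=> Su szI updS stepP s a r Ia; rewrite /WhileT -lock exec_loop.
have sz : size s <= N.
  apply: leq_trans (szI _ _ Ia); rewrite size_cat; apply: leq_trans (leq_addr _ _).
  by elim: s {Ia} => //= x s IH; rewrite size_cat; lia.
suff [E Ir] : iter (size s) (exec N (If u Skip Skip (Pop u ;; body)))
    (S (enc_seq enc s ++ r) a) = S (false :: r) (foldl step a s) /\
    I (false :: r) (foldl step a s).
  split=> //; apply: (iter_stable sz) => //.
  by rewrite exec_if Su.
elim: s a Ia {sz} => [|x s IH] a Ia; first by [].
have sE : enc_seq enc (x :: s) ++ r = true :: enc x ++ (enc_seq enc s ++ r).
  by rewrite /= -catA.
rewrite sE in Ia; have [E1 I1] := stepP _ _ _ Ia.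
have [E2 I2] := IH _ I1; split=> //.
rewrite -[size _]/(size s).+1 iterSr sE exec_if Su exec_seq exec_pop Su updS E1.
exact: E2.
Qed.

(* Reads a unary number from the top of [u] into [o]. *)
Definition ReadU (u o : nat) : cmd := locked (WhileT u (Push o true) ;; Pop u).

Lemma exec_readU N u o k r s : u != o -> s u = enc_unary k ++ r -> k <= N ->
  exec N (ReadU u o) s = upd (upd s u r) o (una k ++ s o).
Proof.
move=> uo su kN; rewrite /ReadU -lock exec_seq /WhileT -lock exec_loop; move/eqP: (uo) => uo'.
pose S a b := upd (upd s u (enc_unary a ++ r)) o (una b ++ s o).
have {1}-> : s = S k 0 by rewrite /S; upd_ext.
rewrite (@iter_count _ _ S) //; first last.
- by move=> b; rewrite exec_if /S /upd (negPf uo) eqxx.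
- move=> a b; rewrite exec_if {1}/S /upd (negPf uo) eqxx !execE /S; upd_ext.
by rewrite exec_pop /S addn0; upd_ext; rewrite (negPf uo) eqxx.
Qed.

(** * Systems of quadratic equations *)

(* [(i, j, k, l)] stands for the equation [v_i * v_j + v_k = v_l]. *)
Definition quad : Type := nat * nat * nat * nat.

Definition enc_quad (q : quad) : word :=
  let: (i, j, k, l) := q in
  enc_unary i ++ enc_unary j ++ enc_unary k ++ enc_unary l.

Definition EmitQ (a b c d : nat) : cmd := locked
  (Push 0 false ;; Dup d 0 ;; Push 0 false ;; Dup c 0 ;;
   Push 0 false ;; Dup b 0 ;; Push 0 false ;; Dup a 0 ;; Push 0 true).

Lemma exec_emitQ N a b c d ka kb kc kd s :
  all (fun i => (i != 0) && (i != 2)) [:: a; b; c; d] -> s 2 = [::] ->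
  s a = una ka -> s b = una kb -> s c = una kc -> s d = una kd ->
  all (fun k => k <= N) [:: ka; kb; kc; kd] ->
  exec N (EmitQ a b c d) s = upd s 0 (true :: enc_quad (ka, kb, kc, kd) ++ s 0).
Proof.
move=> /and5P[/andP[a0 a2] /andP[b0 b2] /andP[c0 c2] /andP[d0 d2] _] s2 sa sb sc sd.
move=> /and5P[na nb nc nd _].
rewrite /EmitQ -lock !(exec_seq, exec_push).
rewrite (exec_dup (i := d) (k := kd)) ?a2 ?b2 ?c2 ?d2 ?a0 ?b0 ?c0 ?d0 //; last by rewrite /upd (negPf d0).
rewrite (exec_dup (i := c) (k := kc)) ?a2 ?b2 ?c2 ?d2 ?a0 ?b0 ?c0 ?d0 //; last by rewrite /upd (negPf c0).
rewrite (exec_dup (i := b) (k := kb)) ?a2 ?b2 ?c2 ?d2 ?a0 ?b0 ?c0 ?d0 //; last by rewrite /upd (negPf b0).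
rewrite (exec_dup (i := a) (k := ka)) ?a2 ?b2 ?c2 ?d2 ?a0 ?b0 ?c0 ?d0 //; last by rewrite /upd (negPf a0).
rewrite /upd /= /enc_quad /enc_unary; apply: funext => j; case: (j == 0) => //.
by rewrite -!catA.
Qed.

(* Defines a new variable, whose index is taken from register [f]. *)
Definition Def (f a b c r : nat) : cmd :=
  locked (EmitQ a b c f ;; Set_ r f ;; Push f true).

Lemma exec_def N f a b c r ka kb kc kf s :
  all (fun i => (i != 0) && (i != 2)) [:: a; b; c; f; r] && (f != r) -> s 2 = [::] ->
  s a = una ka -> s b = una kb -> s c = una kc -> s f = una kf ->
  all (fun k => k <= N) [:: ka; kb; kc; kf; size (s r)] ->
  exec N (Def f a b c r) s =
  upd (upd (upd s 0 (true :: enc_quad (ka, kb, kc, kf) ++ s 0)) r (una kf)) f (una kf.+1).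
Proof.
move=> /andP[/and5P[A1 A2 A3 A4 /andP[A5 _]] fr] s2 sa sb sc sf /and5P[na nb nc nf /andP[nr _]].
have C1 : all (fun i => (i != 0) && (i != 2)) [:: a; b; c; f] by rewrite /= A1 A2 A3 A4.
have C2 : all (fun k => k <= N) [:: ka; kb; kc; kf] by rewrite /= na nb nc nf.
rewrite /Def -lock exec_seq (exec_emitQ C1 s2 sa sb sc sf C2).
case/andP: A4 => f0 f2; case/andP: A5 => r0 r2.
rewrite exec_seq (exec_set (k := kf)) ?f2 ?r2 //.
- by rewrite exec_push; congr (upd _ _ (_ :: _)); rewrite /upd (negPf fr) (negPf f0) sf.
- by rewrite /upd (negPf f0).
- by rewrite /upd (negPf r0).
Qed.

(* Variable 0 is the constant 1, and variables [3], ..., [n + 2] are universally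
   quantified. *)
Record system := System { sy_n : nat; sy_N : nat; sy_quads : seq quad }.

Definition quad_lt (N : nat) (q : quad) : bool :=
  let: (i, j, k, l) := q in [&& i < N, j < N, k < N & l < N].

Definition wf_system (s : system) : bool :=
  (sy_n s + 3 <= sy_N s) && all (quad_lt (sy_N s)) (sy_quads s).

Definition enc_system (s : system) : word :=
  enc_unary (sy_n s) ++ enc_unary (sy_N s) ++ enc_seq enc_quad (sy_quads s).

Lemma enc_unary_inj m n r r' :
  enc_unary m ++ r = enc_unary n ++ r' -> m = n /\ r = r'.
Proof.
elim: m n => [|m IH] [|n] //=; first by case.
by rewrite /enc_unary /= => -[/IH[-> ->]].
Qed.

Lemma enc_system_inj : injective enc_system.
Proof.
move=> [n N qs] [n' N' qs']; rewrite /enc_system /=.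
move=> /enc_unary_inj[-> /enc_unary_inj[-> E]]; congr System.
elim: qs qs' E => [|[[[i j] k] l] qs IH] [|[[[i' j'] k'] l'] qs'] //= [].
rewrite -![(enc_unary _ ++ _) ++ _]catA => /enc_unary_inj[-> /enc_unary_inj[-> ]] /enc_unary_inj[-> ].
by move=> /enc_unary_inj[-> /IH ->].
Qed.

Section Truth.
Local Open Scope ring_scope.
Variable R : realType.

Definition quad_holds (v : nat -> R) (q : quad) : Prop :=
  let: (i, j, k, l) := q in v i * v j + v k = v l.

Fixpoint sat (v : nat -> R) (qs : seq quad) : Prop :=
  if qs is q :: qs' then quad_holds v q /\ sat v qs' else True.

(** Assignments are infinite sequences so that indices remain plain numbers; [sat_eq] transfers
    satisfaction between sequences that agree below [N]. *)
Definition true_system (s : system) : Prop :=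
  forall x : nat -> R, exists v : nat -> R,
    [/\ v 0%N = 1, forall j, (j < sy_n s)%N -> v (j + 3)%N = x j
      & sat v (sy_quads s)].

Lemma sat_eq v v' N qs : all (quad_lt N) qs -> (forall i, (i < N)%N -> v i = v' i) ->
  sat v qs -> sat v' qs.
Proof.
move=> + E; elim: qs => //= -[[[i j] k] l] qs IH /andP[/and4P[? ? ? ?] ?] [q /IH H].
by split; [rewrite /= -!E | apply: H].
Qed.

End Truth.

Lemma init_sto k w : program_init w = sto ([:: [::]; rev w] ++ nseq k [::]).
Proof.
apply: funext => -[|[|i]] //=; rewrite /program_init /sto /=.
by rewrite nth_nseq; case: ifP.
Qed.

(** * From systems to sentences *)

Definition EmitV (r : nat) : cmd :=
  Push 0 false ;; Dup r 0 ;; Emit 0 [:: false; false; true; true].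
Definition EmitAtom : cmd :=
  EmitV 9 ;; Emit 0 [:: true; true; false; false; true; false] ;;
  EmitV 8 ;; EmitV 7 ;; EmitV 6 ;;
  Emit 0 [:: true; false; false; true; false; true; false; true; false; true; true].
Definition EmitUniv : cmd :=
  Push 0 false ;; Dup 6 0 ;;
  Emit 0 [:: true; true; false; false; true; false; false; false; false] ;;
  Push 0 false ;; Dup 6 0 ;;
  Emit 0 [:: true; false; false; true; false; true; false;
             false; false; true; true; true; true; true].

Definition ReadQ : cmd := ReadU 3 6 ;; ReadU 3 7 ;; ReadU 3 8 ;; ReadU 3 9.
Definition ClearQ : cmd := Clear 6 ;; Clear 7 ;; Clear 8 ;; Clear 9.

Definition ReadSystemHead : cmd := Move 1 3 ;; ReadU 3 4 ;; ReadU 3 5.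

Section SentenceOfSystem.

Definition word_v (i : nat) : word :=
  [:: false; false; true; true] ++ enc_unary i.
Definition triv_word : word := [:: false; true; false; false; true; false].
Definition quad_word (q : quad) : word :=
  let: (i, j, k, l) := q in
  [:: true; false; false; true; false; true; false; true; false; true; true] ++
  word_v i ++ word_v j ++ word_v k ++ [:: true; true; false; false; true; false] ++ word_v l.
Definition univ_word (j : nat) : word :=
  [:: true; false; false; true; false; true; false; false; false; true; true; true; true; true] ++
  enc_unary j ++ [:: true; true; false; false; true; false; false; false; false] ++ enc_unary j.
(* [v_0 - 1 = 0] and [neg + 1 = 0] *)
Definition const_word : word :=
  [:: true; false; false; true; false; true; false] ++ word_v 0 ++
    [:: false; false; true; false] ++
  [:: true; false; false; true; false; true; false; false; false; true; false;
      false; true; true].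

(** Terms have no subtraction, so existential variable 0 is forced to be -1. Existential variable
    [i + 1] stands for [v_i]; thus all of [v] is quantified existentially, and [univ_word] ties the
    entries with indices from 3 to [n + 2] to the universal variables. Every conjunct brings its own
    [FAnd], and [triv_word] closes the chain. *)
Definition sentence_word (s : system) : word :=
  enc_unary (sy_n s) ++ enc_unary (sy_N s).+1 ++ const_word ++
  flatten [seq univ_word j | j <- iota 0 (sy_n s)] ++
  foldl (fun o q => quad_word q ++ o) triv_word (sy_quads s).

End SentenceOfSystem.

Definition sentence_program : cmd :=
  ReadSystemHead ;; Emit 0 triv_word ;;
  WhileT 3 (ReadQ ;; EmitAtom ;; ClearQ) ;;
  Dup 4 6 ;; WhileT 6 EmitUniv ;;
  Emit 0 const_word ;;
  Push 0 false ;; Dup 5 0 ;; Push 0 true ;; Push 0 false ;; Dup 4 0.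

Ltac cat_norm :=
  rewrite /word_v /enc_unary /una /=; repeat (progress rewrite -?catA /=); reflexivity.

Definition store_quads (n N : nat) (u : word) (o : word) : store :=
  sto [:: o; [::]; [::]; u; una n; una N; [::]; [::]; [::]; [::]].

Lemma exec_head L s r : size (enc_system s ++ r) <= L ->
  exec L ReadSystemHead (program_init (enc_system s ++ r)) =
  store_quads (sy_n s) (sy_N s) (enc_seq enc_quad (sy_quads s) ++ r) [::].
Proof.
case: s => n N qs; rewrite /enc_system /= => szL.
have szn : n <= L by move: szL; rewrite !size_cat /= size_nseq; lia.
have szN : N <= L by move: szL; rewrite !size_cat /= !size_nseq; lia.
rewrite (init_sto 8) /ReadSystemHead exec_seq exec_move //; last by rewrite stoE /= size_rev.
rewrite !upd_sto stoE /= revK cats0.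
rewrite exec_seq (exec_readU (o := 4) (k := n) (r := enc_unary N ++ enc_seq enc_quad qs ++ r)) //; last first.
  by rewrite stoE /= -![(enc_unary _ ++ _) ++ _]catA.
rewrite !upd_sto stoE /= (exec_readU (k := N) (r := enc_seq enc_quad qs ++ r)) //.
by rewrite !upd_sto stoE /= !cats0.
Qed.

Lemma regs_sentence_program : regs_lt 10 sentence_program.
Proof.
by rewrite /sentence_program /ReadSystemHead /ReadQ /EmitAtom /ClearQ /EmitUniv
   /EmitV /WhileT /ReadU /Clear /Dup /Emit /WhileT /Move -!lock.
Qed.

Lemma exec_readQ L n N i j k l r o :
  size (enc_quad (i, j, k, l)) <= L ->
  exec L ReadQ (store_quads n N (enc_quad (i, j, k, l) ++ r) o) =
  sto [:: o; [::]; [::]; r; una n; una N; una i; una j; una k; una l].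
Proof.
rewrite /enc_quad !size_cat /= !size_nseq /= => szL.
rewrite /ReadQ /store_quads -![(enc_unary _ ++ _) ++ _]catA.
rewrite exec_seq (exec_readU (o := 6) (k := i) (r := enc_unary j ++ enc_unary k ++ enc_unary l ++ r)) //; last lia.
rewrite !upd_sto stoE /= exec_seq (exec_readU (o := 7) (k := j) (r := enc_unary k ++ enc_unary l ++ r)) //; last lia.
rewrite !upd_sto stoE /= exec_seq (exec_readU (o := 8) (k := k) (r := enc_unary l ++ r)) //; last lia.
rewrite !upd_sto stoE /= (exec_readU (o := 9) (k := l) (r := r)) //; last lia.
by rewrite !upd_sto stoE /= !cats0.
Qed.

Lemma exec_clearQ L n N i j k l r o :
  all (fun m => m <= L) [:: i; j; k; l] ->
  exec L ClearQ (sto [:: o; [::]; [::]; r; una n; una N; una i; una j; una k; una l]) =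
  store_quads n N r o.
Proof.
case/and5P=> ? ? ? ? _.
rewrite /ClearQ !exec_seq (exec_clear (i := 6)) ?upd_sto /= ?stoE ?size_una //.
rewrite (exec_clear (i := 7)) ?upd_sto /= ?stoE ?size_una //.
rewrite (exec_clear (i := 8)) ?upd_sto /= ?stoE ?size_una //.
by rewrite (exec_clear (i := 9)) ?upd_sto /= ?stoE ?size_una.
Qed.

Lemma exec_emitV L r l k : [&& r != 0 & r != 2] -> nth [::] l r = una k ->
  nth [::] l 2 = [::] -> k <= L ->
  exec L (EmitV r) (sto l) = sto (set_nth [::] l 0 (word_v k ++ nth [::] l 0)).
Proof.
move=> /andP[r0 r2] lr l2 kL; rewrite /EmitV !exec_seq exec_push.
rewrite (exec_dup (k := k)) ?r0 ?r2 //; last by rewrite /upd (negPf r0).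
rewrite exec_emit -upd_sto; upd_ext.
by rewrite /word_v /= -!catA.
Qed.

Lemma exec_sentence_program L s : size (enc_system s) <= L ->
  exec L sentence_program (program_init (enc_system s)) 0 = sentence_word s.
Proof.
move=> szL; have szL' : size (enc_system s ++ [::]) <= L by rewrite cats0.
rewrite -[enc_system s]cats0 /sentence_program exec_seq exec_head // exec_seq exec_emit.
case: s szL {szL'} => n N qs; rewrite /enc_system /sentence_word /= => szL.
have szn : n <= L by move: szL; rewrite !size_cat /= size_nseq; lia.
have szN : N <= L by move: szL; rewrite !size_cat /= !size_nseq; lia.
rewrite exec_seq upd_sto -[sto _]/(store_quads n N (enc_seq enc_quad qs ++ [::]) triv_word).
have [|||||-> _] := @whileT_seq word quad enc_quad (fun r o => store_quads n N r o)
  (fun r o => size r <= L) (fun o q => quad_word q ++ o) L 3 (ReadQ ;; EmitAtom ;; ClearQ)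
  _ _ _ _ qs triv_word [::].
- by [].
- by [].
- by move=> b r o; rewrite /store_quads upd_sto.
- move=> r o [[[i j] k] l] /= szq.
  have : size (enc_quad (i, j, k, l)) <= L by move: szq; rewrite size_cat /=; lia.
  split; last by move: szq; rewrite size_cat; lia.
  rewrite exec_seq exec_readQ // exec_seq.
  have [? ? ? ?] : [/\ i <= L, j <= L, k <= L & l <= L].
    by move: szq; rewrite /enc_quad !size_cat /= !size_nseq; split; lia.
  rewrite /EmitAtom exec_seq (exec_emitV (r := 9) (k := l)) //=.
  rewrite exec_seq exec_emit upd_sto stoE /=.
  rewrite exec_seq (exec_emitV (r := 8) (k := k)) //=.
  rewrite exec_seq (exec_emitV (r := 7) (k := j)) //=.
  rewrite exec_seq (exec_emitV (r := 6) (k := i)) //=.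
  rewrite exec_emit upd_sto stoE /= exec_clearQ; last by apply/and5P.
  by congr (store_quads _ _ _ _); cat_norm.
- by rewrite cats0; move: szL; rewrite !size_cat; lia.
set o := foldl _ _ _.
rewrite /store_quads exec_seq (exec_dup (k := n)) // upd_sto stoE /= cats0.
rewrite exec_seq.
have -> : exec L (WhileT 6 EmitUniv)
    (sto [:: o; [::]; [::]; [:: false]; una n; una N; una n; [::]; [::]; [::]]) =
    sto [:: flatten [seq univ_word j | j <- iota 0 n] ++ o; [::]; [::]; [:: false];
            una n; una N; [::]; [::]; [::]; [::]].
  rewrite /WhileT -lock exec_loop.
  apply: (@iter_stable _ _ n) => //.
  have E m o' : m <= L -> exec L (If 6 Skip Skip (Pop 6 ;; EmitUniv))
     (sto [:: o'; [::]; [::]; [:: false]; una n; una N; una m.+1; [::]; [::]; [::]]) =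
     (sto [:: univ_word m ++ o'; [::]; [::]; [:: false]; una n; una N; una m; [::]; [::]; [::]]).
    move=> mL; rewrite exec_if stoE /= exec_seq exec_pop upd_sto stoE /=.
    rewrite /EmitUniv exec_seq exec_push upd_sto stoE /=.
    rewrite exec_seq (exec_dup (k := m)) // upd_sto stoE /=.
    rewrite exec_seq exec_emit upd_sto stoE /=.
    rewrite exec_seq exec_push upd_sto stoE /=.
    rewrite exec_seq (exec_dup (k := m)) // upd_sto stoE /=.
    rewrite exec_emit upd_sto stoE /=.
    by rewrite /univ_word; cat_norm.
  have E2 m o' : m <= n -> iter m (exec L (If 6 Skip Skip (Pop 6 ;; EmitUniv)))
     (sto [:: o'; [::]; [::]; [:: false]; una n; una N; una m; [::]; [::]; [::]]) =
     (sto [:: flatten [seq univ_word j | j <- iota 0 m] ++ o'; [::]; [::]; [:: false]; una n; una N; [::]; [::]; [::]; [::]]).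
    elim: m o' => // m IH o' mn; rewrite iterSr E; last lia.
    rewrite IH; last lia.
    rewrite -[in RHS](addn1 m) iotaD map_cat flatten_cat add0n -catA.
    by rewrite -[flatten (map _ (iota m 1))]/(univ_word m ++ [::]) cats0.
  exact: E2.
rewrite exec_seq exec_emit upd_sto stoE /=.
rewrite exec_seq exec_push upd_sto stoE /=.
rewrite exec_seq (exec_dup (k := N)) // upd_sto stoE /=.
rewrite exec_seq exec_push upd_sto stoE /=.
rewrite exec_seq exec_push upd_sto stoE /=.
rewrite (exec_dup (k := n)) // upd_sto stoE /=.
by cat_norm.
Qed.

Definition conj (V : Type) (l : seq (rformula V)) : rformula V :=
  foldr (@FAnd V) (FAtom CEq TZero) l.

Lemma enc_conj V (ev : V -> word) l :
  enc_formula ev (conj l) =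
  flatten [seq [:: true; false] ++ enc_formula ev f | f <- l] ++ triv_word.
Proof. by elim: l => //= f l ->; rewrite -catA. Qed.

Section SystemSentence.
Variables (n N : nat).
Let V := ('I_n + 'I_N.+1)%type.

Definition sv (i : nat) : rterm V := TVar (inr (inord i.+1)).
Definition sneg : rterm V := TVar (inr ord0).
Definition quad_atom (q : quad) : rformula V :=
  let: (i, j, k, l) := q in
  FAtom CEq (TAdd (TAdd (TMul (sv i) (sv j)) (sv k)) (TMul sneg (sv l))).
Definition univ_atom (j : 'I_n) : rformula V :=
  FAtom CEq (TAdd (sv (j + 3)) (TMul sneg (TVar (inl j)))).

End SystemSentence.

(** The [rev] reflects that the program writes each equation in front of those read before it. *)
Definition system_sentence (s : system) : sentence :=
  @Sentence (sy_n s) (sy_N s).+1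
    (conj ([:: FAtom CEq (TAdd (sv _ _ 0) (sneg _ _));
               FAtom CEq (TAdd (sneg _ _) TOne)] ++
           [seq univ_atom _ j | j <- enum 'I_(sy_n s)] ++
           [seq quad_atom _ _ q | q <- rev (sy_quads s)])).

Lemma enc_system_sentence s : wf_system s ->
  enc_sentence (system_sentence s) = sentence_word s.
Proof.
case: s => n N qs; rewrite /wf_system /= => /andP[nN qsN].
rewrite /enc_sentence /sentence_word; congr (_ ++ (_ ++ _)).
rewrite /s_matrix /system_sentence enc_conj map_cat flatten_cat -catA map_cat flatten_cat -catA.
have vE i : i < N -> enc_term (@enc_variable n N.+1) (sv n N i) = word_v i.
  by move=> iN; rewrite /= inordK.
congr (_ ++ (_ ++ _)).
- by rewrite /const_word /= inordK //; lia.
- congr flatten; rewrite -val_enum_ord -!map_comp; apply: eq_map => j /=.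
  have /= jn := ltn_ord j.
  rewrite inordK; last by move: jn nN; clear; lia.
  by rewrite /univ_word addn3; cat_norm.
have E l t : all (quad_lt N) l ->
   flatten [seq [:: true; false] ++ enc_formula (@enc_variable _ _) f |
      f <- [seq quad_atom n N q | q <- rev l]] ++ t =
   foldl (fun o q => quad_word q ++ o) t l.
  elim: l t => //= -[[[i j] k] m] l IH t /andP[/and4P[? ? ? ?] /IH <-].
  rewrite rev_cons -cats1 !map_cat flatten_cat -catA; congr cat.
  by rewrite /= !inordK ?ltnS // /quad_word; cat_norm.
exact: E.
Qed.

Section SystemSentenceTruth.
Local Open Scope ring_scope.
Variable R : realType.

Lemma holds_conj_cat V (v : V -> R) l1 l2 :
  holds v (conj (l1 ++ l2)) <-> holds v (conj l1) /\ holds v (conj l2).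
Proof. by elim: l1 => //= [|f l1 IH]; [split=> [? //|[] //] | rewrite IH; tauto]. Qed.

Lemma holds_conj_map V (v : V -> R) (T : eqType) (F : T -> rformula V) l :
  holds v (conj (map F l)) <-> forall x, x \in l -> holds v (F x).
Proof.
elim: l => [|y l IH] /=; first by [].
split=> [[hy /IH hl] x|h].
  by rewrite inE => /predU1P[->|/hl].
split; first by apply: h; rewrite mem_head.
by apply/IH => x xl; apply: h; rewrite inE xl orbT.
Qed.

Lemma sat_all (v : nat -> R) qs : sat v qs <-> forall q, q \in qs -> quad_holds v q.
Proof.
elim: qs => [|y l IH] /=; first by [].
split=> [[hy /IH hl] x|h].
  by rewrite inE => /predU1P[->|/hl].
split; first by apply: h; rewrite mem_head.
by apply/IH => x xl; apply: h; rewrite inE xl orbT.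
Qed.

Lemma true_system_sentence s : wf_system s ->
  true_sentence R (system_sentence s) <-> true_system R s.
Proof.
case: s => n N qs; rewrite /wf_system /= => /andP[nN /allP qsN]; split=> H.
- move=> x; have [y /=] := H (\row_j x j).
  move=> [e1 [e2 /holds_conj_cat[/holds_conj_map hu /holds_conj_map hq]]].
  have neg1 : y 0 ord0 = -1 by lra.
  exists (fun i => y 0 (inord i.+1)); split => /=.
  + by move: e1; rewrite neg1; lra.
  + move=> j jn; have := hu (Ordinal jn); rewrite mem_enum => /(_ isT) /=.
    by rewrite neg1 mxE /=; lra.
  + apply/sat_all => -[[[i j] k] l] q; have := hq (i, j, k, l).
    by rewrite mem_rev q => /(_ isT) /=; rewrite neg1; lra.
- move=> x; have [v /= [v0 vu /sat_all vq]] := H (fun j => if insub j is Some o then x 0 o else 0).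
  exists (\row_k if k == ord0 then -1 else v k.-1).
  pose f (i : 'I_n + 'I_N.+1) := match i with inl j => x 0 j
    | inr k => (\row_k if k == ord0 then -1 else v k.-1) 0 k end.
  change (holds f (s_matrix (system_sentence (System n N qs)))).
  have fE i : (i < N)%N -> f (inr (inord i.+1)) = v i.
    by move=> iN; rewrite /f mxE -val_eqE /= inordK.
  have fn : f (inr ord0) = -1 by rewrite /f mxE eqxx.
  have fl j : f (inl j) = x 0 j by [].
  clearbody f; rewrite /=; split.
    by have := fE 0%N; rewrite fn => ->; [rewrite v0; ring | lia].
  split; first by rewrite /= fn; ring.
  apply/holds_conj_cat; split; apply/holds_conj_map.
    move=> j _ /=; have /= jn := ltn_ord j; rewrite fE; last lia.
    rewrite fn fl vu // valK; ring.
  move=> [[[i j] k] l]; rewrite mem_rev => q.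
  have /= /and4P[? ? ? ?] := qsN _ q; have /= E := vq _ q.
  by rewrite !fE // fn E; ring.
Qed.

End SystemSentenceTruth.

(** * From systems to polynomial maps *)

(* Coefficient, exponents of the variables [z], [w], [s], and the indices of the
   other variables of the monomial, where index 0 is ignored. *)
Definition mono : Type := int * seq nat * seq nat.

(** The indices run downwards because the output is produced backwards, so [v_k] becomes coordinate
    [N + 2 - k] of the domain. Index 0 has no coordinate, since [v_0 = 1]. *)
Definition expo (N : nat) (m : mono) : seq nat :=
  m.1.2 ++ [seq count_mem i m.2 | i <- rev (iota 1 N.-1)].

Definition mono_word (N : nat) (m : mono) : word :=
  enc_int m.1.1 ++ enc_seq enc_binary (expo N m).

Definition mono_head (c : int) (sp : seq nat) : word :=
  true :: enc_int c ++ flatten [seq true :: enc_binary e | e <- sp].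

Lemma enc_seqE T (enc : T -> word) s r :
  enc_seq enc s ++ r = flatten [seq true :: enc x | x <- s] ++ false :: r.
Proof. by elim: s => //= x s IH; rewrite -!catA IH. Qed.

Lemma mono_headE N c sp ks r :
  true :: mono_word N (c, sp, ks) ++ r =
  mono_head c sp ++ flatten [seq true :: enc_binary (count_mem i ks) | i <- rev (iota 1 N.-1)]
    ++ false :: r.
Proof.
rewrite /mono_word /mono_head /expo /= -catA enc_seqE map_cat flatten_cat.
by rewrite -!catA -map_comp.
Qed.

(** Counts the registers that hold 1 and decrements every nonempty one. When the registers start as
    indices of variables, the [i]-th call thus counts the occurrences of [i], with no comparison of
    numbers. The count [c] is kept in the control flow, which makes the program a decision tree. *)
Fixpoint Hits (rs : seq nat) (c : nat) : cmd :=
  match rs with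
  | [::] => Emit 0 (true :: enc_binary c)
  | r :: rs' => If r (Hits rs' c) Skip (Pop r ;; If r (Hits rs' c.+1) Skip (Hits rs' c))
  end.

Lemma exec_hits L rs c s : uniq (0 :: rs) -> (forall r, r \in rs -> s r = una (size (s r))) ->
  exec L (Hits rs c) s =
  fun j => if j == 0 then true :: enc_binary (c + count (fun r => size (s r) == 1) rs) ++ s 0
           else if j \in rs then behead (s j) else s j.
Proof.
elim: rs c s => [|r rs IH] c s /=.
  by move=> _ _; rewrite exec_emit addn0; apply: funext => j; rewrite /upd; case: eqP.
rewrite inE negb_or => /andP[/andP[r0 nrs] /andP[rrs urs]] su.
have sur := su r (mem_head _ _).
have su' r' : r' \in rs -> s r' = una (size (s r')).
  by move=> r'rs; apply: su; rewrite inE r'rs orbT.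
have uq : uniq (0 :: rs) by rewrite /= nrs.
rewrite exec_if sur size_una; case Es: (size (s r)) => [|t].
  rewrite IH //; apply: funext => j; rewrite inE; case: eqP => // _.
  case: eqP => [->|_] //; rewrite (negPf rrs) sur Es //.
rewrite unaS exec_seq exec_pop sur Es unaS /=.
have E c' : exec L (Hits rs c') (upd s r (una t)) = fun j => if j == 0 then
    true :: enc_binary (c' + count (fun r => size (s r) == 1) rs) ++ s 0
    else if j \in r :: rs then behead (s j) else s j.
  rewrite IH //; last first.
    move=> r' r'rs; rewrite /upd; case: eqP => [rE|_]; last exact: su'.
    by move: rrs; rewrite -rE r'rs.
  apply: funext => j; rewrite /upd !inE eq_sym (negPf r0).
  have -> : count (fun r' => size (if r' == r then una t else s r') == 1) rs =
     count (fun r => size (s r) == 1) rs.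
    apply: eq_in_count => r' r'rs.
    by have /negPf-> : r' != r by apply: contraNneq rrs => <-.
  case: eqP => // _; case: eqP => [->|_] //=.
  by rewrite (negPf rrs) sur Es.
rewrite exec_if {1}/upd eqxx; case: t Es E => [|t] Es E.
  by rewrite E; apply: funext => j; case: eqP => //; rewrite addSnnS.
by rewrite unaS E.
Qed.

Arguments Hits : simpl never.

Definition Mono (pre : word) (r1 r2 r3 r4 : nat) : cmd := locked
  (Push 0 false ;; Dup r1 10 ;; Dup r2 11 ;; Dup r3 12 ;; Dup r4 13 ;;
   Dup 5 14 ;; Pop 14 ;; WhileT 14 (Hits [:: 10; 11; 12; 13] 0) ;; Emit 0 pre).

Definition store_mono (n N : nat) (u o : word) (i j k l x : nat) : store :=
  sto [:: o; [::]; [::]; u; una n; una N; una i; una j; una k; una l;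
          [::]; [::]; [::]; [::]; [::]; una x; [::]].

(** Register 16 stays empty: as a factor of a monomial it stands for [v_0], that is for 1, and pads
    products to length four. *)
Definition mono_regs := [:: 6; 7; 8; 9; 15; 16].

Lemma exec_mono L n N u o i j k l x c sp r1 r2 r3 r4 k1 k2 k3 k4 :
  0 < N <= L ->
  let s := store_mono n N u o i j k l x in
  [/\ r1 \in mono_regs, r2 \in mono_regs, r3 \in mono_regs & r4 \in mono_regs] ->
  [/\ s r1 = una k1, s r2 = una k2, s r3 = una k3 & s r4 = una k4] ->
  [/\ k1 < N, k2 < N, k3 < N & k4 < N] ->
  exec L (Mono (mono_head c sp) r1 r2 r3 r4) s =
  store_mono n N u (true :: mono_word N (c, sp, [:: k1; k2; k3; k4]) ++ o) i j k l x.
Proof.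
move=> /andP[N0 NL] s [m1 m2 m3 m4] [s1 s2 s3 s4] [l1 l2 l3 l4].
rewrite /Mono -lock exec_seq exec_push.
have regsP r : r \in mono_regs -> [&& r != 2, r != 0 & r \notin [:: 10; 11; 12; 13]].
  by move: r; apply/allP.
have /and3P[a1 /negPf b1 c1] := regsP _ m1; have /and3P[a2 /negPf b2 c2] := regsP _ m2.
have /and3P[a3 /negPf b3 c3] := regsP _ m3; have /and3P[a4 /negPf b4 c4] := regsP _ m4.
move: c1 c2 c3 c4; rewrite !inE => /norP[/negPf c10 /norP[/negPf c11 /norP[/negPf c12 /negPf c13]]].
move=> /norP[/negPf c20 /norP[/negPf c21 /norP[/negPf c22 /negPf c23]]].
move=> /norP[/negPf c30 /norP[/negPf c31 /norP[/negPf c32 /negPf c33]]].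
move=> /norP[/negPf c40 /norP[/negPf c41 /norP[/negPf c42 /negPf c43]]].
rewrite exec_seq (exec_dup (o := 10) (k := k1)) ?a1 ?c10 //; [| by rewrite /upd b1 | lia].
rewrite exec_seq (exec_dup (o := 11) (k := k2)) ?a2 ?c21 //; [| by rewrite /upd c20 b2 | lia].
rewrite exec_seq (exec_dup (o := 12) (k := k3)) ?a3 ?c32 //; [| by rewrite /upd c31 c30 b3 | lia].
rewrite exec_seq (exec_dup (o := 13) (k := k4)) ?a4 ?c43 //; [| by rewrite /upd c42 c41 c40 b4 | lia].
rewrite /s /store_mono !upd_sto !stoE /= ?cats0.
rewrite exec_seq (exec_dup (o := 14) (k := N)) // !upd_sto !stoE /= ?cats0.
rewrite exec_seq exec_pop upd_sto stoE /=.
have -> : behead (una N) = una N.-1 by case: (N) N0.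
pose S o t m := sto [:: o; [::]; [::]; u; una n; una N; una i; una j; una k; una l;
          una (k1 - t); una (k2 - t); una (k3 - t); una (k4 - t); una m; una x; [::]].
have -> : sto [:: false :: o; [::]; [::]; u; una n; una N; una i; una j; una k; una l;
   una k1; una k2; una k3; una k4; una N.-1; una x; [::]] = S (false :: o) 0 N.-1.
  by rewrite /S !subn0.
rewrite exec_seq /WhileT -lock exec_loop.
have step o' t m : exec L (If 14 Skip Skip (Pop 14 ;; Hits [:: 10; 11; 12; 13] 0)) (S o' t m.+1) =
    S (true :: enc_binary (count_mem t.+1 [:: k1; k2; k3; k4]) ++ o') t.+1 m.
  rewrite exec_if /S stoE unaS /= exec_seq exec_pop upd_sto stoE /=.
  have bu a : behead (una (a - t)) = una (a - t.+1) by rewrite subnS; case: (a - t).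
  have eqS a : (a - t == 1) = (a == t.+1) by apply/eqP/eqP; lia.
  rewrite exec_hits //; last by move=> r; rewrite !inE => /or4P[] /eqP ->; rewrite stoE /= size_una.
  apply: funext => y; do 17?[case: y => [|y] /=]; rewrite ?stoE /= ?size_una ?bu ?eqS //.
have run t m o' : iter m (exec L (If 14 Skip Skip (Pop 14 ;; Hits [:: 10; 11; 12; 13] 0))) (S o' t m) =
    S (flatten [seq true :: enc_binary (count_mem i [:: k1; k2; k3; k4]) | i <- rev (iota t.+1 m)] ++ o') (t + m) 0.
  elim: m t o' => [|m IH] t o'; first by rewrite addn0.
  rewrite iterSr step IH addSnnS; congr (S _ _ _).
  rewrite -[iota t.+1 m.+1]/(t.+1 :: iota t.+2 m) rev_cons -cats1 map_cat flatten_cat -catA.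
  by congr cat; rewrite [flatten _]/= cats0.
rewrite (@iter_stable _ _ N.-1 _ _ _ _ (run _ _ _)) //; last lia.
rewrite exec_emit /S upd_sto stoE /= mono_headE add0n.
(* All indices are below [N], so [N - 1] rounds have emptied the four working registers. *)
have z a : a < N -> a - N.-1 = 0 by lia.
by rewrite !z.
Qed.

(* Monomials whose last component lists registers instead of indices. *)
Definition rmono : Type := mono.

Definition rval (i j k l x r : nat) : nat :=
  nth 0 [:: 0; 0; 0; 0; 0; 0; i; j; k; l; 0; 0; 0; 0; 0; x; 0] r.

Definition MonoOf (m : rmono) : cmd :=
  Mono (mono_head m.1.1 m.1.2) (nth 0 m.2 0) (nth 0 m.2 1) (nth 0 m.2 2) (nth 0 m.2 3).

Definition Monos (ms : seq rmono) : cmd := seqc (map MonoOf ms).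
Arguments Monos : simpl never.

Definition mono_of i j k l x (m : rmono) : mono :=
  (m.1.1, m.1.2, [seq rval i j k l x r | r <- m.2]).

Definition prepend (N : nat) (o : word) (ms : seq mono) : word :=
  foldl (fun o m => true :: mono_word N m ++ o) o ms.

Lemma foldl_enc_seq T (enc : T -> word) ms l r :
  foldl (fun o m => true :: enc m ++ o) (enc_seq enc l ++ r) ms =
  enc_seq enc (rev ms ++ l) ++ r.
Proof.
elim: ms l => //= m ms IH l; rewrite rev_cons cat_rcons -IH; congr foldl.
by rewrite /= -catA.
Qed.

Lemma exec_monos L n N u o i j k l x (ms : seq rmono) :
  0 < N <= L -> [&& i < N, j < N, k < N, l < N & x < N] ->
  all (fun m => (size m.2 == 4) && all (mem mono_regs) m.2) ms ->
  exec L (Monos ms) (store_mono n N u o i j k l x) =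
  store_mono n N u (prepend N o [seq mono_of i j k l x m | m <- ms]) i j k l x.
Proof.
move=> NL lts; elim: ms o => //= -[[c sp] rs] ms IH o /andP[/andP[/eqP szr rsP] msP].
rewrite /Monos /= exec_seq -IH //; congr exec.
case: rs szr rsP => [|r1 [|r2 [|r3 [|r4 []]]]] //= _ /and5P[m1 m2 m3 m4 _].
have sE r : r \in mono_regs -> store_mono n N u o i j k l x r = una (rval i j k l x r).
  by move=> rm; apply/eqP; move: r rm; apply/allP; rewrite /= /store_mono /= !eqxx.
have ltN r : r \in mono_regs -> rval i j k l x r < N.
  case/and5P: lts => iN jN kN lN xN; case/andP: NL => N0 _.
  by move: r; apply/allP => /=; rewrite iN jN kN lN xN N0.
have := @exec_mono L n N u o i j k l x c sp r1 r2 r3 r4 (rval i j k l x r1)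
  (rval i j k l x r2) (rval i j k l x r3) (rval i j k l x r4) NL.
by apply; split; rewrite ?sE ?ltN.
Qed.

(** The signed terms of [v_i * v_j + v_k - v_l]. Multiplying them pairwise, [quad_rmonos] expands
    minus [w] times the square of this defect into nine monomials, where equal signs give the
    coefficient -1. *)
Definition quad_terms : seq (bool * nat * nat) :=
  [:: (false, 6, 7); (false, 8, 16); (true, 9, 16)].

Definition quad_rmonos : seq rmono :=
  [seq ((if x.1.1 == y.1.1 then (-1)%R else 1%R) : int, [:: 0; 1; 0],
        [:: x.1.2; x.2; y.1.2; y.2]) | x <- quad_terms, y <- quad_terms].

Definition quad_monos (q : quad) : seq mono :=
  let: (i, j, k, l) := q in [seq mono_of i j k l 0 m | m <- quad_rmonos].

Arguments quad_monos : simpl never.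

(** This is [z^3 w - z^2 - w s^2], the part of [h2] that is the same for all systems. *)
Definition const_rmonos : seq rmono :=
  [:: (1%R : int, [:: 3; 1; 0], nseq 4 16); ((-1)%R : int, [:: 2; 0; 0], nseq 4 16);
      ((-1)%R : int, [:: 0; 1; 2], nseq 4 16)].
Definition h1_rmonos : seq rmono :=
  [:: (1%R : int, [:: 1; 1; 0], nseq 4 16); ((-1)%R : int, [:: 0; 0; 0], nseq 4 16)].
Definition coord_rmono : rmono := (1%R : int, [:: 0; 0; 0], [:: 15; 16; 16; 16]).

Definition instance_program : cmd :=
  ReadSystemHead ;; Emit 0 [:: false; false] ;;
  WhileT 3 (ReadQ ;; Monos quad_rmonos ;; ClearQ) ;;
  Monos const_rmonos ;; Emit 0 [:: false; true] ;;
  Monos h1_rmonos ;; Push 0 true ;;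
  Dup 4 6 ;;
  WhileT 6 (Push 0 false ;; Dup 6 15 ;; Emit 15 (una 3) ;; MonoOf coord_rmono ;;
            Clear 15 ;; Push 0 true) ;;
  Emit 0 [:: true; false; true; false; false] ;;
  Dup 4 6 ;; WhileT 6 (Emit 0 [:: true; false]) ;;
  Emit 0 [:: true; false; true; false; false] ;;
  Dup 5 6 ;; WhileT 6 (Emit 0 [:: true; false]).

Definition h2_monos (s : system) : seq mono :=
  rev (flatten [seq quad_monos q | q <- sy_quads s] ++
       [seq mono_of 0 0 0 0 0 m | m <- const_rmonos]).
Definition h1_monos : seq mono := rev [seq mono_of 0 0 0 0 0 m | m <- h1_rmonos].
Definition coord_mono (j : nat) : mono := mono_of 0 0 0 0 (j + 3) coord_rmono.

Definition comps (s : system) : seq (seq mono) :=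
  [seq [:: coord_mono j] | j <- iota 0 (sy_n s)] ++ [:: h1_monos; h2_monos s].

Definition instance_word (s : system) : word :=
  enc_seq enc_factor (nseq (sy_N s).+2 Line) ++ enc_seq enc_factor (nseq (sy_n s).+2 Line) ++
  enc_seq (enc_seq (mono_word (sy_N s))) (comps s).

Lemma regs_instance_program : regs_lt 17 instance_program.
Proof.
by rewrite /instance_program /ReadSystemHead /ReadQ /ClearQ /quad_rmonos /const_rmonos
   /h1_rmonos /coord_rmono /quad_terms /= /Monos /= /MonoOf /Mono /Hits /ReadU /Clear /Dup /Emit /WhileT
   /Move -!lock.
Qed.

Lemma exec_whileT_una (S : nat -> word -> store) (f : nat -> word -> word) L u body n o :
  (forall m o, S m o u = una m) -> (forall m o, upd (S m.+1 o) u (una m) = S m o) ->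
  (forall m o, m < n -> exec L body (S m o) = S m (f m o)) -> n <= L ->
  exec L (WhileT u body) (S n o) = S 0 (foldr f o (iota 0 n)).
Proof.
move=> Su updS bodyP nL; rewrite /WhileT -lock exec_loop.
apply: (iter_stable nL); last by rewrite exec_if Su.
have E m o' : m <= n -> iter m (exec L (If u Skip Skip (Pop u ;; body))) (S m o') =
    S 0 (foldr f o' (iota 0 m)).
  elim: m o' => // m IH o' mn.
  rewrite iterSr exec_if Su unaS exec_seq exec_pop Su updS bodyP // IH; last lia.
  by rewrite -[in RHS](addn1 m) iotaD foldr_cat.
exact: E.
Qed.

Lemma exec_instance_program L s : size (enc_system s) + 4 <= L -> wf_system s ->
  exec L instance_program (program_init (enc_system s)) 0 = instance_word s.
Proof.
move=> szL wf; have szL' : size (enc_system s ++ [::]) <= L by rewrite cats0; lia.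
rewrite -[enc_system s]cats0 /instance_program exec_seq exec_head // exec_seq exec_emit.
case: s szL wf {szL'} => n N qs; rewrite /enc_system /wf_system => szL /andP[]; rewrite [sy_n _]/= [sy_N _]/= [sy_quads _]/= => nN qsN.
have szN : N <= L by move: szL; rewrite !size_cat /= !size_nseq; lia.
have szn : n + 3 <= L by lia.
have NL : 0 < N <= L by lia.
have szq : size (enc_seq enc_quad qs ++ [::]) <= L.
  by move: szL; rewrite /= cats0 !size_cat; lia.
have N0 : 0 < N by lia.
rewrite /store_quads upd_sto stoE /=.
have -> : sto [:: [:: false; false]; [::]; [::]; enc_seq enc_quad qs ++ [::]; una n; una N; [::]; [::]; [::]; [::]]
   = store_mono n N (enc_seq enc_quad qs ++ [::]) (enc_seq (mono_word N) [::] ++ [:: false]) 0 0 0 0 0.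
  by apply: funext => i; do 17?[case: i => [|i] //]; rewrite /store_mono !stoE /= !nth_nil.
rewrite exec_seq.
have ReadE r o i j k l : size (enc_quad (i, j, k, l)) <= L ->
  exec L ReadQ (store_mono n N (enc_quad (i, j, k, l) ++ r) o 0 0 0 0 0) = store_mono n N r o i j k l 0.
  rewrite /enc_quad !size_cat /= !size_nseq /= => sz4.
  rewrite /ReadQ /store_mono -![(enc_unary _ ++ _) ++ _]catA.
  rewrite exec_seq (exec_readU (o := 6) (k := i) (r := enc_unary j ++ enc_unary k ++ enc_unary l ++ r)) //; last lia.
  rewrite !upd_sto stoE /= exec_seq (exec_readU (o := 7) (k := j) (r := enc_unary k ++ enc_unary l ++ r)) //; last lia.
  rewrite !upd_sto stoE /= exec_seq (exec_readU (o := 8) (k := k) (r := enc_unary l ++ r)) //; last lia.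
  rewrite !upd_sto stoE /= (exec_readU (o := 9) (k := l) (r := r)) //; last lia.
  by rewrite !upd_sto stoE /= !cats0.
have ClearE r o i j k l : all (fun m => m <= L) [:: i; j; k; l] ->
  exec L ClearQ (store_mono n N r o i j k l 0) = store_mono n N r o 0 0 0 0 0.
  case/and5P=> ? ? ? ? _; rewrite /ClearQ /store_mono.
  rewrite !exec_seq (exec_clear (i := 6)) ?upd_sto /= ?stoE ?size_una //.
  rewrite (exec_clear (i := 7)) ?upd_sto /= ?stoE ?size_una //.
  rewrite (exec_clear (i := 8)) ?upd_sto /= ?stoE ?size_una //.
  by rewrite (exec_clear (i := 9)) ?upd_sto /= ?stoE ?size_una.
have -> : forall l0, exec L (WhileT 3 (ReadQ ;; Monos quad_rmonos ;; ClearQ))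
    (store_mono n N (enc_seq enc_quad qs ++ [::]) (enc_seq (mono_word N) l0 ++ [:: false]) 0 0 0 0 0) =
    store_mono n N [:: false] (enc_seq (mono_word N)
      (rev (flatten [seq quad_monos q | q <- qs]) ++ l0) ++ [:: false]) 0 0 0 0 0.
  move=> l0; rewrite /WhileT -lock exec_loop.
  have szqs : size qs <= L.
    apply: leq_trans szq; rewrite cats0.
    by elim: (qs) => //= x s IH; rewrite size_cat; lia.
  apply: (iter_stable szqs); last by rewrite exec_if /store_mono stoE.
  elim: qs l0 qsN szq {szqs szL} => [|[[[i j] k] l] qs IH] l0 //= /andP[qN qsN] szq.
  move: (qN) => /and4P[? ? ? ?].
  rewrite -iterS iterSr exec_if {1}/store_mono stoE [nth _ _ _]/= exec_seq exec_pop.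
  have -> : upd (store_mono n N (true :: (enc_quad (i, j, k, l) ++ enc_seq enc_quad qs) ++ [::])
      (enc_seq (mono_word N) l0 ++ [:: false]) 0 0 0 0 0) 3 (behead
      (store_mono n N (true :: (enc_quad (i, j, k, l) ++ enc_seq enc_quad qs) ++ [::])
      (enc_seq (mono_word N) l0 ++ [:: false]) 0 0 0 0 0 3)) =
    store_mono n N (enc_quad (i, j, k, l) ++ (enc_seq enc_quad qs ++ [::]))
      (enc_seq (mono_word N) l0 ++ [:: false]) 0 0 0 0 0.
    by rewrite -[(_ ++ enc_seq _ _) ++ _]catA /store_mono upd_sto stoE.
  rewrite exec_seq ReadE; last by move: szq; rewrite !size_cat /=; lia.
  rewrite exec_seq exec_monos //; last by rewrite /= N0; apply/and5P.
  rewrite ClearE; last by rewrite /= ?andbT; apply/and4P; split; lia.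
  rewrite /prepend foldl_enc_seq IH //; last by move: szq; rewrite !size_cat /=; lia.
  by rewrite [rev _ ++ rev _ ++ _]catA -rev_cat.
rewrite cats0; set l2 := rev _.
rewrite exec_seq exec_monos //; last by rewrite N0.
rewrite /prepend foldl_enc_seq; set l3 := rev _ ++ l2.
have l3E : l3 = h2_monos (System n N qs) by rewrite /l3 /l2 /h2_monos rev_cat.
clearbody l3 => {l2}.
rewrite exec_seq exec_emit /store_mono upd_sto stoE [set_nth _ _ _ _]/=.
rewrite -[sto _]/(store_mono n N [:: false] (enc_seq (mono_word N) [::] ++
  true :: (enc_seq (mono_word N) l3 ++ [:: false])) 0 0 0 0 0).
rewrite exec_seq exec_monos //; last by rewrite N0.
rewrite /prepend foldl_enc_seq cats0; set lh := rev _.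
have lhE : lh = h1_monos by [].
clearbody lh.
rewrite exec_seq exec_push /store_mono upd_sto stoE [set_nth _ _ _ _]/=.
rewrite exec_seq (exec_dup (k := n)) //; last lia.
rewrite upd_sto stoE [set_nth _ _ _ _]/= cats0.
pose o4 := true :: enc_seq (mono_word N) lh ++ true :: enc_seq (mono_word N) l3 ++ [:: false].
have o4E : o4 = enc_seq (enc_seq (mono_word N)) [:: h1_monos; h2_monos (System n N qs)].
  by rewrite /o4 l3E lhE.
rewrite exec_seq -[sto _]/(store_mono n N [:: false] o4 n 0 0 0 0).
rewrite (@exec_whileT_una (fun m o => store_mono n N [:: false] o m 0 0 0 0)
  (fun j o => true :: enc_seq (mono_word N) [:: coord_mono j] ++ o)) //; last 3 first.
- by move=> m o; rewrite /store_mono upd_sto.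
- move=> m o mn; rewrite exec_seq exec_push /store_mono upd_sto stoE [set_nth _ _ _ _]/=.
  rewrite exec_seq (exec_dup (k := m)) //; last lia.
  rewrite upd_sto stoE [set_nth _ _ _ _]/= cats0.
  rewrite exec_seq exec_emit upd_sto stoE [set_nth _ _ _ _]/=.
  rewrite -[sto _]/(store_mono n N [:: false] (enc_seq (mono_word N) [::] ++ o) m 0 0 0 (3 + m)).
  have := @exec_monos L n N [:: false] (enc_seq (mono_word N) [::] ++ o) m 0 0 0 (3 + m) [:: coord_rmono].
  rewrite /Monos [seqc _]/= exec_seq exec_skip => E; rewrite exec_seq E //; last by rewrite N0 /=; lia.
  have -> : prepend N (enc_seq (mono_word N) [::] ++ o) [seq mono_of m 0 0 0 (3 + m) r | r <- [:: coord_rmono]] =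
      enc_seq (mono_word N) [:: coord_mono m] ++ o.
    by rewrite /coord_mono [m + 3]addnC -[enc_seq _ [:: _]]cat1s -!catA.
  set w := enc_seq _ _ ++ o.
  rewrite exec_seq exec_clear; last by rewrite /store_mono stoE /= size_una; lia.
  by rewrite exec_push /store_mono !upd_sto.
- by lia.
have -> : foldr (fun j o => true :: enc_seq (mono_word N) [:: coord_mono j] ++ o) o4 (iota 0 n) =
    enc_seq (enc_seq (mono_word N)) (comps (System n N qs)).
  rewrite /comps [sy_n _]/= o4E; elim: (iota 0 n) => //= j js ->.
  by rewrite -!catA.
set o5 := enc_seq _ _.
have factE m o : m <= L -> exec L (WhileT 6 (Emit 0 [:: true; false])) (store_mono n N [:: false] o m 0 0 0 0) =
    store_mono n N [:: false] (flatten (nseq m [:: true; false]) ++ o) 0 0 0 0 0.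
  move=> mL; rewrite (@exec_whileT_una (fun m o => store_mono n N [:: false] o m 0 0 0 0)
    (fun j o => [:: true; false] ++ o)) //; last 2 first.
  - by move=> m' o'; rewrite /store_mono upd_sto.
  - by move=> m' o' _; rewrite exec_emit /store_mono upd_sto.
  congr (store_mono _ _ _ _ _ _ _ _ _); have : size (iota 0 m) = m by rewrite size_iota.
  by elim: m (iota 0 m) {mL} => [|m IH] [|x l] //= [/IH ->].
have facts m o : enc_seq enc_factor (nseq m.+2 Line) ++ o =
   flatten (nseq m [:: true; false]) ++ [:: true; false; true; false; false] ++ o.
  by elim: m => //= m ->.
rewrite exec_seq exec_emit /store_mono upd_sto stoE [set_nth _ _ _ _]/=.
rewrite exec_seq (exec_dup (k := n)) //; last lia.
rewrite upd_sto stoE [set_nth _ _ _ _]/= cats0 -/(store_mono _ _ _ _ _ _ _ _ _).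
rewrite exec_seq -[[:: true, false, true, false, false & o5]]/([:: true; false; true; false; false] ++ o5).
rewrite factE -?facts; last lia.
rewrite exec_seq exec_emit /store_mono upd_sto stoE [set_nth _ _ _ _]/=.
rewrite exec_seq (exec_dup (k := N)) //.
rewrite upd_sto stoE [set_nth _ _ _ _]/= cats0.
rewrite -[sto _]/(store_mono n N [:: false] ([:: true; false; true; false; false] ++
   (enc_seq enc_factor (nseq n.+2 Line) ++ o5)) N 0 0 0 0).
by rewrite factE // -facts.
Qed.

Definition tuple_of (T : Type) (x0 : T) (n : nat) (s : seq T) : n.-tuple T :=
  [tuple nth x0 s i | i < n].

Lemma val_tuple_of (T : Type) (x0 : T) n s :
  size s = n -> tuple_of x0 n s = s :> seq T.
Proof.
move=> szs; apply: (@eq_from_nth _ x0); first by rewrite size_tuple.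
move=> i; rewrite size_tuple => iN.
by rewrite -(tnth_nth x0 (tuple_of x0 n s) (Ordinal iN)) tnth_mktuple.
Qed.

Definition mono_multinom (N : nat) (m : mono) : int * 'X_{1..N.+2} :=
  (m.1.1, Multinom (tuple_of 0 N.+2 (expo N m))).

Definition system_instance (s : system) : instance :=
  @Instance (sy_N s).+2 (sy_n s).+2 (nseq_tuple _ Line) (nseq_tuple _ Line)
    (tuple_of [::] (sy_n s).+2 [seq map (mono_multinom (sy_N s)) ms | ms <- comps s]).

Definition wf_mono (N : nat) (m : mono) : bool :=
  [&& size m.1.2 == 3, size m.2 == 4, sumn m.1.2 <= 4 & all (fun k => k < N) m.2].

Lemma size_expo N m : 0 < N -> wf_mono N m -> size (expo N m) = N.+2.
Proof.
by move=> N0 /and4P[/eqP s3 _ _ _]; rewrite /expo size_cat s3 size_map size_rev size_iota; lia.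
Qed.

Lemma quad_monos_wf N q : 0 < N -> quad_lt N q -> all (wf_mono N) (quad_monos q).
Proof.
by case: q => [[[i j] k] l] N0 /and4P[iN jN kN lN]; rewrite /quad_monos /= /wf_mono /= /rval /= iN jN kN lN N0.
Qed.

Lemma comps_wf s : wf_system s -> all (all (wf_mono (sy_N s))) (comps s).
Proof.
case: s => n N qs /andP[/= nN qsN]; have N0 : 0 < N by lia.
rewrite /comps all_cat /= andbT; apply/and3P; split.
- apply/allP => ms /mapP[j]; rewrite mem_iota => /andP[_ /= jn] ->.
  by rewrite /= /wf_mono /= /rval /= N0 ?andbT; lia.
- by rewrite /h1_monos /rev /= /wf_mono /= /rval /= N0.
- rewrite /h2_monos all_rev all_cat ?andbT; apply/andP; split; last first.
    by rewrite /= /wf_mono /= /rval /= N0.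
  apply/allP => m /flatten_mapP[q qqs mq].
  by have /allP := quad_monos_wf N0 (allP qsN _ qqs); apply.
Qed.

Lemma size_comps s : size (comps s) = (sy_n s).+2.
Proof. by rewrite /comps size_cat size_map size_iota addn2. Qed.

Lemma eq_enc_seq (T T' : Type) (f : T -> T') (e : T -> word) (e' : T' -> word)
    (P : pred T) s :
  (forall x, P x -> e' (f x) = e x) -> all P s -> enc_seq e' (map f s) = enc_seq e s.
Proof. by move=> E; elim: s => //= x s IH /andP[Px /IH ->]; rewrite E. Qed.

Lemma enc_system_instance s : wf_system s -> enc_instance (system_instance s) = instance_word s.
Proof.
move=> wf; have N0 : 0 < sy_N s by case/andP: wf; lia.
rewrite /enc_instance /instance_word.
have -> : i_map (system_instance s) = [seq map (mono_multinom (sy_N s)) ms | ms <- comps s] :> seq _.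
  by apply: val_tuple_of; rewrite size_map size_comps.
congr (_ ++ (_ ++ _)).
apply: (@eq_enc_seq _ _ _ _ _ (all (wf_mono (sy_N s)))); last exact: comps_wf.
move=> ms msP; apply: (@eq_enc_seq _ _ _ _ _ (wf_mono (sy_N s))) => // m mP.
by rewrite /enc_monomial /mono_word /= val_tuple_of ?size_expo.
Qed.

(** The variables [z], [w], [s] contribute at most 4 by [wf_mono], and each of the four entries of
    [m.2] raises at most one further exponent, by 1. *)
Lemma mdeg_mono N m : 0 < N -> wf_mono N m -> mdeg (mono_multinom N m).2 <= 8.
Proof.
move=> N0 mP; rewrite /mdeg /= val_tuple_of ?size_expo // /expo big_cat /=.
case/and4P: mP => _ /eqP s4 s3 _.
have -> : (\sum_(i <- m.1.2) i = sumn m.1.2)%N by rewrite sumnE.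
rewrite big_map.
have : (\sum_(i <- rev (iota 1 N.-1)) count_mem i m.2 <= size m.2)%N.
  elim: (m.2) => [|k ks IH] /=; first by rewrite big1.
  rewrite big_split /= -[(size ks).+1]add1n; apply: leq_add => //.
  have -> : (\sum_(i <- rev (iota 1 N.-1)) (k == i) = count_mem k (rev (iota 1 N.-1)))%N.
    by rewrite -sum1_count [RHS]big_mkcond /=; apply: eq_bigr => i _; rewrite eq_sym; case: eqP.
  by rewrite (@count_uniq_mem _ _ k) ?leq_b1 // rev_uniq iota_uniq.
by rewrite s4 => H; apply: leq_trans (leq_add s3 H) _.
Qed.

Lemma system_instance_degree s : wf_system s -> degree_le 8 (system_instance s).
Proof.
move=> wf j; have N0 : 0 < sy_N s by case/andP: wf; lia.
rewrite /component (tnth_nth [::]) /= val_tuple_of ?size_map ?size_comps //.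
rewrite (nth_map [::]) ?size_comps //.
have : all (wf_mono (sy_N s)) (nth [::] (comps s) j).
  by apply: (allP (comps_wf wf)); apply: mem_nth; rewrite size_comps.
elim: (nth _ _ _) => [|m ms IH] /=; first by rewrite /poly_of_monomials big_nil msize0.
move=> /andP[mP /IH msP]; rewrite /poly_of_monomials big_cons.
apply: leq_trans (msizeD_le _ _) _; rewrite geq_max msP andbT.
by apply: leq_trans (msizeZ_le _ _) _; rewrite msizeX ltnS mdeg_mono.
Qed.

Lemma system_instance_well_defined R s : well_defined R (system_instance s).
Proof. by move=> x _ i; rewrite /= tnth_nseq. Qed.

(** * Values of the constructed polynomial map and its surjectivity *)

Section SystemInstanceTruth.
Local Open Scope ring_scope.
Variable R : realType.

Lemma eval_monomials n (h : 'I_n -> R) (s : seq (int * 'X_{1..n})) :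
  mmap intr h (poly_of_monomials s) =
  \sum_(ce <- s) ce.1%:~R * \prod_i h i ^+ ce.2 i.
Proof.
rewrite /poly_of_monomials raddf_sum /=; apply: eq_bigr => ce _.
by rewrite mmapZ mmapX.
Qed.

Definition mono_val (z w s : R) (v : nat -> R) (m : mono) : R :=
  m.1.1%:~R * (z ^+ nth 0%N m.1.2 0 * w ^+ nth 0%N m.1.2 1 * s ^+ nth 0%N m.1.2 2) *
  \prod_(k <- m.2) v k.

(** Every entry of [ks] other than 0 occurs exactly once in the range of indices, and an entry 0
    contributes the factor 1. *)
Lemma prod_count (v : nat -> R) N ks : (0 < N)%N -> v 0%N = 1 -> all (fun k => (k < N)%N) ks ->
  \prod_(i <- rev (iota 1 N.-1)) v i ^+ count_mem i ks = \prod_(k <- ks) v k.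
Proof.
move=> N0 v0; elim: ks => [|k ks IH] /=; first by rewrite big_nil big1.
move=> /andP[kN /IH {}IH]; rewrite big_cons -IH.
under eq_bigr do rewrite exprD.
rewrite big_split /=; congr (_ * _).
have [->|k0] := eqVneq k 0%N.
  rewrite v0 big1_seq // => i /andP[_]; rewrite mem_rev mem_iota => /andP[i1 _].
  by case: i i1 => // i _; rewrite expr0.
rewrite (bigD1_seq k) /=; [|by rewrite mem_rev mem_iota; lia|by rewrite rev_uniq iota_uniq].
rewrite eqxx expr1 big1_seq ?mulr1 // => i /andP[ik _].
by rewrite eq_sym (negPf ik) expr0.
Qed.

Lemma eval_mono N (h : 'I_N.+2 -> R) (v : nat -> R) m : (0 < N)%N -> wf_mono N m ->
  v 0%N = 1 -> (forall k, (0 < k < N)%N -> v k = h (inord (N.+2 - k))) ->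
  (mono_multinom N m).1%:~R * \prod_i h i ^+ (mono_multinom N m).2 i =
  mono_val (h (inord 0)) (h (inord 1)) (h (inord 2)) v m.
Proof.
move=> N0 mP v0 vE; rewrite /mono_val -mulrA; congr (_ * _).
have se := size_expo N0 mP; case/and4P: mP => /eqP s3 _ _ kN.
rewrite -(prod_count N0 v0 kN).
have -> : \prod_i h i ^+ (mono_multinom N m).2 i =
    \prod_(0 <= i < N.+2) h (inord i) ^+ nth 0%N (expo N m) i.
  rewrite big_mkord; apply: eq_bigr => i _; rewrite inord_val; congr (_ ^+ _).
  by rewrite /= /fun_of_multinom tnth_mktuple.
rewrite (big_cat_nat (n := 3)) //=; congr (_ * _).
  rewrite !big_nat_recl // big_nil /expo !nth_cat s3 /= mulr1.
  by rewrite mulrA.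
rewrite -[rev (iota 1 N.-1)]/(rev (iota 1 N.-1)).
(* Behind the coordinates of [z], [w], [s], coordinate [i + 3] belongs to the variable with index
   [N - 1 - i]. *)
have -> : \prod_(3 <= i < N.+2) h (inord i) ^+ nth 0%N (expo N m) i =
   \prod_(0 <= i < N.-1) v (N.-1 - i)%N ^+ count_mem (N.-1 - i)%N m.2.
  rewrite -{1}[3%N]add0n big_addn (_ : N.+2 - 3 = N.-1)%N; last lia.
  rewrite !big_nat; apply: eq_bigr => i /andP[_ iN].
  rewrite vE; last lia.
  congr (h (inord _) ^+ _); first lia.
  rewrite /expo nth_cat s3 ltnNge leq_addl /= addnK.
  rewrite (nth_map 0%N) ?size_rev ?size_iota // nth_rev ?size_iota // nth_iota; last lia.
  by congr (count_mem _ _); lia.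
rewrite -(big_map (fun i => N.-1 - i)%N xpredT (fun j => v j ^+ count_mem j m.2)).
apply: congr_big => //; apply: (@eq_from_nth _ 0%N).
  by rewrite size_map size_rev !size_iota subn0.
rewrite size_map size_iota subn0 => i iN.
rewrite /index_iota subn0 (nth_map 0%N) ?size_iota // nth_iota // nth_rev ?size_iota //.
by rewrite nth_iota; lia.
Qed.

Definition defect (v : nat -> R) (q : quad) : R :=
  let: (i, j, k, l) := q in v i * v j + v k - v l.

Lemma sum_defect_ge0 v qs : 0 <= \sum_(q <- qs) defect v q ^+ 2.
Proof. by apply: sumr_ge0 => q _; apply: sqr_ge0. Qed.

Lemma sum_defect_eq0 v qs : \sum_(q <- qs) defect v q ^+ 2 = 0 <-> sat v qs.
Proof.
elim: qs => [|[[[i j] k] l] qs IH]; first by rewrite big_nil.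
rewrite big_cons [sat _ _]/= -IH; have := sum_defect_ge0 v qs.
set S := \sum_(_ <- _) _ => S0; have := sqr_ge0 (v i * v j + v k - v l).
rewrite [defect _ _]/=; split=> [E|[E ->]].
  have E2 : (v i * v j + v k - v l) ^+ 2 = 0 by lra.
  by split; [move/eqP: E2; rewrite sqrf_eq0 => /eqP; lra | lra].
by rewrite E subrr expr0n addr0.
Qed.

Lemma mono_val_quad z w s v q : v 0%N = 1 ->
  \sum_(m <- quad_monos q) mono_val z w s v m = - (w * defect v q ^+ 2).
Proof.
case: q => [[[i j] k] l] v0; rewrite /quad_monos /= !big_cons big_nil /mono_val /= /rval /=.
by rewrite !big_cons !big_nil v0 /=; ring.
Qed.

Lemma mono_val_h1 z w s v : v 0%N = 1 -> \sum_(m <- h1_monos) mono_val z w s v m = z * w - 1.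
Proof.
move=> v0; rewrite /h1_monos /rev /= !big_cons big_nil /mono_val /= /rval /=.
by rewrite !big_cons !big_nil v0 /=; ring.
Qed.

Lemma mono_val_h2 z w s v sy : v 0%N = 1 -> \sum_(m <- h2_monos sy) mono_val z w s v m =
  (z * w - 1) * z ^+ 2 - w * (\sum_(q <- sy_quads sy) defect v q ^+ 2 + s ^+ 2).
Proof.
move=> v0; rewrite /h2_monos (perm_big _ (permEl (perm_rev _))) /= big_cat /=.
rewrite big_flatten /= big_map.
under eq_bigr do rewrite mono_val_quad //.
rewrite sumrN -mulr_sumr !big_cons big_nil /mono_val /= /rval /=.
by rewrite !big_cons !big_nil v0 /=; ring.
Qed.

Lemma mono_val_coord z w s v j : v 0%N = 1 ->
  \sum_(m <- [:: coord_mono j]) mono_val z w s v m = v (j + 3)%N.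
Proof.
by move=> v0; rewrite big_cons big_nil /mono_val /= /rval /= !big_cons !big_nil v0 /=; ring.
Qed.

Lemma cubic_root (u t c : R) : u != 0 -> exists z, u * z ^+ 3 - t * z - c = 0.
Proof.
wlog u0 : u t c / 0 < u.
  move=> W un; have [u0|u0] := ltP 0 u; first exact: W.
  have [||z zP] := W (- u) (- t) (- c); rewrite ?oppr_eq0 // ?oppr_gt0 ?lt_neqAle ?un //.
  by exists z; move: zP; lra.
move=> _; pose p : {poly R} := u *: 'X^3 - t *: 'X - c%:P.
have pE x : p.[x] = u * x ^+ 3 - t * x - c by rewrite /p !hornerE.
(* With this choice [u * m^3] equals [(u + |t| + |c|) * m^2], which dominates [|t| * m + |c|]
   because [m >= 1]; hence the sign changes between [-m] and [m]. *)
pose m := 1 + (`|t| + `|c|) / u.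
have tc0 : 0 <= `|t| + `|c| by rewrite addr_ge0.
have m1 : 1 <= m by rewrite lerDl divr_ge0 // ltW.
have um : u * m = u + (`|t| + `|c|) by rewrite /m; field; rewrite gt_eqF.
have big : `|t| * m + `|c| <= u * m ^+ 3.
  have -> : u * m ^+ 3 = (u + (`|t| + `|c|)) * m ^+ 2 by rewrite -um; ring.
  have := normr_ge0 t; have := normr_ge0 c; nra.
have := ler_norm t; have := ler_norm (- t); have := ler_norm c; have := ler_norm (- c).
rewrite !normrN => c1 c2 t1 t2.
have [||x _ /eqP xP] := @poly_ivt R p (- m) m; first by lra.
  by rewrite !pE; apply/andP; split; nra.
by exists x; rewrite -pE.
Qed.

(** If [u = 0], then [w = - t / P] is forced and has the inverse [z], as [t] is nonzero. If [u] and
    [z] are nonzero, the first equation gives [w = (u + 1) / z], and the second one multiplied by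
    [z] becomes the cubic [u z^3 - t z - (u + 1) P = 0]. *)
Lemma hit_punctured (P u t : R) : 0 < P -> (u != 0) || (t != 0) ->
  exists z w, z * w - 1 = u /\ (z * w - 1) * z ^+ 2 - w * P = t.
Proof.
move=> P0 ut; have PN : P != 0 by rewrite gt_eqF.
have [u0|un] := eqVneq u 0.
  rewrite u0 eqxx /= in ut; exists (- P / t), (- t / P); rewrite u0; split.
    by field; rewrite PN ut.
  by field; rewrite PN ut.
have [z zP] := cubic_root t ((u + 1) * P) un.
(* The root 0 occurs only for [u = -1]; then [z = 0] solves the first equation for every [w], and
   [w] is free for the second. *)
have [z0|zn] := eqVneq z 0.
  have u1 : u = -1.
    move: zP; rewrite z0 expr0n /= !mulr0 subr0 sub0r => /eqP.
    by rewrite oppr_eq0 mulf_eq0 (negPf PN) orbF => /eqP; lra.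
  by exists 0, (- t / P); rewrite u1; split; [ring | field; rewrite PN].
exists z, ((u + 1) / z); split; first by field.
have -> : z * ((u + 1) / z) - 1 = u by field.
have -> : t = (u * z ^+ 3 - (u + 1) * P) / z; last by field.
have -> : u * z ^+ 3 - (u + 1) * P = t * z by lra.
by field.
Qed.

Lemma surjective_system_instance s : wf_system s ->
  surjective_instance R (system_instance s) <-> true_system R s.
Proof.
case: s => n N qs wf; move: (wf); rewrite /wf_system /= => /andP[nN qsN].
have N0 : (0 < N)%N by lia.
pose s := System n N qs.
pose val (a : 'rV[R]_N.+2) k : R := if k == 0%N then 1 else a 0 (inord (N.+2 - k)).
have mapE (a : 'rV[R]_N.+2) (j : 'I_n.+2) : poly_map (I := system_instance s) a 0 j =
    \sum_(m <- nth [::] (comps s) j)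
      mono_val (a 0 (inord 0)) (a 0 (inord 1)) (a 0 (inord 2)) (val a) m.
  rewrite mxE /component (tnth_nth [::]) /= val_tuple_of ?size_map ?size_comps //.
  rewrite (nth_map [::]) ?size_comps // eval_monomials big_map.
  have := allP (comps_wf wf) (nth [::] (comps s) j).
  rewrite mem_nth ?size_comps // => /(_ isT) /allP msP.
  rewrite !big_seq; apply: eq_bigr => m /msP mP; apply: eval_mono => //.
  by move=> k /andP[k0 _]; rewrite /val ifN_eq // -lt0n.
have coordE (a : 'rV[R]_N.+2) (j : 'I_n.+2) : (j < n)%N ->
    poly_map (I := system_instance s) a 0 j = val a (j + 3)%N.
  move=> jn; rewrite mapE /comps nth_cat size_map size_iota jn.
  by rewrite (nth_map 0%N) ?size_iota // nth_iota // mono_val_coord.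
have h1E (a : 'rV[R]_N.+2) (j : 'I_n.+2) : (j : nat) = n ->
    poly_map (I := system_instance s) a 0 j = a 0 (inord 0) * a 0 (inord 1) - 1.
  by move=> jn; rewrite mapE /comps nth_cat size_map size_iota jn ltnn subnn mono_val_h1.
have h2E (a : 'rV[R]_N.+2) (j : 'I_n.+2) : (j : nat) = n.+1 ->
    poly_map (I := system_instance s) a 0 j =
    (a 0 (inord 0) * a 0 (inord 1) - 1) * a 0 (inord 0) ^+ 2 -
    a 0 (inord 1) * (\sum_(q <- qs) defect (val a) q ^+ 2 + a 0 (inord 2) ^+ 2).
  move=> jn; rewrite mapE /comps nth_cat size_map size_iota jn ltnNge leqnSn /=.
  by rewrite subSnn /= mono_val_h2.
have boxT k (a : 'rV[R]_k) : @box R k (nseq_tuple k Line) a.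
  by move=> i; rewrite tnth_nseq.
split=> [surj x|tr b _].
(* A preimage of the point [x] followed by two zeros encodes a solution of the system. *)
- have [a _ aE] := surj (\row_j if (j < n)%N then x j else 0) (boxT _ _).
  have aEj j : poly_map a 0 j = if (j < n)%N then x j else 0.
    by rewrite aE mxE.
  exists (val a); split=> //=.
    move=> j jn; have jn2 : (j < n.+2)%N by lia.
    by have := aEj (Ordinal jn2); rewrite coordE //= jn.
  have nn : (n < n.+2)%N by lia.
  have := aEj (Ordinal nn); rewrite h1E //= ltnn => e1.
  have := aEj ord_max; rewrite h2E //= ltnNge leqnSn /= e1 mul0r sub0r => /eqP.
  rewrite oppr_eq0 mulf_eq0 => /orP[/eqP w0|/eqP P0].
    by move: e1; rewrite w0 mulr0; lra.
  by apply/sum_defect_eq0; have := sum_defect_ge0 (val a) qs; have := sqr_ge0 (a 0 (inord 2)); lra.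
pose x j : R := b 0 (inord j).
have nn : (n < n.+2)%N by lia.
pose row z w r (v : nat -> R) : 'rV[R]_N.+2 :=
  \row_i (if i == 0%N :> nat then z else if i == 1%N :> nat then w else
          if i == 2%N :> nat then r else v (N.+2 - i)%N).
have rowE z w r v : v 0%N = 1 -> [/\ row z w r v 0 (inord 0) = z, row z w r v 0 (inord 1) = w,
    row z w r v 0 (inord 2) = r & forall k, (k < N)%N -> val (row z w r v) k = v k].
  move=> v0; split; [by rewrite /row mxE inordK | by rewrite /row mxE inordK | |].
    by rewrite /row mxE inordK //; lia.
  move=> k kN; rewrite /val; case: eqP => [->//|k0]; rewrite mxE inordK; last lia.
  by rewrite !ifN; [congr v; lia|lia|lia|lia].
suff [z [w [r [v [v0 vx e1 e2]]]]] : exists z w r v, [/\ v 0%N = 1 :> R,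
    forall j, (j < n)%N -> v (j + 3)%N = x j, z * w - 1 = b 0 (Ordinal nn) &
    (z * w - 1) * z ^+ 2 - w * (\sum_(q <- qs) defect v q ^+ 2 + r ^+ 2) = b 0 ord_max].
  have [E0 E1 E2 Ev] := rowE z w r v v0.
  exists (row z w r v); first exact: boxT.
  apply/rowP => j; have := ltn_ord j; rewrite ltnS leq_eqVlt => /orP[/eqP jn|].
    rewrite h2E // E0 E1 E2; have -> : j = ord_max by apply/val_inj.
    rewrite -e2; congr (_ - _ * (_ + _)); apply: eq_big_seq => -[[[i k] l] m] qq.
    by have /and4P[? ? ? ?] := allP qsN _ qq; rewrite /= !Ev.
  rewrite ltnS leq_eqVlt => /orP[/eqP jn|jn].
    by rewrite h1E // E0 E1 e1; congr (b 0 _); apply/val_inj.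
  have jn' : (j < n)%N := jn.
  have jN : (j + 3 < N)%N by apply: leq_trans nN; rewrite -addSn leq_add2r.
  rewrite (coordE _ _ jn') (Ev _ jN) (vx _ jn').
  rewrite /x; congr (b 0 _); apply/val_inj; rewrite /= inordK //; exact: ltn_ord.
(* Over the origin a solution of the system is used, with [z = w = 1] and [s = 0]. *)
have [/andP[/eqP u0 /eqP t0]|nz] := boolP ((b 0 (Ordinal nn) == 0) && (b 0 ord_max == 0)).
  have [v [v0 vx /sum_defect_eq0 vq]] := tr x.
  exists 1, 1, 0, v; split=> //; first by rewrite u0; ring.
  by rewrite t0 vq; ring.
(* Away from the origin any assignment with the prescribed universal part will do, and [s = 1] makes
   [P] at least 1. *)
pose v k : R := if k == 0%N then 1 else if (k < 3)%N then 0 else x (k - 3)%N.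
have P0 : 0 < \sum_(q <- qs) defect v q ^+ 2 + 1 ^+ 2.
  by have := sum_defect_ge0 v qs; lra.
have [|z [w [e1 e2]]] := hit_punctured (u := b 0 (Ordinal nn)) (t := b 0 ord_max) P0.
  by rewrite -negb_and.
exists z, w, 1, v; split=> // j jn; rewrite /v addn3 /=; congr x; lia.
Qed.

End SystemInstanceTruth.

(** * Straight-line generation of equations *)

(* Registers 4, ..., 18 hold unary numbers, given by [rho]; register 0 holds the
   equations generated so far, and [sg] gives the other registers. *)
Definition numreg (i : nat) : bool := 4 <= i <= 18.

Definition gstore (sg : store) (rho : nat -> nat) (qs : seq quad) : store :=
  fun i => if i == 0 then enc_seq enc_quad qs else if numreg i then una (rho i) else sg i.

Definition rupd (rho : nat -> nat) (r v : nat) : nat -> nat :=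
  fun r' => if r' == r then v else rho r'.

Inductive acmd :=
  | ASet of nat & nat
  | AInc of nat
  | AQuad of nat & nat & nat & nat
  | ADef of nat & nat & nat & nat.

Definition ccmd (c : acmd) : cmd :=
  match c with
  | ASet o i => Set_ o i
  | AInc i => Push i true
  | AQuad a b c d => EmitQ a b c d
  | ADef a b c r => Def 5 a b c r
  end.

Definition gstate : Type := (nat -> nat) * seq quad.

(* [ADef a b c r] defines a new variable [v_a * v_b + v_c] and puts its index
   into register [r]; register 5 is the first unused index. *)
Definition astep (g : gstate) (c : acmd) : gstate :=
  let: (rho, qs) := g in
  match c with
  | ASet o i => (rupd rho o (rho i), qs)
  | AInc i => (rupd rho i (rho i).+1, qs)
  | AQuad a b c d => (rho, (rho a, rho b, rho c, rho d) :: qs)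
  | ADef a b c r =>
      (rupd (rupd rho r (rho 5)) 5 (rho 5).+1, (rho a, rho b, rho c, rho 5) :: qs)
  end.

Definition arun (l : seq acmd) (g : gstate) : gstate := foldl astep g l.

Definition acmd_ok (c : acmd) : bool :=
  match c with
  | ASet o i => [&& numreg o, numreg i & i != o]
  | AInc i => numreg i
  | AQuad a b c d => [&& numreg a, numreg b, numreg c & numreg d]
  | ADef a b c r => [&& numreg a, numreg b, numreg c, numreg r & r != 5]
  end.

Lemma gstore_upd0 sg rho qs q :
  upd (gstore sg rho qs) 0 (true :: enc_quad q ++ gstore sg rho qs 0) = gstore sg rho (q :: qs).
Proof. by apply: funext => i; rewrite /upd /gstore /=; case: eqP. Qed.

Lemma gstore_updr sg rho qs r k : numreg r ->
  upd (gstore sg rho qs) r (una k) = gstore sg (rupd rho r k) qs.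
Proof.
move=> nr; apply: funext => i; rewrite /upd /gstore /rupd; case: eqP => [->|//].
by rewrite nr ifN // ; move: nr; rewrite /numreg; lia.
Qed.

Lemma gstore_upds sg rho qs r w : r != 0 -> ~~ numreg r ->
  upd (gstore sg rho qs) r w = gstore (upd sg r w) rho qs.
Proof.
move=> r0 nr; apply: funext => i; rewrite /upd /gstore; case: (i =P r) => [->|_ //].
by rewrite (negPf nr) (negPf r0).
Qed.

Lemma gstore_num sg rho qs r : numreg r -> gstore sg rho qs r = una (rho r).
Proof. by move=> nr; rewrite /gstore nr ifN //; move: nr; rewrite /numreg; lia. Qed.

Lemma numreg02 r : numreg r -> (r != 0) && (r != 2).
Proof. by rewrite /numreg; lia. Qed.

Lemma exec_ccmd L sg g c : acmd_ok c -> sg 2 = [::] -> (forall r, g.1 r <= L) ->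
  exec L (ccmd c) (gstore sg g.1 g.2) = gstore sg (astep g c).1 (astep g c).2.
Proof.
case: g => rho qs /=; move=> ok s2 bd; have g2 : gstore sg rho qs 2 = [::] by [].
case: c ok => [o i|i|a b c d|a b c r] /=.
- move=> /and3P[no ni io].
  have C : [&& i != 2, o != 2 & i != o].
    by case/andP: (numreg02 ni) => _ ->; case/andP: (numreg02 no) => _ ->.
  rewrite (exec_set C (gstore_num _ _ _ ni) g2 (bd i)) ?gstore_updr //.
  by rewrite gstore_num // size_una.
- by move=> ni; rewrite exec_push gstore_num // cons_una gstore_updr.
- move=> /and4P[na nb nc nd].
  have C1 : all (fun i => (i != 0) && (i != 2)) [:: a; b; c; d] by rewrite /= !numreg02.
  have C2 : all (fun k => k <= L) [:: rho a; rho b; rho c; rho d] by rewrite /= !bd.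
  by rewrite (exec_emitQ C1 g2 (gstore_num _ _ _ na) (gstore_num _ _ _ nb)
    (gstore_num _ _ _ nc) (gstore_num _ _ _ nd) C2) gstore_upd0.
- move=> /and5P[na nb nc nr r5].
  have C1 : all (fun i => (i != 0) && (i != 2)) [:: a; b; c; 5; r] && (5 != r).
    by rewrite /= !numreg02 // eq_sym r5.
  have C2 : all (fun k => k <= L) [:: rho a; rho b; rho c; rho 5; size (gstore sg rho qs r)].
    by rewrite gstore_num // size_una /= !bd.
  rewrite (exec_def C1 g2 (gstore_num _ _ _ na) (gstore_num _ _ _ nb)
    (gstore_num _ _ _ nc) _ C2) // gstore_upd0 !gstore_updr //.
Qed.

Lemma astep_bound B g c : (forall r, g.1 r <= B) -> forall r, (astep g c).1 r <= B.+1.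
Proof.
case: g => rho qs /= bd r; case: c => *; rewrite /= /rupd;
  by repeat case: ifP => _; rewrite ?ltnS ?bd // leqW.
Qed.

Definition ACmds (l : seq acmd) : cmd := locked (seqc (map ccmd l)).

(** A command raises a register bound by at most one, so all numbers met stay within the number of
    rounds that the copying loops have. *)
Lemma exec_acmds L B sg g l : all acmd_ok l -> sg 2 = [::] -> (forall r, g.1 r <= B) ->
  B + size l <= L ->
  exec L (ACmds l) (gstore sg g.1 g.2) = gstore sg (arun l g).1 (arun l g).2.
Proof.
rewrite /ACmds -lock; elim: l g B => //= c l IH g B /andP[okc okl] s2 bd BL.
rewrite exec_seq exec_ccmd //; last by move=> r; apply: leq_trans (bd r) _; lia.
by apply: (IH _ B.+1) => //; [apply: astep_bound | lia].
Qed.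

Lemma arun_bound B g l : (forall r, g.1 r <= B) -> forall r, (arun l g).1 r <= B + size l.
Proof.
elim: l g B => [|c l IH] g B bd r /=; first by rewrite addn0.
by rewrite addnS -addSn; apply: IH; apply: astep_bound.
Qed.

(** * From polynomial maps to systems *)

(* Reading one bit of input pays for 16 steps of [acmd]. *)
Definition pst (r : word) (g : gstate) : store :=
  gstore (upd (fun=> [::]) 3 r) g.1 g.2.
Definition credit (L k : nat) (r : word) (g : gstate) : Prop :=
  forall i, g.1 i + 16 * size r + k <= L.

(** A Hoare triple for a command that consumes the prefix [x] of the input and acts on the state by
    [f], with credit [k] before and [k'] after. The frame [m] is credit set aside, which lets
    triples be composed. *)
Definition reads (L k : nat) (x : word) (c : cmd) (f : gstate -> gstate) (k' : nat) : Prop :=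
  forall m r g, credit L (k + m) (x ++ r) g ->
    exec L c (pst (x ++ r) g) = pst r (f g) /\ credit L (k' + m) r (f g).

Lemma reads_seq L k1 k2 k3 x1 x2 c1 c2 f1 f2 :
  reads L k1 x1 c1 f1 k2 -> reads L k2 x2 c2 f2 k3 ->
  reads L k1 (x1 ++ x2) (c1 ;; c2) (fun g => f2 (f1 g)) k3.
Proof.
move=> R1 R2 m r g; rewrite -catA => C1.
by have [E1 C2] := R1 _ _ _ C1; rewrite exec_seq E1; apply: R2.
Qed.

Lemma reads_acmds L k l : all acmd_ok l -> reads L (size l + k) [::] (ACmds l) (arun l) k.
Proof.
move=> okl m r g C.
have Ci i : g.1 i <= L - size l - (16 * size r + k + m) by have := C i; rewrite /=; lia.
split.
  rewrite /pst (@exec_acmds L (L - size l - (16 * size r + k + m))) //.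
  by have := C 0; rewrite /=; lia.
by move=> i; have := arun_bound l Ci i; have := C i; rewrite /=; lia.
Qed.

Lemma reads_weak L k k' x c f k2 : k <= k' -> reads L k x c f k2 -> reads L k' x c f k2.
Proof.
move=> kk R m r g C; apply: R => i; apply: leq_trans (C i); lia.
Qed.

Ltac reads_acm :=
  match goal with |- reads ?L _ _ (ACmds ?l) _ ?k' =>
    apply: (@reads_weak _ (size l + k')); [by [] | exact: (@reads_acmds L k' l isT)] end.

Lemma pst_pop b r g : upd (pst (b :: r) g) 3 r = pst r g.
Proof. by rewrite /pst gstore_upds //; congr gstore; apply: funext => i; rewrite /upd; case: eqP. Qed.

Lemma pst3 r g : pst r g 3 = r. Proof. by []. Qed.

Lemma reads_pop L k b : reads L k [:: b] (Pop 3) id (k + 16).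
Proof.
move=> m r g C; rewrite exec_pop pst3 /= pst_pop; split=> // i.
by have := C i; rewrite /=; lia.
Qed.

Definition ReadBit (cF cT : cmd) : cmd := If 3 Skip (Pop 3 ;; cF) (Pop 3 ;; cT).

Lemma reads_bit L k k' b cF cT f :
  reads L (k + 16) [::] (if b then cT else cF) f k' ->
  reads L k [:: b] (ReadBit cF cT) f k'.
Proof.
move=> R m r g C; rewrite exec_if pst3 /=.
have [E C'] := reads_pop C; rewrite exec_pop pst3 /= pst_pop in E.
by case: b R C E => R C E; rewrite exec_seq exec_pop pst3 /= pst_pop; apply: (R m r g C').
Qed.

Definition ReadSeq (body : cmd) : cmd := WhileT 3 body ;; Pop 3.

(** Consuming the marker in front of an entry releases the 16 units that pay for the body, so the
    iteration is self-financing; the closing bit leaves another 16. *)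
Lemma reads_seq_loop L T (enc : T -> word) body (step : gstate -> T -> gstate) :
  (forall x, reads L 16 (enc x) body (step^~ x) 0) ->
  forall s, reads L 0 (enc_seq enc s) (ReadSeq body) (fun g => foldl step g s) 16.
Proof.
move=> R s m r g C; rewrite exec_seq.
have [||||/=|E C'] := @whileT_seq gstate T enc pst (credit L m) step L 3 body _ _ _ _ s g r.
- exact: pst3.
- by move=> r' g' /(_ 0); lia.
- exact: pst_pop.
- move=> r' g' x C'; apply: (R x m) => i; have := C' i; rewrite /=; lia.
- exact: C.
rewrite E; exact: (@reads_pop L 0 false m r _ C').
Qed.

(** Every coordinate, on a line or a segment, occupies three consecutive variables, of which the
    first is its value. The next coordinate is then always found by adding 3. *)
Definition lineA : seq acmd := [:: AInc 5; AInc 5; AInc 5].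
Definition segA : seq acmd :=
  [:: ASet 10 5; AInc 5; ASet 11 5; AInc 5; ASet 12 5; AInc 5;
      AQuad 10 10 11 6; AQuad 12 12 7 11].
Definition lineB : seq acmd := [:: AQuad 9 6 7 5; AInc 5; AInc 5; AInc 5; AInc 9].
(* [b = 2 c / (1 + c ^ 2)] runs through [-1, 1] as [c] runs through the reals. *)
Definition segB : seq acmd :=
  [:: ASet 10 5; AInc 5; ASet 11 5; AInc 5; ASet 12 5; AInc 5;
      AQuad 9 9 6 11; AQuad 10 11 7 12; AQuad 9 6 9 12; AInc 9].
Definition doublec : seq acmd := [:: ADef 10 6 10 10].
Definition squarec : seq acmd := [:: ADef 12 12 7 12].

Definition facA (F : factor) := if F is Line then lineA else segA.
Definition facB (F : factor) := if F is Line then lineB else segB.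

(** Numbers are given in binary, least significant digit first. Register 10 runs through the powers
    of two while 11 accumulates the coefficient; [g_digit] likewise squares repeatedly in 12 and
    multiplies into 13. The number of equations is thus linear in the number of digits. *)
Definition g_coef (g : gstate) (b : bool) : gstate :=
  arun doublec (if b then arun [:: ADef 10 6 11 11] g else g).
Definition g_digit (g : gstate) (b : bool) : gstate :=
  arun squarec (if b then arun [:: ADef 13 12 7 13] g else g).
Definition g_exp (g : gstate) (e : nat) : gstate :=
  arun [:: AInc 15; AInc 15; AInc 15] (foldl g_digit (arun [:: ASet 12 15] g) (digits e)).
Definition g_intb (g : gstate) (b : bool) (k : nat) : gstate :=
  arun [:: ADef 11 18 7 13; ASet 15 16]
    (foldl g_coef (arun [:: ASet 18 (if b then 8 else 6); ASet 10 6; ASet 11 7] g) (digits k)).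
Definition g_int (g : gstate) (c : int) : gstate :=
  match c with Posz k => g_intb g false k | Negz k => g_intb g true k.+1 end.
Definition g_mono n (g : gstate) (ce : int * 'X_{1..n}) : gstate :=
  arun [:: ADef 13 6 14 14] (foldl g_exp (g_int g ce.1) ce.2).
Definition g_comp n (g : gstate) (s : seq (int * 'X_{1..n})) : gstate :=
  arun [:: AQuad 14 6 7 17; AInc 17; AInc 17; AInc 17]
    (foldl (@g_mono n) (arun [:: ASet 14 7] g) s).
(** Registers 6, 7, 8 hold the indices of the constants 1, 0, -1; the two equations force the last
    two values. Register 9 is the next universal variable, 16 the first domain coordinate, 17 the
    codomain coordinate in progress, 15 the domain coordinate within a monomial, 18 the sign of a
    coefficient, and 14 the partial sum of a component. *)
Definition init_acmds : seq acmd :=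
  [:: AInc 7; AInc 8; AInc 8; ASet 5 4; AInc 5; AInc 5; AInc 5; AQuad 6 7 7 7;
      AQuad 8 6 6 7; AInc 9; AInc 9; AInc 9; ASet 16 5].
Definition g_init (n : nat) : gstate :=
  arun init_acmds (fun i => if i == 4 then n else 0, [::]).
Definition g_final (n : nat) (I : instance) : gstate :=
  let gA := foldl (fun g F => arun (facA F) g) (g_init n) (i_A I) in
  let gB := foldl (fun g F => arun (facB F) g) (arun [:: ASet 17 5] gA) (i_B I) in
  foldl (@g_comp _) gB (i_map I).

Definition CoefLoop : cmd := ReadSeq (ReadBit Skip (ACmds [:: ADef 10 6 11 11]) ;; ACmds doublec).
Definition IntCmd : cmd :=
  ReadBit (ACmds [:: ASet 18 6; ASet 10 6; ASet 11 7]) (ACmds [:: ASet 18 8; ASet 10 6; ASet 11 7]) ;;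
  CoefLoop ;; ACmds [:: ADef 11 18 7 13; ASet 15 16].
Definition ExpCmd : cmd :=
  ACmds [:: ASet 12 15] ;;
  ReadSeq (ReadBit Skip (ACmds [:: ADef 13 12 7 13]) ;; ACmds squarec) ;;
  ACmds [:: AInc 15; AInc 15; AInc 15].
Definition MonoCmd : cmd := IntCmd ;; ReadSeq ExpCmd ;; ACmds [:: ADef 13 6 14 14].
Definition CompCmd : cmd :=
  ACmds [:: ASet 14 7] ;; ReadSeq MonoCmd ;; ACmds [:: AQuad 14 6 7 17; AInc 17; AInc 17; AInc 17].

Definition system_program : cmd :=
  Loop (If 1 Skip (Pop 1 ;; Push 3 false ;; Push 4 true) (Pop 1 ;; Push 3 true ;; Push 4 true)) ;;
  Push 0 false ;;
  ACmds init_acmds ;;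
  ReadSeq (ReadBit (ACmds lineA) (ACmds segA)) ;; ACmds [:: ASet 17 5] ;;
  ReadSeq (ReadBit (ACmds lineB) (ACmds segB)) ;;
  ReadSeq CompCmd ;;
  Push 0 false ;; Dup 5 0 ;; Push 0 false ;; Dup 4 0.

Lemma regs_system_program : regs_lt 19 system_program.
Proof.
by rewrite /system_program /CompCmd /MonoCmd /ExpCmd /IntCmd /CoefLoop /ReadSeq /ReadBit
  /init_acmds /lineA /segA /lineB /segB /doublec /squarec
  /ACmds -!lock /= /Def -!lock /= /EmitQ -!lock /= /Set_ -!lock /= /Dup -!lock /= /Clear -!lock /=
  /WhileT -!lock.
Qed.

Lemma reads_digit L b : reads L 16 [:: b]
  (ReadBit Skip (ACmds [:: ADef 13 12 7 13]) ;; ACmds squarec) (g_digit^~ b) 0.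
Proof.
rewrite -[[:: b]]cats0; apply: (reads_seq (k2 := 1) (f2 := arun squarec)).
  apply: (@reads_bit _ _ _ _ _ _ (fun g => if b then arun [:: ADef 13 12 7 13] g else g)).
  case: b => /=; first by reads_acm.
  by apply: (@reads_weak _ 1) => // m r g C; rewrite exec_skip.
by reads_acm.
Qed.

Lemma reads_coef L b : reads L 16 [:: b]
  (ReadBit Skip (ACmds [:: ADef 10 6 11 11]) ;; ACmds doublec) (g_coef^~ b) 0.
Proof.
rewrite -[[:: b]]cats0; apply: (reads_seq (k2 := 1) (f2 := arun doublec)).
  apply: (@reads_bit _ _ _ _ _ _ (fun g => if b then arun [:: ADef 10 6 11 11] g else g)).
  case: b => /=; first by reads_acm.
  by apply: (@reads_weak _ 1) => // m r g C; rewrite exec_skip.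
by reads_acm.
Qed.

Lemma reads_exp L e : reads L 16 (enc_binary e) ExpCmd (g_exp^~ e) 0.
Proof.
rewrite -[enc_binary e]cat0s -[enc_binary e]cats0.
apply: (reads_seq (k2 := 0) (f1 := arun [:: ASet 12 15])
   (f2 := fun g => arun [:: AInc 15; AInc 15; AInc 15] (foldl g_digit g (digits e)))).
  by reads_acm.
apply: (reads_seq (k2 := 16) (f2 := arun [:: AInc 15; AInc 15; AInc 15])).
  exact: (reads_seq_loop (@reads_digit L)).
by reads_acm.
Qed.

Lemma reads_int L c : reads L 16 (enc_int c) IntCmd (g_int^~ c) 0.
Proof.
have H b k : reads L 16 (b :: enc_binary k) IntCmd (fun g => arun [:: ADef 11 18 7 13; ASet 15 16]
    (foldl g_coef (arun [:: ASet 18 (if b then 8 else 6); ASet 10 6; ASet 11 7] g) (digits k))) 0.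
  rewrite -[b :: enc_binary k]cat1s -[enc_binary k]cats0.
  apply: (reads_seq (k2 := 0) (f1 := arun [:: ASet 18 (if b then 8 else 6); ASet 10 6; ASet 11 7])
    (f2 := fun g => arun [:: ADef 11 18 7 13; ASet 15 16] (foldl g_coef g (digits k)))).
    by apply: reads_bit; case: b => /=; reads_acm.
  apply: (reads_seq (k2 := 16) (f2 := arun [:: ADef 11 18 7 13; ASet 15 16])).
    exact: (reads_seq_loop (@reads_coef L)).
  by reads_acm.
by case: c => k; apply: H.
Qed.

Lemma reads_mono L n (ce : int * 'X_{1..n}) :
  reads L 16 (enc_monomial ce) MonoCmd ((@g_mono n)^~ ce) 0.
Proof.
rewrite /enc_monomial -[enc_seq _ _]cats0.
apply: (reads_seq (k2 := 0) (f1 := g_int^~ ce.1)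
   (f2 := fun g => arun [:: ADef 13 6 14 14] (foldl g_exp g ce.2))).
  exact: reads_int.
apply: (reads_seq (k2 := 16) (f2 := arun [:: ADef 13 6 14 14])).
  exact: (reads_seq_loop (@reads_exp L)).
by reads_acm.
Qed.

Lemma reads_comp L n (s : seq (int * 'X_{1..n})) :
  reads L 16 (enc_seq (@enc_monomial n) s) CompCmd ((@g_comp n)^~ s) 0.
Proof.
rewrite -[enc_seq _ _]cat0s -[enc_seq _ _]cats0.
apply: (reads_seq (k2 := 0) (f1 := arun [:: ASet 14 7])
   (f2 := fun g => arun [:: AQuad 14 6 7 17; AInc 17; AInc 17; AInc 17] (foldl (@g_mono n) g s))).
  by reads_acm.
apply: (reads_seq (k2 := 16) (f2 := arun [:: AQuad 14 6 7 17; AInc 17; AInc 17; AInc 17])).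
  exact: (reads_seq_loop (@reads_mono L n)).
by reads_acm.
Qed.

(** The number of universal variables is the length of the input. It has to be known before the
    codomain is parsed, because the domain coordinates are placed behind these variables, and it is
    at least [i_cod I]. *)
Definition instance_system (I : instance) : system :=
  let n := size (enc_instance I) in
  let g := g_final n I in System n (g.1 5) g.2.

Lemma g_reg4 I n : (g_final n I).1 4 = n.
Proof.
have ar l g : all (fun c => match c with ASet o _ | AInc o | ADef _ _ _ o => o != 4 | _ => true end) l ->
   (arun l g).1 4 = g.1 4.
  elim: l g => //= c l IH [rho qs] /andP[oc /IH ->].
  by case: c oc => //= [o i|i|a b c r] o4; rewrite /rupd ?(eq_sym 4) ?(negPf o4).
have fo T (step : gstate -> T -> gstate) l g : (forall g x, (step g x).1 4 = g.1 4) ->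
  (foldl step g l).1 4 = g.1 4.
  by move=> E; elim: l g => //= x l IH g; rewrite IH E.
have hcoef g b : (g_coef g b).1 4 = g.1 4 by rewrite /g_coef ar //; case: b; rewrite ?ar.
have hdigit g b : (g_digit g b).1 4 = g.1 4 by rewrite /g_digit ar //; case: b; rewrite ?ar.
have hexp g e : (g_exp g e).1 4 = g.1 4 by rewrite /g_exp ar // (fo _ _ _ _ hdigit) ar.
have hint g c : (g_int g c).1 4 = g.1 4.
  by case: c => k; rewrite /g_int /g_intb ar // (fo _ _ _ _ hcoef) ar.
have hmono k g ce : (@g_mono k g ce).1 4 = g.1 4.
  by rewrite /g_mono ar // (fo _ _ _ _ hexp) hint.
have hcomp k g s : (@g_comp k g s).1 4 = g.1 4.
  by rewrite /g_comp ar // (fo _ _ _ _ (@hmono k)) ar.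
rewrite /g_final (fo _ _ _ _ (@hcomp _)) (fo _ (fun g F => arun (facB F) g)); last by move=> g []; rewrite ar.
by rewrite ar // (fo _ (fun g F => arun (facA F) g)) ?ar // => g []; rewrite ar.
Qed.

Lemma exec_seq_eq N c1 c2 s s' i t :
  exec N c1 s = s' -> exec N c2 s' i = t -> exec N (c1 ;; c2) s i = t.
Proof. by rewrite exec_seq => ->. Qed.

Lemma exec_system_program L I : 64 * size (enc_instance I) + 64 <= L ->
  exec L system_program (program_init (enc_instance I)) 0 = enc_system (instance_system I).
Proof.
set w := enc_instance I; move=> wL; rewrite /system_program exec_seq exec_loop.
pose S r u k := upd (upd (upd (fun=> [::]) 1 r) 3 u) 4 (una k) : store.
have -> : program_init w = S (rev w) [::] 0.
  by apply: funext => i; rewrite /program_init /S /upd; do 5?[case: i => [|i] //].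
have moveP r u k : iter (size r) (exec L (If 1 Skip (Pop 1 ;; Push 3 false ;; Push 4 true)
     (Pop 1 ;; Push 3 true ;; Push 4 true))) (S r u k) = S [::] (rev r ++ u) (size r + k).
  elim: r u k => // b r IH u k; rewrite [size _]/= iterSr rev_cons cat_rcons addSnnS -IH.
  congr (iter _ _ _); rewrite exec_if {1}/S /upd /=.
  by case: b; rewrite !(exec_seq, exec_push, exec_pop) /S; apply: funext => i;
     rewrite /upd; do 5?[case: i => [|i] //].
rewrite (@iter_stable _ _ (size (rev w)) L _ _ _ (moveP _ _ _)) //; last by rewrite size_rev; lia.
rewrite revK cats0 addn0 size_rev exec_seq exec_push.
have -> : upd (S [::] w (size w)) 0 (false :: S [::] w (size w) 0) =
    pst w (fun i => if i == 4 then size w else 0, [::]).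
  apply: funext => i; rewrite /pst /gstore /S /upd /numreg /=.
  by do 19?[case: i => [|i] //].
set g0 := (_, _).
have C0 : credit L (13 + 16) w g0.
  by move=> i; rewrite /g0 /=; case: (i == 4); lia.
have [E1 C1] := @reads_acmds L 16 init_acmds isT 0 w g0 C0.
apply: (exec_seq_eq E1).
have rA : forall F, reads L 16 (enc_factor F) (ReadBit (ACmds lineA) (ACmds segA)) (arun (facA F)) 0.
  by case; apply: reads_bit => /=; reads_acm.
have rB : forall F, reads L 16 (enc_factor F) (ReadBit (ACmds lineB) (ACmds segB)) (arun (facB F)) 0.
  by case; apply: reads_bit => /=; reads_acm.
have C1' : credit L (0 + 16) (enc_seq enc_factor (i_A I) ++ (enc_seq enc_factor (i_B I) ++
  enc_seq (enc_seq (@enc_monomial _)) (i_map I))) (arun init_acmds g0) := C1.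
have [E2 C2] := reads_seq_loop (step := fun g F => arun (facA F) g) rA C1'.
apply: (exec_seq_eq E2).
have [E3 C3] := @reads_acmds L 0 [:: ASet 17 5] isT 31 _ _ C2.
apply: (exec_seq_eq E3).
have [E4 C4] := reads_seq_loop (step := fun g F => arun (facB F) g) rB C3.
apply: (exec_seq_eq E4).
move: C4 => C4; rewrite -[enc_seq (enc_seq _) _]cats0 in C4 *.
have [E5 C5] := reads_seq_loop (@reads_comp L _) (C4 : credit L (0 + 47) _ _).
apply: (exec_seq_eq E5); rewrite -/(g_init _) -/(g_final (size w) I) in C5 *.
have b5 : (g_final (size w) I).1 5 <= L by have := C5 5; lia.
have b4 : (g_final (size w) I).1 4 <= L by have := C5 4; lia.
rewrite {1}/pst exec_seq exec_push.
rewrite exec_seq (exec_dup (k := (g_final (size w) I).1 5)) //.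
rewrite exec_seq exec_push (exec_dup (k := (g_final (size w) I).1 4)) //.
rewrite /upd /= /enc_system /instance_system /= -/w g_reg4.
by cat_norm.
Qed.

(** * Truth of the system obtained from an instance *)

Fixpoint numd (ds : word) : nat := if ds is b :: ds' then b + 2 * numd ds' else 0.

Lemma numd_digits n : numd (digits n) = n.
Proof.
have pos p : numd (pos_digits p) = nat_of_pos p.
  by elim: p => [p IH|p IH|] //=; rewrite IH NatTrec.doubleE -mul2n.
by rewrite -[RHS]bin_of_natK /digits; case: bin_of_nat => [|p] //=; rewrite pos.
Qed.

Lemma quad_lt_le F F' qs : F <= F' -> all (quad_lt F) qs -> all (quad_lt F') qs.
Proof.
move=> FF; apply: sub_all => -[[[i j] k] l] /and4P[? ? ? ?].
by apply/and4P; split; apply: leq_trans FF.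
Qed.

Section SystemTruth.
Local Open Scope ring_scope.
Variable R : realType.
Implicit Types (v : nat -> R) (g : gstate).

Definition cst3 v : Prop := [/\ v 0%N = 1, v 1%N = 0 & v 2%N = -1].

Definition good g : Prop :=
  [/\ g.1 6%N = 0%N, g.1 7%N = 1%N, g.1 8%N = 2%N, (3 <= g.1 5%N)%N & all (quad_lt (g.1 5%N)) g.2].

Definition agree (F : nat) v v' : Prop := forall i, (i < F)%N -> v' i = v i.

Lemma agree_cst3 F v v' : (3 <= F)%N -> agree F v v' -> cst3 v -> cst3 v'.
Proof. by move=> F3 ag [? ? ?]; split; rewrite ag //; lia. Qed.

(* [g'] is obtained from [g] by adding equations that can always be satisfied by
   choosing values for the new variables, and that imply [rel]. *)
Definition ext (keep : seq nat) g g' (rel : (nat -> R) -> Prop) : Prop :=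
  [/\ (g.1 5%N <= g'.1 5%N)%N, good g', all (fun r => g'.1 r == g.1 r) keep,
      (forall v, cst3 v -> sat v g'.2 -> sat v g.2 /\ rel v) &
      (forall v, cst3 v -> sat v g.2 -> exists2 v', agree (g.1 5%N) v v' & sat v' g'.2)].

(** An assignment is extended twice; the constants survive the first extension because only indices
    from 3 on are changed. *)
Lemma ext_trans keep g1 g2 g3 r1 r2 : (3 <= g1.1 5%N)%N ->
  ext keep g1 g2 r1 -> ext keep g2 g3 r2 -> ext keep g1 g3 (fun v => r1 v /\ r2 v).
Proof.
move=> F3 [l1 G1 /allP k1 s1 c1] [l2 G2 /allP k2 s2 c2]; split=> //.
- exact: leq_trans l2.
- by apply/allP => r rk; rewrite (eqP (k2 r rk)) (eqP (k1 r rk)).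
- by move=> v cv /(s2 v cv)[/(s1 v cv)[] ? ? ?].
- move=> v cv /(c1 v cv)[v1 a1 sv1]; have [v2 a2 sv2] := c2 v1 (agree_cst3 F3 a1 cv) sv1.
  by exists v2 => // i iF; rewrite a2 ?a1 //; apply: leq_trans l1.
Qed.

Lemma ext_weak keep keep' g g' r r' : {subset keep' <= keep} ->
  (forall v, cst3 v -> r v -> r' v) -> ext keep g g' r -> ext keep' g g' r'.
Proof.
move=> sk rr [l G /allP k s c]; split=> //; first by apply/allP => x /sk /k.
by move=> v cv /(s v cv)[? /(rr v cv)].
Qed.

Lemma ext_regs (keep : seq nat) g g' : good g -> g'.2 = g.2 ->
  all (fun r => g'.1 r == g.1 r) ([:: 5; 6; 7; 8]%N ++ keep) -> ext keep g g' (fun=> True).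
Proof.
move=> [h6 h7 h8 h5 hq] e2; rewrite all_cat => /andP[/= /and5P[/eqP e5 /eqP e6 /eqP e7 /eqP e8 _] kk].
split=> //; rewrite ?e5 //.
- by split; rewrite ?e5 ?e6 ?e7 ?e8 ?e2.
- by move=> v _; rewrite e2.
- by move=> v _ sv; exists v => //; rewrite e2.
Qed.

(** A defining equation excludes no solution: its new variable takes the value of the defining
    expression, and the older equations do not mention it. *)
Lemma ext_def (keep : seq nat) g (a b c r : nat) : good g ->
  [&& g.1 a < g.1 5%N, g.1 b < g.1 5%N & g.1 c < g.1 5%N]%N ->
  r \notin ([:: 5; 6; 7; 8]%N ++ keep) -> 5%N \notin keep ->
  ext keep g (astep g (ADef a b c r))
    (fun v => v (g.1 5%N) = v (g.1 a) * v (g.1 b) + v (g.1 c)).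
Proof.
case: g => rho qs [/= h6 h7 h8 h5 hq] /and3P[ha hb hc].
rewrite !inE !negb_or => /and5P[r5 r6 r7 r8 rk] k5.
split=> /=; rewrite /rupd /=.
- exact: leqnSn.
- split=> /=; rewrite ?(eq_sym 6) ?(eq_sym 7) ?(eq_sym 8) ?(negPf r6) ?(negPf r7) ?(negPf r8) //; first lia.
  by rewrite !ltnS (ltnW ha) (ltnW hb) (ltnW hc) leqnn /=; apply: quad_lt_le hq.
- apply/allP => x xk; rewrite ifN; last by apply: contraNneq k5 => <-.
  by rewrite ifN //; apply: contraNneq rk => <-.
- by move=> v _ [<- ?].
- move=> v _ sv; exists (fun i => if i == rho 5%N then v (rho a) * v (rho b) + v (rho c) else v i).
    by move=> i iF; rewrite ltn_eqF.
  rewrite eqxx !ltn_eqF //; split=> //.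
  by apply: sat_eq sv; first exact: hq; move=> i iF; rewrite ltn_eqF.
Qed.

Definition keepX : seq nat := [:: 4; 9; 14; 16; 17]%N.

Lemma digit_spec g b : good g -> (g.1 12%N < g.1 5%N)%N -> (g.1 13%N < g.1 5%N)%N ->
  let g' := g_digit g b in
  [/\ ext (15%N :: keepX) g g' (fun v => v (g'.1 12%N) = v (g.1 12%N) ^+ 2 /\
                              v (g'.1 13%N) = v (g.1 13%N) * v (g.1 12%N) ^+ b),
      (g'.1 12%N < g'.1 5%N)%N & (g'.1 13%N < g'.1 5%N)%N].
Proof.
move=> G h12 h13 g'; case: (G) => [h6 h7 h8 h5 _].
have h7' : (g.1 7%N < g.1 5%N)%N by rewrite h7; lia.
case: b @g' => g'.
  have E1 := @ext_def (15%N :: keepX) g 13 12 7 13 G.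
  rewrite h13 h12 h7' in E1; have {}E1 := E1 isT isT isT.
  set g1 := astep g _ in E1; have G1 : good g1 by case: E1.
  have r12 : g1.1 12%N = g.1 12%N by rewrite /g1; case: (g).
  have r7 : g1.1 7%N = g.1 7%N by rewrite /g1; case: (g).
  have r13 : g1.1 13%N = g.1 5%N by rewrite /g1; case: (g).
  have r5 : g1.1 5%N = (g.1 5%N).+1 by rewrite /g1; case: (g).
  have E2 := @ext_def (15%N :: keepX) g1 12 12 7 12 G1.
  rewrite r12 r7 r5 !ltnS (ltnW h12) (ltnW h7') in E2; have {}E2 := E2 isT isT isT.
  have g'E : g' = astep g1 (ADef 12 12 7 12) by [].
  have q12 : g'.1 12%N = (g.1 5%N).+1 by rewrite g'E -r5; case: (g1).
  have q13 : g'.1 13%N = g.1 5%N by rewrite g'E -r13; case: (g1).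
  have q5 : g'.1 5%N = (g.1 5%N).+2 by rewrite g'E -r5; case: (g1).
  rewrite q12 q13 q5 !ltnS leqnn leqnSn; split=> //.
  apply: (ext_weak (keep := 15%N :: keepX)) (ext_trans h5 E1 E2) => // v [_ v1 _].
  by rewrite h7 v1 => -[-> ->]; rewrite !addr0.
have E2 := @ext_def (15%N :: keepX) g 12 12 7 12 G.
rewrite h12 h7' in E2; have {}E2 := E2 isT isT isT.
have g'E : g' = astep g (ADef 12 12 7 12) by [].
have q12 : g'.1 12%N = g.1 5%N by rewrite g'E; case: (g).
have q13 : g'.1 13%N = g.1 13%N by rewrite g'E; case: (g).
have q5 : g'.1 5%N = (g.1 5%N).+1 by rewrite g'E; case: (g).
rewrite q12 q13 q5 ltnS leqnn ltnS (ltnW h13); split=> //.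
apply: ext_weak E2 => // v [_ v1 _]; rewrite h7 v1 => ->.
by rewrite addr0 expr0 mulr1.
Qed.

Lemma digits_spec g ds : good g -> (g.1 12%N < g.1 5%N)%N -> (g.1 13%N < g.1 5%N)%N ->
  let g' := foldl g_digit g ds in
  ext (15%N :: keepX) g g' (fun v => v (g'.1 13%N) = v (g.1 13%N) * v (g.1 12%N) ^+ numd ds) /\
  (g'.1 13%N < g'.1 5%N)%N.
Proof.
elim: ds g => [|b ds IH] g G h12 h13 /=.
  split=> //; apply: (ext_weak (keep := 15%N :: keepX) (r := fun=> True)) => //.
    by move=> v _ _; rewrite expr0 mulr1.
  by apply: ext_regs => //; apply/allP.
have [E1 q12 q13] := digit_spec b G h12 h13; have G1 : good (g_digit g b) by case: E1.
have [E2 q] := IH _ G1 q12 q13; split=> //.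
have F3 : (3 <= g.1 5%N)%N by case: G.
apply: (ext_weak (keep := 15%N :: keepX)) (ext_trans F3 E1 E2) => // v _ [[e12 e13] ->].
by rewrite e12 e13 exprD exprM mulrA.
Qed.

Lemma exp_spec g e : good g -> (g.1 13%N < g.1 5%N)%N -> (g.1 15%N < g.1 5%N)%N ->
  let g' := g_exp g e in
  [/\ ext keepX g g' (fun v => v (g'.1 13%N) = v (g.1 13%N) * v (g.1 15%N) ^+ e),
      (g'.1 13%N < g'.1 5%N)%N & g'.1 15%N = (g.1 15%N + 3)%N].
Proof.
move=> G h13 h15 g'; have F3 : (3 <= g.1 5%N)%N by case: G.
pose g1 := arun [:: ASet 12 15] g.
have g1E : [/\ g1.1 12%N = g.1 15%N, g1.1 13%N = g.1 13%N, g1.1 5%N = g.1 5%N, g1.1 15%N = g.1 15%N & g1.2 = g.2].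
  by rewrite /g1; case: (g).
case: g1E => r12 r13 r5 r15 r2.
have E1 : ext (15%N :: keepX) g g1 (fun=> True).
  by apply: ext_regs => //; rewrite /g1 /keepX; case: (g) => rho qs; apply/allP => x; rewrite !inE; do !case/predU1P => [->//|]; move/eqP => ->.
have G1 : good g1 by case: E1.
have h12' : (g1.1 12%N < g1.1 5%N)%N by rewrite r12 r5.
have h13' : (g1.1 13%N < g1.1 5%N)%N by rewrite r13 r5.
have [E2 q13] := digits_spec (digits e) G1 h12' h13'.
set g2 := foldl _ _ _ in E2 q13.
have E3 : ext keepX g2 g' (fun v => v (g'.1 13%N) = v (g2.1 13%N)).
  have G2 : good g2 by case: E2.
  have gE : g' = arun [:: AInc 15; AInc 15; AInc 15] g2 by [].
  apply: (ext_weak (keep := keepX) (r := fun=> True)) => //; first by rewrite gE; case: (g2).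
  apply: ext_regs => //; first by rewrite gE; case: (g2).
  by rewrite gE /keepX; case: (g2) => rho qs; apply/allP => x; rewrite !inE; do !case/predU1P => [->//|]; move/eqP => ->.
have k15 : g2.1 15%N = g1.1 15%N by case: E2 => _ _ /andP[/eqP].
split.
- have E12 := ext_trans F3 E1 E2.
  have E12' : ext keepX g g2 _ := ext_weak (keep' := keepX) (fun x xk => mem_behead (s := 15%N :: keepX) xk) (fun v _ h => h) E12.
  apply: (ext_weak (keep := keepX)) (ext_trans F3 E12' E3) => // v _ [[_ e2] ->].
  by rewrite e2 r12 r13 numd_digits.
- by rewrite /g' /g_exp -/g1 -/g2; case: (g2) q13.
- rewrite /g' /g_exp -/g1 -/g2 -r15 -k15; case: (g2) => rho qs; rewrite /arun /= /rupd /=; lia.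
Qed.

Lemma exps_spec g es : good g -> (g.1 13%N < g.1 5%N)%N -> (g.1 15%N + 3 * size es <= g.1 5%N)%N ->
  let g' := foldl g_exp g es in
  ext keepX g g' (fun v => v (g'.1 13%N) =
    v (g.1 13%N) * \prod_(0 <= k < size es) v (g.1 15%N + 3 * k)%N ^+ nth 0%N es k) /\
  (g'.1 13%N < g'.1 5%N)%N.
Proof.
elim: es g => [|e es IH] g G h13 h15 /=.
  split=> //; apply: (ext_weak (keep := keepX) (r := fun=> True)) => //.
    by move=> v _ _; rewrite big_geq // mulr1.
  by apply: ext_regs => //; apply/allP.
have h15' : (g.1 15%N < g.1 5%N)%N by move: h15 => /=; lia.
have [E1 q13 q15] := exp_spec e G h13 h15'; have G1 : good (g_exp g e) by case: E1.
have F3 : (3 <= g.1 5%N)%N by case: G.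
have l5 : (g.1 5%N <= (g_exp g e).1 5%N)%N by case: E1.
have [|E2 q] := IH _ G1 q13; first by rewrite q15; move: h15 l5 => /=; lia.
split=> //; apply: (ext_weak (keep := keepX)) (ext_trans F3 E1 E2) => // v _ [e1 ->].
rewrite e1 -mulrA big_nat_recl // muln0 addn0; congr (_ * (_ * _)).
by apply: eq_big_nat => k _; rewrite q15; congr (v _ ^+ _); lia.
Qed.

Lemma coef_spec g b : good g -> (g.1 10%N < g.1 5%N)%N -> (g.1 11%N < g.1 5%N)%N ->
  let g' := g_coef g b in
  [/\ ext (18%N :: keepX) g g' (fun v => v (g'.1 10%N) = v (g.1 10%N) *+ 2 /\
                              v (g'.1 11%N) = v (g.1 11%N) + v (g.1 10%N) *+ b),
      (g'.1 10%N < g'.1 5%N)%N & (g'.1 11%N < g'.1 5%N)%N].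
Proof.
move=> G h10 h11 g'; case: (G) => [h6 h7 h8 h5 _].
have h6' : (g.1 6%N < g.1 5%N)%N by rewrite h6; lia.
case: b @g' => g'.
  have E1 := @ext_def (18%N :: keepX) g 10 6 11 11 G.
  rewrite h10 h11 h6' in E1; have {}E1 := E1 isT isT isT.
  set g1 := astep g _ in E1; have G1 : good g1 by case: E1.
  have r10 : g1.1 10%N = g.1 10%N by rewrite /g1; case: (g).
  have r6 : g1.1 6%N = g.1 6%N by rewrite /g1; case: (g).
  have r11 : g1.1 11%N = g.1 5%N by rewrite /g1; case: (g).
  have r5 : g1.1 5%N = (g.1 5%N).+1 by rewrite /g1; case: (g).
  have E2 := @ext_def (18%N :: keepX) g1 10 6 10 10 G1.
  rewrite r10 r6 r5 !ltnS (ltnW h10) (ltnW h6') in E2; have {}E2 := E2 isT isT isT.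
  have g'E : g' = astep g1 (ADef 10 6 10 10) by [].
  have q10 : g'.1 10%N = (g.1 5%N).+1 by rewrite g'E -r5; case: (g1).
  have q11 : g'.1 11%N = g.1 5%N by rewrite g'E -r11; case: (g1).
  have q5 : g'.1 5%N = (g.1 5%N).+2 by rewrite g'E -r5; case: (g1).
  rewrite q10 q11 q5 !ltnS leqnn leqnSn; split=> //.
  apply: (ext_weak (keep := 18%N :: keepX)) (ext_trans h5 E1 E2) => // v [v0 _ _].
  by rewrite h6 v0 !mulr1 mulr2n => -[-> ->]; split=> //; rewrite /= mulr1n addrC.
have E2 := @ext_def (18%N :: keepX) g 10 6 10 10 G.
rewrite h10 h6' in E2; have {}E2 := E2 isT isT isT.
have g'E : g' = astep g (ADef 10 6 10 10) by [].
have q10 : g'.1 10%N = g.1 5%N by rewrite g'E; case: (g).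
have q11 : g'.1 11%N = g.1 11%N by rewrite g'E; case: (g).
have q5 : g'.1 5%N = (g.1 5%N).+1 by rewrite g'E; case: (g).
rewrite q10 q11 q5 ltnS leqnn ltnS (ltnW h11); split=> //.
apply: ext_weak E2 => // v [v0 _ _]; rewrite h6 v0 => ->.
by rewrite mulr1 mulr2n mulr0n addr0.
Qed.

Lemma coefs_spec g ds : good g -> (g.1 10%N < g.1 5%N)%N -> (g.1 11%N < g.1 5%N)%N ->
  let g' := foldl g_coef g ds in
  ext (18%N :: keepX) g g' (fun v => v (g'.1 11%N) = v (g.1 11%N) + v (g.1 10%N) *+ numd ds) /\
  (g'.1 11%N < g'.1 5%N)%N.
Proof.
elim: ds g => [|b ds IH] g G h10 h11 /=.
  split=> //; apply: (ext_weak (keep := 18%N :: keepX) (r := fun=> True)) => //.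
    by move=> v _ _; rewrite mulr0n addr0.
  by apply: ext_regs => //; apply/allP.
have [E1 q10 q11] := coef_spec b G h10 h11; have G1 : good (g_coef g b) by case: E1.
have [E2 q] := IH _ G1 q10 q11; split=> //.
have F3 : (3 <= g.1 5%N)%N by case: G.
apply: (ext_weak (keep := 18%N :: keepX)) (ext_trans F3 E1 E2) => // v _ [[e10 e11] ->].
by rewrite e10 e11 mulrnDr mulrnA addrA.
Qed.

Lemma intb_spec g b k : good g ->
  let g' := g_intb g b k in
  [/\ ext keepX g g' (fun v => v (g'.1 13%N) = (-1) ^+ b * k%:R),
      (g'.1 13%N < g'.1 5%N)%N & g'.1 15%N = g.1 16%N].
Proof.
move=> G g'; case: (G) => [h6 h7 h8 F3 _].
pose g1 := arun [:: ASet 18 (if b then 8 else 6); ASet 10 6; ASet 11 7] g.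
have [r18 r10 r11 r5 r2] : [/\ g1.1 18%N = (if b then 2 else 0)%N, g1.1 10%N = 0%N, g1.1 11%N = 1%N, g1.1 5%N = g.1 5%N & g1.2 = g.2].
  by move: h6 h7 h8; rewrite /g1; case: (g) => rho qs /= h6 h7 h8; case: (b); rewrite /arun /= /rupd /= ?h6 ?h7 ?h8.
have E1 : ext keepX g g1 (fun=> True).
  by apply: ext_regs => //; rewrite /g1 /keepX; case: (g) => rho qs; apply/allP => x; rewrite !inE; do !case/predU1P => [->//|]; move/eqP => ->.
have G1 : good g1 by case: E1.
have [||E2 q11] := coefs_spec (digits k) G1; [by rewrite r10 r5; apply: leq_trans F3 | by rewrite r11 r5; apply: leq_trans F3 |].
set g2 := foldl _ _ _ in E2 q11.
have G2 : good g2 by case: E2.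
have k18 : g2.1 18%N = g1.1 18%N by case: E2 => _ _ /andP[/eqP].
have k16 : g2.1 16%N = g1.1 16%N by case: E2 => _ _ /allP/(_ 16%N isT)/eqP.
case: (G2) => [a6 a7 a8 a5 _].
have E3 := @ext_def keepX g2 11 18 7 13 G2.
have c18 : (g2.1 18%N < g2.1 5%N)%N by rewrite k18 r18; case: (b); lia.
have c7 : (g2.1 7%N < g2.1 5%N)%N by rewrite a7; lia.
rewrite q11 c18 c7 in E3; have {}E3 := E3 isT isT isT.
set g3 := astep g2 _ in E3; have G3 : good g3 by case: E3.
have E4 : ext keepX g3 g' (fun=> True).
  have gE : g' = astep g3 (ASet 15 16) by [].
  by apply: ext_regs => //; rewrite gE /keepX; case: (g3) => rho qs //; apply/allP => x; rewrite !inE; do !case/predU1P => [->//|]; move/eqP => ->.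
have r13 : g'.1 13%N = g2.1 5%N by rewrite /g' /g_intb -/g1 -/g2; case: (g2).
have r5' : g'.1 5%N = (g2.1 5%N).+1 by rewrite /g' /g_intb -/g1 -/g2; case: (g2).
split.
- have E12 := ext_trans F3 E1 (ext_weak (keep' := keepX) (fun x xk => mem_behead (s := 18%N :: keepX) xk) (fun v _ h => h) E2).
  have E34 := ext_trans a5 E3 E4.
  apply: (ext_weak (keep := keepX)) (ext_trans F3 E12 E34) => // v [v0 v1 v2] [[_ e2] [e3 _]].
  rewrite r13 e3 e2 k18 r18 r10 r11 a7 v0 v1 numd_digits add0r addr0 mulrC.
  by case: (b); rewrite ?v2 ?v0.
- by rewrite r13 r5'.
- rewrite /g' /g_intb -/g1 -/g2.
  have -> : (arun [:: ADef 11 18 7 13; ASet 15 16] g2).1 15%N = g2.1 16%N by case: (g2).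
  by rewrite k16 /g1; case: (g).
Qed.

Lemma int_spec g c : good g ->
  let g' := g_int g c in
  [/\ ext keepX g g' (fun v => v (g'.1 13%N) = c%:~R),
      (g'.1 13%N < g'.1 5%N)%N & g'.1 15%N = g.1 16%N].
Proof.
move=> G; case: c => k.
  have [E1 E2 E3] := intb_spec false k G; split=> //.
  by apply: ext_weak E1 => // v _ ->; rewrite mul1r.
have [E1 E2 E3] := intb_spec true k.+1 G; split=> //.
by apply: ext_weak E1 => // v _ ->; rewrite expr1 mulN1r NegzE mulrNz.
Qed.

Definition keepM : seq nat := [:: 4; 9; 16; 17]%N.

Definition mval (base : nat) n v (ce : int * 'X_{1..n}) : R :=
  ce.1%:~R * \prod_(i < n) v (base + 3 * i)%N ^+ ce.2 i.

Lemma mono_spec n g (ce : int * 'X_{1..n}) : good g -> (g.1 14%N < g.1 5%N)%N ->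
  (g.1 16%N + 3 * n <= g.1 5%N)%N ->
  let g' := g_mono g ce in
  ext keepM g g' (fun v => v (g'.1 14%N) = v (g.1 14%N) + mval (g.1 16%N) v ce) /\
  (g'.1 14%N < g'.1 5%N)%N.
Proof.
move=> G h14 h16 g'; have F3 : (3 <= g.1 5%N)%N by case: G.
have [E1 q13 q15] := int_spec ce.1 G; set g1 := g_int g ce.1 in E1 q13 q15.
have G1 : good g1 by case: E1.
have l1 : (g.1 5%N <= g1.1 5%N)%N by case: E1.
have [|E2 p13] := exps_spec (es := ce.2) G1 q13; first by rewrite q15 size_tuple; lia.
set g2 := foldl _ _ _ in E2 p13; have G2 : good g2 by case: E2.
have l2 : (g1.1 5%N <= g2.1 5%N)%N by case: E2.
have k14 : g2.1 14%N = g.1 14%N.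
  by case: E2 => _ _ /allP/(_ 14%N isT)/eqP ->; case: E1 => _ _ /allP/(_ 14%N isT)/eqP ->.
case: (G2) => a6 _ _ a5 _.
have E3 := @ext_def keepM g2 13 6 14 14 G2.
have c14 : (g2.1 14%N < g2.1 5%N)%N by rewrite k14; lia.
have c6 : (g2.1 6%N < g2.1 5%N)%N by rewrite a6; lia.
rewrite p13 c6 c14 in E3; have {}E3 := E3 isT isT isT.
have r14 : g'.1 14%N = g2.1 5%N by rewrite /g' /g_mono -/g1 -/g2; case: (g2).
have r5 : g'.1 5%N = (g2.1 5%N).+1 by rewrite /g' /g_mono -/g1 -/g2; case: (g2).
split; last by rewrite r14 r5.
have sk : {subset keepM <= keepX} by apply/allP.
have E12 := ext_weak sk (fun v _ h => h) (ext_trans F3 E1 E2).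
apply: (ext_weak (keep := keepM)) (ext_trans F3 E12 E3) => // v [v0 _ _] [[e1 e2] e3].
rewrite r14 e3 e2 e1 a6 v0 mulr1 k14 addrC /mval; congr (_ + _ * _).
rewrite size_tuple big_mkord; apply: eq_bigr => i _; rewrite q15; congr (_ ^+ _).
by rewrite -tnth_nth.
Qed.

Lemma monos_spec n g (s : seq (int * 'X_{1..n})) : good g -> (g.1 14%N < g.1 5%N)%N ->
  (g.1 16%N + 3 * n <= g.1 5%N)%N ->
  let g' := foldl (@g_mono n) g s in
  ext keepM g g' (fun v => v (g'.1 14%N) = v (g.1 14%N) + \sum_(ce <- s) mval (g.1 16%N) v ce) /\
  (g'.1 14%N < g'.1 5%N)%N.
Proof.
elim: s g => [|ce s IH] g G h14 h16 /=.
  split=> //; apply: (ext_weak (keep := keepM) (r := fun=> True)) => //.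
    by move=> v _ _; rewrite big_nil addr0.
  by apply: ext_regs => //; apply/allP.
have [E1 q14] := mono_spec ce G h14 h16; have G1 : good (g_mono g ce) by case: E1.
have F3 : (3 <= g.1 5%N)%N by case: G.
have l5 : (g.1 5%N <= (g_mono g ce).1 5%N)%N by case: E1.
have k16 : (g_mono g ce).1 16%N = g.1 16%N by case: E1 => _ _ /allP/(_ 16%N isT)/eqP.
have [|E2 q] := IH _ G1 q14; first by rewrite k16; lia.
split=> //; apply: (ext_weak (keep := keepM)) (ext_trans F3 E1 E2) => // v _ [e1 ->].
by rewrite e1 k16 big_cons addrA.
Qed.

(** This falls outside [ext]: the last equation ties the sum to a codomain variable that exists
    already, so a solution extends only if the component has the right value there. *)
Lemma comp_spec n g (s : seq (int * 'X_{1..n})) : good g ->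
  (g.1 16%N + 3 * n <= g.1 5%N)%N -> (g.1 17%N < g.1 5%N)%N ->
  let g' := g_comp g s in
  [/\ (g.1 5%N <= g'.1 5%N)%N, good g', g'.1 16%N = g.1 16%N, g'.1 17%N = (g.1 17%N + 3)%N &
   (forall v, cst3 v -> sat v g'.2 -> sat v g.2 /\ v (g.1 17%N) = \sum_(ce <- s) mval (g.1 16%N) v ce) /\
   (forall v, cst3 v -> sat v g.2 -> v (g.1 17%N) = \sum_(ce <- s) mval (g.1 16%N) v ce ->
     exists2 v', agree (g.1 5%N) v v' & sat v' g'.2)].
Proof.
move=> G h16 h17 g'; case: (G) => [h6 h7 h8 F3 hq].
pose g1 := arun [:: ASet 14 7] g.
have [r14 r16 r17 r5 r2] : [/\ g1.1 14%N = 1%N, g1.1 16%N = g.1 16%N, g1.1 17%N = g.1 17%N, g1.1 5%N = g.1 5%N & g1.2 = g.2].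
  by move: h7; rewrite /g1; case: (g).
have E1 : ext keepM g g1 (fun=> True).
  by apply: ext_regs => //; rewrite /g1 /keepM; case: (g) => rho qs; apply/allP => x; rewrite !inE; do !case/predU1P => [->//|]; move/eqP => ->.
have G1 : good g1 by case: E1.
have [||E2 q14] := monos_spec s G1; [by rewrite r14 r5; lia | by rewrite r16 r5 |].
set g2 := foldl _ _ _ in E2 q14; have G2 : good g2 by case: E2.
have E12 := ext_trans F3 E1 E2; case: (E12) => l12 _ k12 s12 c12.
have k16 : g2.1 16%N = g.1 16%N by move/allP: k12 => /(_ 16%N isT)/eqP.
have k17 : g2.1 17%N = g.1 17%N by move/allP: k12 => /(_ 17%N isT)/eqP.
case: (G2) => a6 a7 a8 a5 aq.
have [g'5 g'16 g'17 g'2] : [/\ g'.1 5%N = g2.1 5%N, g'.1 16%N = g2.1 16%N, g'.1 17%N = (g2.1 17%N + 3)%N &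
   g'.2 = (g2.1 14%N, 0%N, 1%N, g2.1 17%N) :: g2.2].
  rewrite /g' /g_comp -/g1 -/g2; move: a6 a7; case: (g2) => rho qs /= e6 e7.
  by rewrite /arun /= /rupd /= e6 e7 addn3.
rewrite g'5 g'16 g'17 k16 k17; split=> //.
- have [g'6 g'7 g'8] : [/\ g'.1 6%N = g2.1 6%N, g'.1 7%N = g2.1 7%N & g'.1 8%N = g2.1 8%N].
    by rewrite /g' /g_comp -/g1 -/g2; case: (g2).
  split; rewrite ?g'5 ?g'6 ?g'7 ?g'8 //.
  by rewrite g'2 /= q14 k17 aq andbT; apply/and3P; split; lia.
- split=> v cv; rewrite g'2.
    case: (cv) => v0 v1 _ [/= qq /(s12 v cv)[sv [_ e]]]; split=> //.
    by move: qq; rewrite v0 v1 mulr1 addr0 k17 => <-; rewrite e r14 v1 add0r r16.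
  move=> sv e17; have [v' ag sv'] := c12 v cv sv; exists v' => //; split=> //.
  have cv' := agree_cst3 F3 ag cv; have [_ [_ e]] := s12 v' cv' sv'.
  case: cv' => v0 v1 _; rewrite /= v0 v1 mulr1 addr0 e r14 v1 add0r k17 ag // e17 r16.
  apply: eq_bigr => ce _; rewrite /mval; congr (_ * _); apply: eq_bigr => i _; rewrite ag //.
  by have := ltn_ord i; lia.
Qed.

Lemma comps_spec n g (ss : seq (seq (int * 'X_{1..n}))) : good g ->
  (g.1 16%N + 3 * n <= g.1 5%N)%N -> (g.1 17%N + 3 * size ss <= g.1 5%N)%N ->
  let g' := foldl (@g_comp n) g ss in
  [/\ (g.1 5%N <= g'.1 5%N)%N, good g' &
   (forall v, cst3 v -> sat v g'.2 -> sat v g.2 /\ forall k, (k < size ss)%N ->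
      v (g.1 17%N + 3 * k)%N = \sum_(ce <- nth [::] ss k) mval (g.1 16%N) v ce) /\
   (forall v, cst3 v -> sat v g.2 -> (forall k, (k < size ss)%N ->
      v (g.1 17%N + 3 * k)%N = \sum_(ce <- nth [::] ss k) mval (g.1 16%N) v ce) ->
     exists2 v', agree (g.1 5%N) v v' & sat v' g'.2)].
Proof.
elim: ss g => [|s ss IH] g G h16 h17 /=.
  by split=> //; split=> // v _ sv _; exists v.
have h17' : (g.1 17%N < g.1 5%N)%N by move: h17 => /=; lia.
have [l1 G1 r16 r17 [s1 c1]] := comp_spec s G h16 h17'.
have F3 : (3 <= g.1 5%N)%N by case: G.
have [||l2 G2 [s2 c2]] := IH _ G1; [by rewrite r16; lia | by rewrite r17; move: h17 l1 => /=; lia|].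
split=> //; first exact: leq_trans l2.
rewrite r16 r17 in s2 c2; split=> v cv.
  move=> /(s2 v cv)[/(s1 v cv)[sv e] es]; split=> // -[|k] kl; first by rewrite muln0 addn0.
  by rewrite -es //; congr (v _); lia.
move=> sv es; have [|v1 a1 sv1] := c1 v cv sv; first by have := es 0%N isT; rewrite muln0 addn0.
have cv1 := agree_cst3 F3 a1 cv.
(* The extension made for the first component leaves the domain coordinates alone, hence the values
   of the other components. *)
have mE k : \sum_(ce <- nth [::] ss k) mval (g.1 16%N) v1 ce = \sum_(ce <- nth [::] ss k) mval (g.1 16%N) v ce.
  apply: eq_bigr => ce _; rewrite /mval; congr (_ * _); apply: eq_bigr => i _; rewrite a1 //.
  by have := ltn_ord i; lia.
have [|v2 a2 sv2] := c2 v1 cv1 sv1.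
  move=> k kl; rewrite mE; have := es k.+1 kl => /= <-; rewrite a1; first by congr (v _); lia.
  by move: h17 => /=; lia.
by exists v2 => // i iF; rewrite a2 ?a1 //; apply: leq_trans l1.
Qed.

Lemma factor_segment (x : R) : factor_set Segment x <-> -1 <= x <= 1.
Proof. by rewrite /factor_set /= in_itv. Qed.

Definition set3 v (F : nat) (a b c : R) : nat -> R :=
  fun i => if i == F then a else if i == F.+1 then b else if i == F.+2 then c else v i.

Lemma set3E v F a b c : [/\ set3 v F a b c F = a, set3 v F a b c F.+1 = b, set3 v F a b c F.+2 = c &
  agree F v (set3 v F a b c)].
Proof.
rewrite /set3 eqxx; split.
- by [].
- by rewrite (gtn_eqF (leqnn _)) eqxx.
- by rewrite (gtn_eqF (leqnSn _)) (gtn_eqF (leqnn _)) eqxx.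
- by move=> i iF; rewrite ltn_eqF // ltn_eqF ?ltn_eqF //; lia.
Qed.

Lemma sat_agree F v v' qs : all (quad_lt F) qs -> agree F v v' -> sat v qs -> sat v' qs.
Proof. by move=> hq ag; apply: sat_eq; [exact: hq | move=> i iF; rewrite ag]. Qed.

(** Domain coordinates are existential, so the second half has to reach every point [a] of the
    factor, which [ext] cannot express. *)
Lemma facA_spec g A : good g ->
  let g' := arun (facA A) g in
  [/\ g'.1 5%N = (g.1 5%N + 3)%N, good g', g'.1 9%N = g.1 9%N, g'.1 16%N = g.1 16%N &
  (forall v, cst3 v -> sat v g'.2 -> sat v g.2 /\ factor_set A (v (g.1 5%N))) /\
  (forall v a, cst3 v -> sat v g.2 -> factor_set A a ->
     exists2 v', agree (g.1 5%N) v v' & sat v' g'.2 /\ v' (g.1 5%N) = a)].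
Proof.
case: g => rho qs [/= h6 h7 h8 h5 hq]; case: A; rewrite /arun /= /rupd /=; split=> //.
- by rewrite addn3.
- by split=> //=; apply: quad_lt_le hq; lia.
- split=> // v a cv sv _; have [e0 _ _ ag] := set3E v (rho 5%N) a 0 0.
  by exists (set3 v (rho 5%N) a 0 0) => //; split=> //; apply: sat_agree ag sv.
- by rewrite addn3.
- split=> //=; have -> : all (quad_lt (rho 5%N).+3) qs by apply: quad_lt_le hq; lia.
  by rewrite h6 h7 ?andbT; repeat (apply/andP; split); lia.
- split=> [v [v0 v1 v2] | v a [v0 v1 v2] sv].
    rewrite h6 h7 v0 v1 => -[q1 [q2 sv]]; split=> //; apply/factor_segment.
    move: (v (rho 5%N).+2) (v (rho 5%N).+1) (v (rho 5%N)) q1 q2 => z y x q1 q2.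
    by apply/andP; split; nra.
  move=> /factor_segment /andP[a1 a2].
  have p : 0 <= 1 - a * a by nra.
  have [e0 e1 e2 ag] := set3E v (rho 5%N) a (1 - a * a) (Num.sqrt (1 - a * a)).
  exists (set3 v (rho 5%N) a (1 - a * a) (Num.sqrt (1 - a * a))) => //; split=> //.
  have sv' := sat_agree hq ag sv.
  rewrite h6 h7 e0 e1 e2 !ag ?v0 ?v1; [|lia|lia].
  split; first by rewrite -expr2 sqr_sqrtr // addr0.
  by split=> //; ring.
Qed.

Lemma facAs_spec g As : good g ->
  let g' := foldl (fun g A => arun (facA A) g) g As in
  [/\ g'.1 5%N = (g.1 5%N + 3 * size As)%N, good g', g'.1 9%N = g.1 9%N, g'.1 16%N = g.1 16%N &
  (forall v, cst3 v -> sat v g'.2 -> sat v g.2 /\ forall k, (k < size As)%N ->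
     factor_set (nth Line As k) (v (g.1 5%N + 3 * k)%N)) /\
  (forall v a, cst3 v -> sat v g.2 -> (forall k, (k < size As)%N -> factor_set (nth Line As k) (a k)) ->
     exists2 v', agree (g.1 5%N) v v' & sat v' g'.2 /\
       forall k, (k < size As)%N -> v' (g.1 5%N + 3 * k)%N = a k)].
Proof.
elim: As g => [|A As IH] g G /=.
  by split=> //; [rewrite muln0 addn0 | split=> // v a _ sv _; exists v].
have F3 : (3 <= g.1 5%N)%N by case: G.
have [r5 G1 r9 r16 [s1 c1]] := facA_spec A G.
have [q5 G2 q9 q16 [s2 c2]] := IH _ G1; rewrite r5 in s2 c2.
split=> //; [by rewrite q5 r5; lia | by rewrite q9 r9 | by rewrite q16 r16 |].
split=> [v cv /(s2 v cv)[/(s1 v cv)[sv vA] vAs] | v a cv sv aA].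
  split=> // -[|k] kl; first by rewrite muln0 addn0.
  by have := vAs k kl; congr (factor_set _ (v _)); lia.
have [v1 a1 [sv1 e1]] := c1 v (a 0%N) cv sv (aA 0%N isT).
have [v2 a2 [sv2 e2]] := c2 v1 (fun k => a k.+1) (agree_cst3 F3 a1 cv) sv1 (fun k kl => aA k.+1 kl).
exists v2; first by move=> i iF; rewrite a2 ?a1 //; lia.
split=> // -[|k] kl; first by rewrite muln0 addn0 a2 ?e1 //; lia.
by rewrite -e2 //; congr (v2 _); lia.
Qed.

Definition bval (B : factor) (c : R) : R :=
  if B is Line then c else (c + c) / (1 + c * c).

(** On a segment this is the half-angle formula [tan (theta / 2) = sin theta / (1 + cos theta)], a
    right inverse of [sin theta = 2 c / (1 + c^2)] with [c = tan (theta / 2)]. *)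
Definition binv (B : factor) (y : R) : R :=
  if B is Line then y else y / (1 + Num.sqrt (1 - y * y)).

Lemma bval_den_gt0 (c : R) : 0 < 1 + c * c. Proof. by nra. Qed.

Lemma bval_factor B c : factor_set B (bval B c).
Proof.
case: B => //; apply/factor_segment => /=; have d := bval_den_gt0 c.
have := sqr_ge0 (c + 1); have := sqr_ge0 (c - 1); rewrite !expr2 => h1 h2.
by rewrite ler_pdivlMr // ler_pdivrMr //; apply/andP; split; nra.
Qed.

Lemma binvK B y : factor_set B y -> bval B (binv B y) = y.
Proof.
case: B => // /factor_segment /andP[y1 y2] /=.
have p : 0 <= 1 - y * y by nra.
have := sqr_sqrtr p; have := sqrtr_ge0 (1 - y * y); set s := Num.sqrt _ => s0 s2.
have s1 : 1 + s != 0 by rewrite gt_eqF //; lra.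
have t1 : (1 + s)^-1 * (1 + s) = 1 by rewrite mulVf.
move: t1; set t := _^-1 => t1.
have d : 1 + y * t * (y * t) != 0 by rewrite gt_eqF // bval_den_gt0.
apply: (mulIf d); rewrite divfK //.
have -> : y * (1 + y * t * (y * t)) = y * (1 + (y * y) * (t * t)) by ring.
have -> : y * y = (1 - s) * (1 + s) by move: s2; rewrite expr2 => s2; lra.
have -> : (1 - s) * (1 + s) * (t * t) = (1 - s) * t * (t * (1 + s)) by ring.
rewrite t1 mulr1; have -> : y * t + y * t = y * (t * (1 + s) + (1 - s) * t) by ring.
by rewrite t1.
Qed.

(** Unlike a domain coordinate, a codomain coordinate is a function of its universal parameter. No
    choice is left, so this is an [ext]. *)
Lemma facB_spec g B : good g -> (g.1 9%N < g.1 5%N)%N ->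
  let g' := arun (facB B) g in
  [/\ g'.1 5%N = (g.1 5%N + 3)%N, g'.1 9%N = (g.1 9%N).+1 &
   ext [:: 16; 17]%N g g' (fun v => v (g.1 5%N) = bval B (v (g.1 9%N)))].
Proof.
case: g => rho qs [/= h6 h7 h8 h5 hq] h9; case: B; rewrite /arun /= /rupd /=; split; rewrite ?addn3 //.
- split=> //=; first by lia.
  + split=> //=; have -> : all (quad_lt (rho 5%N).+3) qs by apply: quad_lt_le hq; lia.
    by rewrite h6 h7 ?andbT; repeat (apply/andP; split); lia.
  + by rewrite !eqxx.
  + by move=> v [v0 v1 _]; rewrite h6 h7 v0 v1 mulr1 addr0 => -[<-].
  + move=> v [v0 v1 _] sv; have [e0 _ _ ag] := set3E v (rho 5%N) (v (rho 9%N)) 0 0.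
    exists (set3 v (rho 5%N) (v (rho 9%N)) 0 0) => //; split; last exact: sat_agree ag sv.
    by rewrite e0 h6 h7 !ag ?v0 ?v1 ?mulr1 ?addr0 //; lia.
- split=> //=; first by lia.
  + split=> //=; have -> : all (quad_lt (rho 5%N).+3) qs by apply: quad_lt_le hq; lia.
    by rewrite h6 h7 ?andbT; repeat (apply/andP; split); lia.
  + by rewrite !eqxx.
  + move=> v [v0 v1 _]; rewrite h6 h7 v0 v1 mulr1 addr0 => -[q1 [q2 [q3 sv]]]; split=> //.
    apply: (canRL (mulfK _)); first by rewrite gt_eqF // bval_den_gt0.
    by rewrite q1 -q2 -q3 [1 + _]addrC.
  + move=> v [v0 v1 _] sv; set c := v (rho 9%N).
    have [e0 e1 e2 ag] := set3E v (rho 5%N) (bval Segment c) (c * c + 1) (c + c).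
    exists (set3 v (rho 5%N) (bval Segment c) (c * c + 1) (c + c)) => //.
    have sv' := sat_agree hq ag sv.
    rewrite h6 h7 e0 e1 e2 !ag ?v0 ?v1 -/c ?mulr1 ?addr0; [|lia|lia|lia].
    do !split=> //; rewrite /bval [1 + _]addrC divfK //.
    by rewrite addrC gt_eqF // bval_den_gt0.
Qed.

Lemma facBs_spec g Bs : good g -> (g.1 9%N + size Bs <= g.1 5%N)%N ->
  let g' := foldl (fun g B => arun (facB B) g) g Bs in
  g'.1 5%N = (g.1 5%N + 3 * size Bs)%N /\
  ext [:: 16; 17]%N g g' (fun v => forall k, (k < size Bs)%N ->
    v (g.1 5%N + 3 * k)%N = bval (nth Line Bs k) (v (g.1 9%N + k)%N)).
Proof.
elim: Bs g => [|B Bs IH] g G h9 /=.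
  split; first by rewrite muln0 addn0.
  apply: (ext_weak (keep := [:: 16; 17]%N) (r := fun=> True)) => //.
  by apply: ext_regs => //; apply/allP.
have h9' : (g.1 9%N < g.1 5%N)%N by move: h9 => /=; lia.
have F3 : (3 <= g.1 5%N)%N by case: G.
have [r5 r9 E1] := facB_spec B G h9'; have G1 : good (arun (facB B) g) by case: E1.
have [|q5 E2] := IH _ G1; first by rewrite r5 r9; move: h9 => /=; lia.
split; first by rewrite q5 r5; lia.
apply: (ext_weak (keep := [:: 16; 17]%N)) (ext_trans F3 E1 E2) => // v _ [e1 e2] [|k] kl.
  by rewrite muln0 !addn0.
have := e2 k kl; rewrite r5 r9 => e; rewrite [LHS](_ : _ = v (g.1 5%N + 3 + 3 * k)%N); last by congr v; lia.
by rewrite e /=; congr (bval _ (v _)); lia.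
Qed.

Lemma sat_arun v l g : sat v (arun l g).2 -> sat v g.2.
Proof. by elim: l g => //= c l IH [rho qs] /IH; case: c => //= ? ? ? ? []. Qed.

Lemma sat_foldl v T (step : gstate -> T -> gstate) :
  (forall g x, sat v (step g x).2 -> sat v g.2) ->
  forall l g, sat v (foldl step g l).2 -> sat v g.2.
Proof. by move=> H; elim=> //= x l IH g /IH /H. Qed.

(** Equations are only ever added, so those that fix the constants 0 and -1 are part of the final
    system. *)
Lemma sat_final v n I : sat v (g_final n I).2 -> sat v (g_init n).2.
Proof.
have hcoef g b : sat v (g_coef g b).2 -> sat v g.2 by case: b; rewrite /g_coef => /sat_arun // /sat_arun.
have hdigit g b : sat v (g_digit g b).2 -> sat v g.2 by case: b; rewrite /g_digit => /sat_arun // /sat_arun.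
have hexp g e : sat v (g_exp g e).2 -> sat v g.2 by rewrite /g_exp => /sat_arun /(sat_foldl hdigit) /sat_arun.
have hint g c : sat v (g_int g c).2 -> sat v g.2.
  by case: c => k; rewrite /g_int /g_intb => /sat_arun /(sat_foldl hcoef) /sat_arun.
have hmono k g ce : sat v (@g_mono k g ce).2 -> sat v g.2.
  by rewrite /g_mono => /sat_arun /(sat_foldl hexp) /hint.
have hcomp k g s : sat v (@g_comp k g s).2 -> sat v g.2.
  by rewrite /g_comp => /sat_arun /(sat_foldl (@hmono k)) /sat_arun.
rewrite /g_final => /(sat_foldl (@hcomp _)) /(sat_foldl (fun g B => @sat_arun v (facB B) g)) /sat_arun.
by move=> /(sat_foldl (fun g A => @sat_arun v (facA A) g)).
Qed.

Lemma cst3_quads v qs : v 0%N = 1 -> sat v [:: (2, 0, 0, 1)%N, (0, 1, 1, 1)%N & qs] -> cst3 v.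
Proof.
move=> v0 [/= q1 [q2 _]]; move: q1 q2; rewrite v0 => q1 q2; have v1 : v 1%N = 0 by lra.
by split=> //; lra.
Qed.

Definition start_val (x : nat -> R) : nat -> R :=
  fun i => match i with 0%N => 1 | 1%N => 0 | 2%N => -1 | S (S (S k)) => x k end.

Lemma init_spec n : [/\ good (g_init n), (g_init n).1 5%N = (n + 3)%N, (g_init n).1 9%N = 3%N,
  (g_init n).1 16%N = (n + 3)%N & (g_init n).2 = [:: (2, 0, 0, 1); (0, 1, 1, 1)]%N].
Proof. by rewrite addn3; split. Qed.

Lemma size_enc_factors s : (size s <= size (enc_seq enc_factor s))%N.
Proof. by elim: s => //= -[] s /=; lia. Qed.

Lemma ord_fun_extension q (f : 'I_q -> R) : exists h : nat -> R, forall j : 'I_q, h j = f j.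
Proof.
exists (fun k => if insub k is Some o then f o else 0) => j.
by rewrite insubT /= => [|jq]; [exact: ltn_ord | congr f; apply: val_inj].
Qed.

(** Quantifying over the parameters [x] amounts to quantifying over the points of the codomain:
    [binvK] finds parameters for a given point, and [bval_factor] says that all parameters give
    points of the box. *)
Lemma instance_systemP I :
  wf_system (instance_system I) /\
  (true_system R (instance_system I) <-> surjective_instance R I).
Proof.
rewrite /instance_system; set n := size (enc_instance I).
have qn : (i_cod I <= n)%N.
  rewrite /n /enc_instance !size_cat -{1}(size_tuple (i_B I)).
  by have := size_enc_factors (i_B I); lia.
have satI v : v 0%N = 1 -> sat v (g_final n I).2 -> cst3 v.
  by move=> v0 /sat_final; have [_ _ _ _ ->] := init_spec n; exact: cst3_quads.
move: satI; rewrite /g_final; have [G0 h5 h9 h16 h2] := init_spec n; cbv zeta.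
have [a5 GA a9 a16 [sA cA]] := facAs_spec (i_A I) G0; set gA := foldl _ _ _ in a5 GA a9 a16 sA cA *.
rewrite h5 h9 h16 size_tuple in a5 a9 a16 sA cA.
set gA' := arun [:: ASet 17 5] gA.
have [r17 r16 r5 r9 r2] : [/\ gA'.1 17%N = gA.1 5%N, gA'.1 16%N = gA.1 16%N, gA'.1 5%N = gA.1 5%N,
  gA'.1 9%N = gA.1 9%N & gA'.2 = gA.2] by rewrite /gA'; case: (gA).
have GA' : good gA'.
  have [r6 r7 r8] : [/\ gA'.1 6%N = gA.1 6%N, gA'.1 7%N = gA.1 7%N & gA'.1 8%N = gA.1 8%N].
    by rewrite /gA'; case: (gA).
  by case: GA => q6 q7 q8 q5 qq; split; rewrite ?r5 ?r2 ?r6 ?r7 ?r8.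
have [|b5 EB] := facBs_spec (Bs := i_B I) GA'; first by rewrite r9 a9 r5 a5 size_tuple; lia.
set gB := foldl _ _ _ in b5 EB *; rewrite size_tuple r5 r9 a9 a5 in b5 EB.
case: EB => lB GB kB sB cB; rewrite r2 r5 a5 in lB sB cB.
have k16 : gB.1 16%N = (n + 3)%N by case/andP: kB => /eqP -> _; rewrite r16.
have k17 : gB.1 17%N = (n + 3 + 3 * i_dom I)%N by case/and3P: kB => _ /eqP -> _; rewrite r17.
have [||lC GC [sC cC]] := comps_spec (ss := i_map I) GB.
- by rewrite k16 b5; lia.
- by rewrite k17 b5 size_tuple; lia.
set gC := foldl _ _ _ in lC GC sC cC *; rewrite k16 k17 size_tuple b5 in lC sC cC => satI.
have wf : wf_system (System n (gC.1 5%N) gC.2).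
  by case: GC => _ _ _ _ q; rewrite /wf_system /= q andbT; lia.
split=> //; split=> [T y yB | SJ x].
- have [h hE] := ord_fun_extension (fun j => binv (tnth (i_B I) j) (y 0 j)).
  have [v [/= v0 vx sv]] := T h.
  have cv := satI v v0 sv; have [svB eC] := sC v cv sv; have [svA eB] := sB v cv svB.
  have [_ eA] := sA v cv svA.
  exists (\row_(i < i_dom I) v (n + 3 + 3 * i)%N).
    by move=> i; rewrite mxE (tnth_nth Line); apply: eA.
  apply/rowP => j; rewrite mxE /component eval_monomials.
  have := eC j (ltn_ord j); rewrite eB // [(3 + j)%N]addnC vx; last by apply: leq_trans qn.
  rewrite hE.
  rewrite -(tnth_nth Line) binvK; last exact: yB.
  rewrite -(tnth_nth [::]) => ->; apply: eq_bigr => ce _; rewrite /mval; congr (_ * _).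
  by apply: eq_bigr => i _; rewrite mxE.
- pose y := \row_(j < i_cod I) bval (tnth (i_B I) j) (x j).
  have [a aA ay] : exists2 a, box (i_A I) a & poly_map a = y.
    by case: (SJ y) => [j|a aA ay]; [rewrite mxE; exact: bval_factor | exists a].
  have c0 : cst3 (start_val x) by [].
  have s0 : sat (start_val x) (g_init n).2 by rewrite h2 /=; do !split=> //; rewrite ?mulr0 ?mulr1 ?addr0 ?addNr.
  have [a' a'E] := ord_fun_extension (fun i => a 0 i).
  (* The solution is built in stages: first the coordinates of the preimage, then those of its
     image, then all intermediate results. *)
  have [|v1 g1 [sv1 e1]] := cA (start_val x) a' c0 s0.
    by move=> k kl; have := aA (Ordinal kl); rewrite (tnth_nth Line) /= -a'E.
  have F3 : (3 <= n + 3)%N by lia.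
  have c1 := agree_cst3 F3 g1 c0.
  have [v2 g2 sv2] := cB v1 c1 sv1.
  have F3' : (3 <= n + 3 + 3 * i_dom I)%N by lia.
  have c2 := agree_cst3 F3' g2 c1; have [_ eB] := sB v2 c2 sv2.
  have v2x j : (j < n)%N -> v2 (j + 3)%N = x j.
    by move=> jn; rewrite g2 ?g1; [rewrite addn3 | lia | lia].
  have [k kq|v3 g3 sv3] := cC v2 c2 sv2.
    rewrite eB // [(3 + k)%N]addnC v2x; last by apply: leq_trans qn.
    have := congr1 (fun M : 'rV[R]_(i_cod I) => M 0 (Ordinal kq)) ay.
    rewrite /y !mxE /component eval_monomials (tnth_nth Line) /= => <-.
    rewrite (tnth_nth [::]) /=; apply: eq_bigr => ce _; rewrite /mval; congr (_ * _).
    by apply: eq_bigr => i _; rewrite g2 ?e1 ?a'E //; have := ltn_ord i; lia.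
  exists v3; split=> //.
    by rewrite g3; [case: c2 | lia].
  by move=> j jn; rewrite g3 ?v2x //=; move: jn => /=; lia.
Qed.

End SystemTruth.

(** * From sentences to systems *)

(** Prefix notation read from left to right and pushed token by token comes out as postfix notation
    with swapped operands, which a stack machine can evaluate. So neither parsing nor evaluation
    needs recursion. [SqF] is the square of a fresh variable, [TokAnd] a sum of two squares. *)
Inductive tok := Leaf of nat | SqF | TokAdd | TokMul | TokAnd.

Definition enc_tok (t : tok) : word :=
  match t with
  | Leaf i => true :: enc_unary i
  | SqF => [:: false; false; false]
  | TokAdd => [:: false; false; true]
  | TokMul => [:: false; true; false]
  | TokAnd => [:: false; true; true]
  end.

Definition enc_toks (tk : seq tok) : word := flatten [seq enc_tok t | t <- tk].

(* Unread input, numbers of terms and of formulas still to be read, and the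
   tokens read so far, last one first. *)
Definition pstate : Type := word * nat * nat * seq tok.

Fixpoint spl (u : word) : nat * word :=
  match u with
  | true :: u' => let: (k, r) := spl u' in (k.+1, r)
  | _ => (0, u)
  end.

Lemma splP u : u = una (spl u).1 ++ (spl u).2 /\ (forall r, (spl u).2 <> true :: r).
Proof. by elim: u => [|[] u [E H]] //=; case: (spl u) E H => k r /= -> H. Qed.

Lemma spl_una k r : spl (una k ++ false :: r) = (k, false :: r).
Proof. by elim: k => // k IH; rewrite unaS /= IH. Qed.

Definition step_var (u : word) (start bound c f : nat) (tk : seq tok) : option pstate :=
  let: (k, r) := spl u in
  if r is false :: r' then
    if k < bound then Some (r', c, f, Leaf (k + start) :: tk) else None
  else None.

(** Pushed before the tokens of [t] and hence evaluated after them, these turn the value of [t] into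
    [1 + a^2 t]. The next three lists give [-1 + a^2 t], [a^2 + t] and [a^2 - t]. *)
Definition toks_lt := [:: SqF; TokMul; Leaf 0; TokAdd].
Definition toks_gt := [:: SqF; TokMul; Leaf 2; TokAdd].
Definition toks_le := [:: SqF; TokAdd].
Definition toks_ge := [:: Leaf 2; TokMul; SqF; TokAdd].

(** All pending terms precede the pending formulas in the input, so two counters take the place of a
    parsing stack. With nothing pending the state is a fixed point, as the surplus rounds of a loop
    require. *)
Definition step1 (n m : nat) (st : pstate) : option pstate :=
  let: (u, c, f, tk) := st in
  match c with
  | c'.+1 =>
    match u with
    | false :: false :: false :: u' => step_var u' 3 n c' f tk
    | false :: false :: true :: u' => step_var u' (n + 3) m c' f tk
    | false :: true :: false :: u' => Some (u', c', f, Leaf 1 :: tk)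
    | false :: true :: true :: u' => Some (u', c', f, Leaf 0 :: tk)
    | true :: false :: u' => Some (u', c'.+2, f, TokAdd :: tk)
    | true :: true :: u' => Some (u', c'.+2, f, TokMul :: tk)
    | _ => None
    end
  | 0 =>
    match f with
    | f'.+1 =>
      match u with
      | false :: false :: false :: u' => Some (u', 1, f', toks_lt ++ tk)
      | false :: false :: true :: u' => Some (u', 1, f', toks_le ++ tk)
      | false :: true :: false :: u' => Some (u', 1, f', tk)
      | false :: true :: true :: false :: u' => Some (u', 1, f', toks_ge ++ tk)
      | false :: true :: true :: true :: u' => Some (u', 1, f', toks_gt ++ tk)
      | true :: false :: u' => Some (u', 0, f'.+2, TokAnd :: tk)
      | true :: true :: u' => Some (u', 0, f'.+2, TokMul :: tk)
      | _ => None
      end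
    | 0 => Some (u, c, f, tk)
    end
  end.

(** A nonempty register 23 records an error; from then on [Body1] does nothing. *)
Definition Bad : cmd := Push 23 true.
Definition Bit (cF cT : cmd) : cmd := If 3 Bad (Pop 3 ;; cF) (Pop 3 ;; cT).
Definition ETok (tk : seq tok) : cmd := Emit 19 (enc_toks tk).

(** Register 12 starts at the offset of the block of variables and 24 at its size. Each unary mark
    raises the one and lowers the other, so at the end 24 is nonempty exactly when the index is in
    range. *)
Definition Idx : cmd :=
  WhileT 3 (Push 12 true ;; Pop 24) ;;
  If 3 Bad (Pop 3 ;; If 24 Bad Skip (Pop 21 ;; Push 19 false ;; Dup 12 19 ;; Push 19 true)) Skip ;;
  Clear 12 ;; Clear 24.
Definition VarTok : cmd :=
  Bit (Emit 12 [:: true; true; true] ;; Dup 4 24 ;; Idx)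
      (Emit 12 [:: true; true; true] ;; Dup 4 12 ;; Dup 9 24 ;; Idx).
Definition TermTok : cmd :=
  Bit (Bit VarTok (Bit (Pop 21 ;; ETok [:: Leaf 1]) (Pop 21 ;; ETok [:: Leaf 0])))
      (Bit (Push 21 true ;; ETok [:: TokAdd]) (Push 21 true ;; ETok [:: TokMul])).
Definition FormTok : cmd :=
  Bit (Pop 22 ;; Push 21 true ;; Bit (Bit (ETok toks_lt) (ETok toks_le))
                                     (Bit Skip (Bit (ETok toks_ge) (ETok toks_gt))))
      (Bit (Push 22 true ;; ETok [:: TokAnd]) (Push 22 true ;; ETok [:: TokMul])).
Definition Body1 : cmd := If 23 (If 21 (If 22 Skip Skip FormTok) Skip TermTok) Skip Skip.

Definition qst (n m : nat) (u : word) (c f : word) (tk bad : word) (x y : word) : store :=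
  sto [:: [:: false]; [::]; [::]; u; una n; una (n + m); [::]; [::]; [::]; una m; [::]; [::]; x;
          [::]; [::]; [::]; [::]; [::]; [::]; tk; [::]; c; f; bad; y].

Definition Q (n m : nat) (st : pstate) : store :=
  let: (u, c, f, tk) := st in qst n m u (una c) (una f) (enc_toks tk) [::] [::] [::].

Definition is_bad (s : store) : Prop := s 0 = [:: false] /\ exists b r, s 23 = b :: r.

Lemma exec_seq_sto L c1 c2 l : exec L (c1 ;; c2) (sto l) = exec L c2 (exec L c1 (sto l)).
Proof. by []. Qed.
Lemma exec_push_sto L i b l : exec L (Push i b) (sto l) = sto (set_nth [::] l i (b :: nth [::] l i)).
Proof. by rewrite exec_push upd_sto. Qed.
Lemma exec_pop_sto L i l : exec L (Pop i) (sto l) = sto (set_nth [::] l i (behead (nth [::] l i))).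
Proof. by rewrite exec_pop upd_sto. Qed.
Lemma exec_emit_sto L o w l : exec L (Emit o w) (sto l) = sto (set_nth [::] l o (w ++ nth [::] l o)).
Proof. by rewrite exec_emit upd_sto. Qed.
Lemma exec_if_sto L i c0 cF cT l : exec L (If i c0 cF cT) (sto l) =
  match nth [::] l i with
  | [::] => exec L c0 (sto l)
  | b :: _ => if b then exec L cT (sto l) else exec L cF (sto l)
  end.
Proof. by []. Qed.
Lemma exec_clear_sto L i l : size (nth [::] l i) <= L ->
  exec L (Clear i) (sto l) = sto (set_nth [::] l i [::]).
Proof. by move=> h; rewrite exec_clear // upd_sto. Qed.
Lemma exec_dup_sto L i o k l : [&& i != 2, o != 2 & i != o] ->
  nth [::] l i = una k -> nth [::] l 2 = [::] -> k <= L ->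
  exec L (Dup i o) (sto l) = sto (set_nth [::] l o (una k ++ nth [::] l o)).
Proof. by move=> h1 h2 h3 h4; rewrite (exec_dup h1 h2 h3 h4) upd_sto. Qed.

Ltac exsto := repeat (first [rewrite exec_seq_sto | rewrite exec_push_sto | rewrite exec_pop_sto
  | rewrite exec_emit_sto | rewrite exec_if_sto | rewrite exec_skip]; simpl set_nth; simpl nth; simpl behead; cbv iota).

Lemma whileT_count (S : nat -> nat -> store) L u r body a b :
  (forall a b, S a b u = una a ++ r) -> (forall r', r <> true :: r') ->
  (forall a b, exec L body (upd (S a.+1 b) u (una a ++ r)) = S a b.+1) -> a <= L ->
  exec L (WhileT u body) (S a b) = S 0 (a + b).
Proof.
move=> Su rt bodyP aL; rewrite /WhileT -lock exec_loop; apply: iter_count => //.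
  by move=> a' b'; rewrite exec_if Su unaS /= exec_seq exec_pop Su unaS /= bodyP.
by move=> b'; rewrite exec_if Su /=; case: r rt {Su bodyP} => // -[] r /(_ r).
Qed.

Lemma exec_idx L n m u c f tk x y start bound :
  size u + x + y + 8 <= L -> x = start -> y = bound ->
  let s := exec L Idx (qst n m u (true :: una c) (una f) (enc_toks tk) [::] (una x) (una y)) in
  match step_var u start bound c f tk with
  | Some st => s = Q n m st
  | None => is_bad s
  end.
Proof.
move=> szL <- <- {start bound} s; rewrite /step_var.
have [uE rP] := splP u; case: (spl u) uE rP => k r /= uE rP.
have szk : size u = k + size r by rewrite uE size_cat size_una.
pose S a b := qst n m (una a ++ r) (true :: una c) (una f) (enc_toks tk) [::] (una (b + x)) (una (y - b)).
have sE : s = exec L (If 3 Bad (Pop 3 ;; If 24 Bad Skip (Pop 21 ;; Push 19 false ;; Dup 12 19 ;; Push 19 true)) Skip ;;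
  Clear 12 ;; Clear 24) (S 0 k).
  rewrite /s /Idx exec_seq; congr exec; rewrite uE.
  have -> : qst n m (una k ++ r) (true :: una c) (una f) (enc_toks tk) [::] (una x) (una y) = S k 0.
    by rewrite /S subn0.
  rewrite (@whileT_count S _ _ r) ?addn0 //; last lia.
  move=> a b; rewrite /S /qst upd_sto; exsto.
  have -> : behead (una (y - b)) = una (y - b.+1) by rewrite subnS; case: (y - b).
  by [].
rewrite {}sE /S /qst /=; clear S s.
case: r rP {uE} szk => [|[] r] rP szk; last first.
- exsto; case: ltnP => ky.
    have [z zE] : exists z, y - k = z.+1 by exists (y - k).-1; lia.
    rewrite zE unaS; exsto; rewrite (exec_dup_sto (k := k + x)) //; last lia.
    simpl; exsto; rewrite exec_clear_sto; last by rewrite /= size_una; lia.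
    simpl set_nth; rewrite exec_clear_sto; last by rewrite /= size_una; lia.
    by rewrite /Q /qst /enc_toks /= /enc_unary -!catA.
  have -> : y - k = 0 by lia.
  exsto; rewrite /Bad; exsto; rewrite exec_clear_sto; last by rewrite /= size_una; lia.
  simpl set_nth; rewrite exec_clear_sto //.
  by split=> //; exists true, [::].
- by case: (rP r).
- exsto; rewrite /Bad; exsto; rewrite exec_clear_sto; last by rewrite /= size_una; lia.
  simpl set_nth; rewrite exec_clear_sto; last by rewrite /= size_una; lia.
  by split=> //; exists true, [::].
Qed.

Lemma exec_body1 L n m st : n + m + size st.1.1.1 + n + 16 <= L ->
  match step1 n m st with
  | Some st' => exec L Body1 (Q n m st) = Q n m st'
  | None => is_bad (exec L Body1 (Q n m st))
  end.
Proof.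
case: st => [[[u c] f] tk] /= szL.
have bd u' c' f' tk' b : is_bad (qst n m u' c' f' tk' [:: b] [::] [::]) by split=> //; exists b, [::].
rewrite /Body1 /Q /qst exec_if_sto /=.
case: c => [|c].
  rewrite exec_if_sto /=; case: f => [|f]; first by rewrite exec_if_sto /= exec_skip.
  rewrite exec_if_sto unaS /= /FormTok /Bit /ETok.
  by case: u szL => [|[] [|[] [|[] [|[] u]]]] szL; exsto; rewrite /Bad; exsto; try exact: bd.
rewrite exec_if_sto unaS /= /TermTok /Bit /ETok.
case: u szL => [|b1 u] szL; first by exsto; rewrite /Bad; exsto; exact: bd.
case: b1 szL => szL.
  by case: u szL => [|[] u] szL; exsto; rewrite /Bad; exsto; try exact: bd.
case: u szL => [|b2 u] szL; first by exsto; rewrite /Bad; exsto; exact: bd.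
case: b2 szL => szL.
  by case: u szL => [|[] u] szL; exsto; rewrite /Bad; exsto; try exact: bd.
case: u szL => [|b3 u] /= szL; first by rewrite /VarTok /Bit; exsto; rewrite /Bad; exsto; exact: bd.
case: b3 szL => szL; rewrite /VarTok /Bit; exsto.
  rewrite (exec_dup_sto (k := n)) //; last lia.
  simpl set_nth; rewrite exec_seq_sto (exec_dup_sto (k := m)) //; last lia.
  simpl set_nth.
  have -> : [:: true, true, true & [::]] = una 3 by [].
  rewrite una_cat cats0.
  by apply: (@exec_idx L n m u c f tk (n + 3) m); rewrite // ; lia.
rewrite (exec_dup_sto (k := n)) //; last lia.
simpl set_nth; rewrite cats0.
by apply: (@exec_idx L n m u c f tk 3 n); rewrite //; lia.
Qed.

Fixpoint run1 (n m k : nat) (st : pstate) : option pstate :=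
  if k is k'.+1 then obind (run1 n m k') (step1 n m st) else Some st.

Lemma step_var_size u start bound c f tk st :
  step_var u start bound c f tk = Some st -> size st.1.1.1 <= size u.
Proof.
rewrite /step_var; have [uE _] := splP u; case: (spl u) uE => k [|[] r] //= -> .
by case: ifP => // _ [<-] /=; rewrite size_cat size_una /=; lia.
Qed.

Lemma step1_size n m st st' : step1 n m st = Some st' -> size st'.1.1.1 <= size st.1.1.1.
Proof.
case: st => [[[u c] f] tk] /=; case: c => [|c].
  case: f => [|f]; first by case=> <-.
  by case: u => [|[] [|[] [|[] [|[] u]]]] //= [<-] /=; lia.
case: u => [|[] [|[] [|[] u]]] //=;
  by do ?[move=> /step_var_size /= ?; lia | case=> <- /=; lia].
Qed.

Lemma exec_run1 L n m k st : n + m + size st.1.1.1 + n + 16 <= L ->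
  match run1 n m k st with
  | Some st' => iter k (exec L Body1) (Q n m st) = Q n m st'
  | None => is_bad (iter k (exec L Body1) (Q n m st))
  end.
Proof.
have badP j s : is_bad s -> iter j (exec L Body1) s = s.
  move=> [_ [b [r E]]]; elim: j => //= j ->; rewrite /Body1 exec_if E.
  by case: (b).
elim: k st => // k IH st szL; rewrite iterSr /=; have := exec_body1 szL.
case E : step1 => [st'|] /=; last by move=> /[dup] B; rewrite badP.
by move=> ->; apply: IH; apply: leq_trans szL; rewrite !leq_add2r leq_add2l (step1_size E).
Qed.

(** ** Generation of the equations *)

(** [ReadU] adds to its target, so both targets are emptied beforehand by copying the number 0 from
    register 6. *)
Definition Two : cmd := ACmds [:: ASet 10 6; ASet 11 6] ;; ReadU 20 10 ;; ReadU 20 11.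
Definition PushR : cmd := locked (Push 20 false ;; Dup 12 20).
Definition SqFc : cmd := ACmds [:: ASet 12 5; AInc 5; ADef 12 12 7 12] ;; PushR.
Definition Binc (l : seq acmd) : cmd := Two ;; ACmds l ;; PushR.
Definition add_acmds := [:: ADef 10 6 11 12].
Definition mul_acmds := [:: ADef 10 11 7 12].
Definition and_acmds := [:: ADef 10 10 7 12; ADef 11 11 12 12].
Definition OpTok : cmd :=
  Pop 19 ;; If 19 Skip
    (Pop 19 ;; If 19 Skip (Pop 19 ;; SqFc) (Pop 19 ;; Binc add_acmds))
    (Pop 19 ;; If 19 Skip (Pop 19 ;; Binc mul_acmds) (Pop 19 ;; Binc and_acmds)).
Definition LeafTok : cmd :=
  Pop 19 ;; ACmds [:: ASet 12 6] ;; ReadU 19 12 ;; PushR.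
Definition Body2 : cmd := If 19 Skip OpTok LeafTok.

Definition gates : Type := gstate * seq nat.

Definition two_ops (g : gstate) (a b : nat) : gstate :=
  (rupd (rupd (rupd (rupd g.1 10 (g.1 6)) 11 (g.1 6)) 10 a) 11 b, g.2).

Definition bin_gate (l : seq acmd) (gs : gates) : gates :=
  if gs is (g, a :: b :: st) then
    (arun l (two_ops g a b), (arun l (two_ops g a b)).1 12 :: st)
  else gs.

Definition gate (gs : gates) (t : tok) : gates :=
  match t with
  | Leaf i =>
      let g1 := arun [:: ASet 12 6] gs.1 in ((rupd g1.1 12 i, g1.2), i :: gs.2)
  | SqF =>
      let g1 := arun [:: ASet 12 5; AInc 5; ADef 12 12 7 12] gs.1 in (g1, g1.1 12 :: gs.2)
  | TokAdd => bin_gate add_acmds gs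
  | TokMul => bin_gate mul_acmds gs
  | TokAnd => bin_gate and_acmds gs
  end.

Definition arity_ok (t : tok) (st : seq nat) : bool :=
  match t with TokAdd | TokMul | TokAnd => 1 < size st | _ => true end.

Definition leaf_le (B : nat) (t : tok) : bool := if t is Leaf i then i <= B else true.

Definition enc_stack (st : seq nat) : word := flatten [seq enc_unary i | i <- st].

Definition sg2 (tk st : word) : store :=
  fun i => if i == 19 then tk else if i == 20 then st else [::].
Definition rst (tk : seq tok) (gs : gates) : store :=
  gstore (sg2 (enc_toks tk) (enc_stack gs.2)) gs.1.1 gs.1.2.

Definition gbound (B : nat) (gs : gates) : Prop :=
  [/\ forall r, gs.1.1 r <= B, all (fun i => i <= B) gs.2 & gs.1.1 6 = 0].

Lemma upd_sg2_tk tk tk' st : upd (sg2 tk st) 19 tk' = sg2 tk' st.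
Proof. by apply: funext => i; rewrite /upd /sg2; case: eqP. Qed.
Lemma upd_sg2_st tk st st' : upd (sg2 tk st) 20 st' = sg2 tk st'.
Proof. by apply: funext => i; rewrite /upd /sg2; case: eqP => // ->. Qed.

Lemma exec_pushR L tk st rho qs : rho 12 <= L ->
  exec L PushR (gstore (sg2 tk (enc_stack st)) rho qs) =
  gstore (sg2 tk (enc_stack (rho 12 :: st))) rho qs.
Proof.
move=> gL; rewrite /PushR -lock exec_seq exec_push.
rewrite (exec_dup (k := rho 12)) // !gstore_upds // !upd_sg2_st; congr gstore.
by rewrite /upd /= /enc_stack /= /enc_unary -catA.
Qed.

Lemma exec_if19F L tk st rho qs c0 cF cT :
  exec L (If 19 c0 cF cT) (gstore (sg2 (false :: tk) st) rho qs) =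
  exec L cF (gstore (sg2 (false :: tk) st) rho qs).
Proof. by []. Qed.
Lemma exec_if19T L tk st rho qs c0 cF cT :
  exec L (If 19 c0 cF cT) (gstore (sg2 (true :: tk) st) rho qs) =
  exec L cT (gstore (sg2 (true :: tk) st) rho qs).
Proof. by []. Qed.

Arguments arun : simpl never.
Arguments two_ops : simpl never.

Lemma exec_gate L B t tk gs : gbound B gs -> arity_ok t gs.2 -> leaf_le B t ->
  B + 8 <= L ->
  exec L Body2 (rst (t :: tk) gs) = rst tk (gate gs t) /\ gbound (B + 5) (gate gs t).
Proof.
case: gs => [[rho qs] st] [/= gB stB g6] ar lf BL.
have gL r : rho r <= L by have := gB r; lia.
have popE tk' b st' rho' qs' : exec L (Pop 19) (gstore (sg2 (b :: tk') st') rho' qs') = gstore (sg2 tk' st') rho' qs'.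
  by rewrite exec_pop gstore_upds // upd_sg2_tk.
have stB' k : all (fun i => i <= B + k) st.
  by apply: sub_all stB => i; lia.
have up l : all acmd_ok l -> size l <= 5 -> forall rho' qs' tk' st', (forall r, rho' r <= B + 2) ->
  exec L (ACmds l) (gstore (sg2 tk' st') rho' qs') =
  gstore (sg2 tk' st') (arun l (rho', qs')).1 (arun l (rho', qs')).2.
  move=> okl sl rho' qs' tk' st' g'B; apply: (@exec_acmds L (B + 2) _ (rho', qs')) => //; lia.
have gB2 r : rho r <= B + 2 by have := gB r; lia.
have binP l : all acmd_ok l -> size l <= 2 -> all (fun c => if c is ADef _ _ _ r then r != 6 else false) l ->
    1 < size st ->
    exec L (Binc l) (gstore (sg2 (enc_toks tk) (enc_stack st)) rho qs) = rst tk (bin_gate l ((rho, qs), st)) /\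
    gbound (B + 5) (bin_gate l ((rho, qs), st)).
  move=> okl sl l6; case: st stB ar {stB'} => [|a [|b st]] //= /and3P[aB bB stB] _ _.
  set g1 := two_ops _ a b.
  have g1B r : g1.1 r <= B by rewrite /g1 /two_ops /= /rupd; do !case: ifP => // _.
  have g2B r := arun_bound l g1B r.
  have h6 l' g' : all (fun c => if c is ADef _ _ _ r then r != 6 else false) l' -> (arun l' g').1 6 = g'.1 6.
    rewrite /arun; elim: l' g' => //= c l' IH [rho' qs'] /andP[c6 /IH ->]; case: c c6 => //= ? ? ? r r6.
    by rewrite /rupd /= ?(eq_sym 6) (negPf r6).
  split; last first.
    split=> /= [r||]; first by apply: leq_trans (g2B r) _; lia.
      by apply/andP; split; [have := g2B 12; lia | apply: sub_all stB => i; lia].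
    by rewrite h6 //= /g1 /two_ops /rupd /= g6.
  rewrite /Binc /Two !exec_seq up //.
  rewrite (exec_readU (u := 20) (o := 10) (k := a) (r := enc_unary b ++ enc_stack st)) //; [|lia].
  rewrite gstore_upds // upd_sg2_st gstore_num // -[(arun _ _).1 10]/(rho 6) g6 cats0 gstore_updr //.
  rewrite (exec_readU (u := 20) (o := 11) (k := b) (r := enc_stack st)) //; [|lia].
  rewrite gstore_upds // upd_sg2_st gstore_num // -[rupd _ 10 a 11]/(rho 6) g6 cats0 gstore_updr //.
  rewrite -[rupd _ 11 b]/(g1.1) -[(arun _ _).2]/(g1.2) up //; [|lia|by move=> r; have := g1B r; lia].
  rewrite -surjective_pairing /rst /= exec_pushR //; have := g2B 12; lia.
rewrite /Body2 /rst /=; case: t ar lf => [i||||] ar lf.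
- rewrite -[enc_toks (Leaf i :: tk)]/(true :: (enc_unary i ++ enc_toks tk)) exec_if19T.
  rewrite /LeafTok exec_seq popE exec_seq up //.
  rewrite exec_seq (exec_readU (u := 19) (o := 12) (k := i) (r := enc_toks tk)) //; last by move: lf => /=; lia.
  rewrite gstore_upds // upd_sg2_tk gstore_num // -[(arun _ _).1 12]/(rho 6) g6 cats0 gstore_updr //.
  split; first by rewrite exec_pushR //= /rupd /=; move: lf => /=; lia.
  split=> /= [r||]; last by rewrite /rupd /= g6.
    rewrite /arun /= /rupd; do !case: ifP => _; have := gB r; have := gB 6; move: lf => /=; lia.
  by apply/andP; split; [move: lf => /=; lia | apply: stB'].
- rewrite -[enc_toks (SqF :: tk)]/[:: false, false, false & enc_toks tk] exec_if19F /OpTok.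
  rewrite exec_seq popE exec_if19F exec_seq popE exec_if19F exec_seq popE /SqFc exec_seq up //.
  have b3 := @arun_bound B (rho, qs) [:: ASet 12 5; AInc 5; ADef 12 12 7 12] gB.
  split; first by rewrite exec_pushR //; have := b3 12; rewrite [size _]/=; lia.
  split=> [r||]; [by have := b3 r; rewrite [size _]/= [(_, _).1]/=; lia | | by rewrite /arun /= /rupd /= g6].
  rewrite [gate _ _]/=; apply/andP; split; [by apply: leq_trans (b3 12) _; rewrite leq_add2l | exact: stB'].
- rewrite -[enc_toks (TokAdd :: tk)]/[:: false, false, true & enc_toks tk] exec_if19F /OpTok.
  rewrite exec_seq popE exec_if19F exec_seq popE exec_if19T exec_seq popE.
  exact: binP.
- rewrite -[enc_toks (TokMul :: tk)]/[:: false, true, false & enc_toks tk] exec_if19F /OpTok.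
  rewrite exec_seq popE exec_if19T exec_seq popE exec_if19F exec_seq popE.
  exact: binP.
- rewrite -[enc_toks (TokAnd :: tk)]/[:: false, true, true & enc_toks tk] exec_if19F /OpTok.
  rewrite exec_seq popE exec_if19T exec_seq popE exec_if19T exec_seq popE.
  exact: binP.
Qed.

Fixpoint arities_ok (tk : seq tok) (gs : gates) : bool :=
  if tk is t :: tk' then arity_ok t gs.2 && arities_ok tk' (gate gs t) else true.

Lemma exec_gates L B tk gs : gbound B gs -> arities_ok tk gs -> all (leaf_le B) tk ->
  B + 5 * size tk + 8 <= L ->
  iter (size tk) (exec L Body2) (rst tk gs) = rst [::] (foldl gate gs tk) /\
  gbound (B + 5 * size tk) (foldl gate gs tk).
Proof.
elim: tk B gs => [|t tk IH] B gs gb; first by rewrite muln0 addn0.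
move=> /andP[ar ars] /andP[lt lts] BL; rewrite [size _]/= iterSr [foldl _ _ _]/=.
have BL8 : B + 8 <= L by move: BL => /=; lia.
have [-> gb'] := exec_gate tk gb ar lt BL8.
have [||-> gb2] := IH (B + 5) _ gb' ars.
- by apply: sub_all lts => -[] //= i; lia.
- by move: BL => /=; lia.
by split=> //; have -> : B + 5 * (size tk).+1 = B + 5 + 5 * size tk by lia.
Qed.

Lemma gate_reg4 gs t : (gate gs t).1.1 4 = gs.1.1 4.
Proof. by case: gs => [[rho qs] [|a [|b st]]]; case: t. Qed.

Lemma foldl_gate_reg4 gs tk : (foldl gate gs tk).1.1 4 = gs.1.1 4.
Proof. by elim: tk gs => //= t tk IH gs; rewrite IH gate_reg4. Qed.

(** Its equation [v_0 * v_0 + v_0 = v_0] contradicts [v_0 = 1]. *)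
Definition bad_system : system := System 0 3 [:: (0, 0, 0, 0)].
(** The last of the 11 bits, which closes the list of equations, is already in register 0 when an
    error is reported. *)
Definition bad_prefix : word := take 10 (enc_system bad_system).

Definition init2 : seq acmd :=
  [:: AInc 7; AInc 8; AInc 8; AInc 5; AInc 5; AInc 5; AQuad 6 7 7 7; AQuad 8 6 6 7].
Definition rho1 (n m : nat) : nat -> nat :=
  fun i => if i == 4 then n else if i == 5 then n + m else if i == 9 then m else 0.
Definition gates0 (n m : nat) : gates := (arun init2 (rho1 n m, [::]), [::]).

(** If [x] is the variable at the root of the expression, the additional equation [v_0 * x + x = x]
    makes it 0. *)
Definition toks_system (n m : nat) (tk : seq tok) : system :=
  let gs := foldl gate (gates0 n m) tk in
  System n (gs.1.1 5) ((0, head 0 gs.2, head 0 gs.2, head 0 gs.2) :: gs.1.2).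

Definition Gen : cmd :=
  ACmds init2 ;; Loop Body2 ;; ACmds [:: ASet 10 6] ;; ReadU 20 10 ;;
  ACmds [:: AQuad 6 10 10 10] ;; Push 0 false ;; Dup 5 0 ;; Push 0 false ;; Dup 4 0.
Definition Fail : cmd := Emit 0 bad_prefix.
Definition Dispatch : cmd :=
  If 23 (If 21 (If 22 (If 3 Gen Fail Fail) Fail Fail) Fail Fail) Fail Fail.

Definition parse_program : cmd :=
  Move 1 3 ;; Push 0 false ;; Push 22 true ;;
  WhileT 3 (Push 4 true ;; Push 5 true) ;; If 3 Bad (Pop 3) Skip ;;
  WhileT 3 (Push 9 true ;; Push 5 true) ;; If 3 Bad (Pop 3) Skip ;;
  Loop Body1 ;; Dispatch.

Lemma regs_parse_program : regs_lt 25 parse_program.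
Proof.
by rewrite /parse_program /Dispatch /Gen /Fail /Body2 /LeafTok /OpTok /Binc /SqFc /PushR -!lock /= /Two
  /Body1 /TermTok /FormTok /VarTok /Idx /ETok /Bit /Bad /init2 /add_acmds /mul_acmds /and_acmds
  /ACmds -!lock /= /Def -!lock /= /EmitQ -!lock /= /Set_ -!lock /= /Dup -!lock /= /Clear -!lock /=
  /ReadU -!lock /= /WhileT -!lock /Emit -!lock /Move -!lock.
Qed.

Definition parse_word (L : nat) (w : word) : option (nat * nat * seq tok) :=
  let: (n, r) := spl w in
  if r is false :: r1 then
    let: (m, r2) := spl r1 in
    if r2 is false :: u then
      if run1 n m L (u, 0, 1, [::]) is Some ([::], 0, 0, tk) then Some (n, m, tk) else None
    else None
  else None.

Lemma exec_fail L s : s 0 = [:: false] -> exec L Fail s 0 = enc_system bad_system.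
Proof. by move=> s0; rewrite /Fail exec_emit /upd /= s0. Qed.

Lemma exec_dispatch_bad L s : is_bad s -> exec L Dispatch s 0 = enc_system bad_system.
Proof.
by move=> [s0 [b [r E]]]; rewrite /Dispatch exec_if E; case: b E => _; apply: exec_fail.
Qed.

Lemma exec_parse L w : 64 * size w + 64 <= L ->
  exec L parse_program (program_init w) 0 =
  if parse_word L w is Some (n, m, tk) then exec L Gen (Q n m ([::], 0, 0, tk)) 0
  else enc_system bad_system.
Proof.
move=> wL; rewrite /parse_program (init_sto 23) [_ ++ nseq _ _]/=.
rewrite exec_seq exec_move //; last by rewrite stoE /= size_rev; lia.
rewrite !upd_sto stoE [set_nth _ _ _ _]/= [rev (rev w) ++ _]/= revK cats0.
(* If the input ends within the first unary number, register 3 is empty, and the error mark survives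
   all later commands. *)
have bad2 s : is_bad s -> s 3 = [::] -> exec L (WhileT 3 (Push 9 true ;; Push 5 true) ;;
   If 3 Bad (Pop 3) Skip ;; Loop Body1 ;; Dispatch) s 0 = enc_system bad_system.
  move=> sb s3; rewrite exec_seq /WhileT -lock exec_loop.
  rewrite (@iter_stable _ _ 0 L s s) //; last by rewrite exec_if s3.
  rewrite exec_seq exec_if s3 exec_seq exec_loop.
  have sb' : is_bad (exec L Bad s).
    by case: sb => s0 [b [r E]]; split; [exact: s0 | exists true, (b :: r); rewrite /Bad exec_push /upd /= E].
  rewrite (@iter_stable _ _ 0 L (exec L Bad s) (exec L Bad s)) //; exact: exec_dispatch_bad.
have bad3 s : is_bad s -> exec L (Loop Body1 ;; Dispatch) s 0 = enc_system bad_system.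
  move=> sb; rewrite exec_seq exec_loop (@iter_stable _ _ 0 L s s) //; first exact: exec_dispatch_bad.
  by case: sb => _ [b [r E]]; rewrite /Body1 exec_if E; case: (b).
rewrite /parse_word; have [wE rP] := splP w; case: (spl w) wE rP => n r /= wE rP.
have szw : size w = n + size r by rewrite wE size_cat size_una.
exsto.
pose S1 a b := sto [:: [:: false]; [::]; [::]; una a ++ r; una b; una b; [::]; [::]; [::]; [::];
  [::]; [::]; [::]; [::]; [::]; [::]; [::]; [::]; [::]; [::]; [::]; [::]; [:: true]; [::]; [::]].
rewrite wE -[sto _]/(S1 n 0) exec_seq (@whileT_count S1 _ _ r) //; first last.
- lia.
- by move=> a b; rewrite /S1 upd_sto; exsto.
rewrite addn0 /S1 [una 0 ++ r]/= exec_seq.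
case: r rP {S1 wE} szw => [|[] r] rP szw; [|by case: (rP r)|].
  by exsto; rewrite /Bad; exsto; apply: bad2 => //; split=> //; exists true, [::].
exsto.
have [rE rP'] := splP r; case: (spl r) rE rP' => m r2 /= rE rP'.
have szr : size r = m + size r2 by rewrite rE size_cat size_una.
pose S2 a b := sto [:: [:: false]; [::]; [::]; una a ++ r2; una n; una (n + b); [::]; [::]; [::]; una b;
  [::]; [::]; [::]; [::]; [::]; [::]; [::]; [::]; [::]; [::]; [::]; [::]; [:: true]; [::]; [::]].
have -> : sto [:: [:: false]; [::]; [::]; r; una n; una n; [::]; [::]; [::]; [::];
  [::]; [::]; [::]; [::]; [::]; [::]; [::]; [::]; [::]; [::]; [::]; [::]; [:: true]; [::]; [::]] = S2 m 0.
  by rewrite /S2 addn0 -rE.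
rewrite exec_seq (@whileT_count S2 _ _ r2) //; first last.
- by move: szw => /=; lia.
- by move=> a b; rewrite /S2 upd_sto; exsto; rewrite addnS.
rewrite addn0 /S2 [una 0 ++ r2]/= exec_seq.
case: r2 rP' {S2 rE} szr => [|[] u] rP' szr; [|by case: (rP' u)|].
  by exsto; rewrite /Bad; exsto; apply: bad3; split=> //; exists true, [::].
exsto.
have := @exec_run1 L n m L (u, 0, 1, [::]); rewrite -[Q n m (u, _, _, _)]/(sto [:: [:: false]; [::]; [::]; u; una n;
  una (n + m); [::]; [::]; [::]; una m;
  [::]; [::]; [::]; [::]; [::]; [::]; [::]; [::]; [::]; [::]; [::]; [::]; [:: true]; [::]; [::]]).
move=> H; rewrite exec_loop.
case: run1 H => [[[[u' c'] f'] tk]|] H; last first.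
  by apply: exec_dispatch_bad; apply: H; move: szw szr => /=; lia.
rewrite H; last by move: szw szr => /=; lia.
clear H; case: c' => [|c']; case: f' => [|f']; case: u' => [|[] u'];
  rewrite /Dispatch /Q /qst ?unaS ?una0; repeat (rewrite exec_if_sto; simpl nth; cbv iota);
  first [done | by apply: exec_fail | idtac].
Qed.

Lemma upd_same (s : store) i w : upd s i w i = w.
Proof. by rewrite /upd eqxx. Qed.

Lemma exec_gen L n m tk x : arities_ok tk (gates0 n m) -> all (leaf_le (n + m + 8)) tk ->
  (foldl gate (gates0 n m) tk).2 = [:: x] -> n + m + 5 * size tk + 32 <= L ->
  exec L Gen (Q n m ([::], 0, 0, tk)) 0 = enc_system (toks_system n m tk).
Proof.
move=> ar lf stE szL; rewrite /Gen.
have -> : Q n m ([::], 0, 0, tk) = gstore (sg2 (enc_toks tk) [::]) (rho1 n m) [::].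
  apply: funext => i; rewrite /Q /qst /gstore /sg2 /rho1 /numreg.
  by do 25?[case: i => [|i] //]; rewrite /sto /= nth_nil.
have r1B r : rho1 n m r <= n + m by rewrite /rho1; do !case: ifP => _; lia.
have g0B := @arun_bound _ (rho1 n m, [::]) init2 r1B.
rewrite exec_seq (@exec_acmds L (n + m) _ (rho1 n m, [::])) //; last by rewrite [size _]/=; lia.
rewrite -[gstore _ _ _]/(rst tk (gates0 n m)) exec_seq exec_loop.
have gb : gbound (n + m + 8) (gates0 n m) by split.
have [|E [gB stB g6]] := exec_gates gb ar lf (L := L); first by lia.
rewrite (@iter_stable _ _ _ L _ _ _ E) //; last lia.
set gs := foldl gate _ _ in E gB stB g6 stE *.
have gL k r : k <= 8 -> gs.1.1 r <= L - k by move=> k8; have := gB r; lia.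
rewrite /rst stE; set g := gs.1 in gB g6 gL *.
rewrite exec_seq (@exec_acmds L (L - 8) _ g) //; [|by move=> r; apply: gL|rewrite [size _]/=; lia].
have xL : x <= L - 8 by move: stB; rewrite stE /= andbT; lia.
rewrite exec_seq (exec_readU (u := 20) (o := 10) (k := x) (r := [::])) //; last lia.
rewrite gstore_upds // upd_sg2_st gstore_num //.
have -> : (arun [:: ASet 10 6] g).1 10 = g.1 6 by case: (g).
rewrite g6.
rewrite cats0 gstore_updr // exec_seq.
rewrite (@exec_acmds L (L - 8) _ (rupd (arun [:: ASet 10 6] g).1 10 x, (arun [:: ASet 10 6] g).2)) //;
  [|move=> r|by rewrite [size _]/=; lia]; last first.
  rewrite /= /arun; case E0 : (g) => [rho qs] /=; have gr := gL 8 r isT; have g6' := gL 8 6 isT.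
  by move: gr g6'; rewrite E0 /= /rupd => gr g6'; do !case: ifP => _.
have h4 : g.1 4 = n by rewrite /g /gs foldl_gate_reg4.
have := gL 0 5 isT; have := gL 0 4 isT; rewrite subn0 => b4 b5.
rewrite !exec_seq exec_push (exec_dup (i := 5) (k := g.1 5)) //; last by case: (g).
rewrite exec_push (exec_dup (i := 4) (k := g.1 4)) //; last by case: (g).
rewrite !upd_same /toks_system /enc_system -/gs [sy_n _]/= [sy_N _]/= [sy_quads _]/= stE [head _ _]/=.
rewrite -/g h4; have -> : forall sg, gstore sg (arun [:: AQuad 6 10 10 10] (rupd (arun [:: ASet 10 6] g).1 10 x, (arun [:: ASet 10 6] g).2)).1
   (arun [:: AQuad 6 10 10 10] (rupd (arun [:: ASet 10 6] g).1 10 x, (arun [:: ASet 10 6] g).2)).2 0 =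
   enc_seq enc_quad ((0, x, x, x) :: g.2).
  by move=> sg; rewrite (_ : (0, x, x, x) = (g.1 6, x, x, x) :> quad); [case: (g) | rewrite g6].
by rewrite /enc_unary -!catA.
Qed.

(* Arithmetic expressions with nondeterministic squares: a formula becomes an
   expression that can take the value 0 exactly when the formula holds. *)
Inductive node := NLeaf of nat | NSq | NBin of tok & node & node.

Fixpoint toksr (e : node) : seq tok :=
  match e with
  | NLeaf i => [:: Leaf i]
  | NSq => [:: SqF]
  | NBin op e1 e2 => toksr e2 ++ toksr e1 ++ [:: op]
  end.

Definition binop (t : tok) : bool :=
  match t with TokAdd | TokMul | TokAnd => true | _ => false end.

Fixpoint node_ok (F : nat) (e : node) : bool :=
  match e with
  | NLeaf i => i < F
  | NSq => true
  | NBin op e1 e2 => [&& binop op, node_ok F e1 & node_ok F e2]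
  end.

Section Trees.
Variables n m : nat.
Notation V := ('I_n + 'I_m)%type.

Definition var_index (x : V) : nat :=
  match x with inl j => j + 3 | inr k => k + (n + 3) end.

Fixpoint tree_term (t : rterm V) : node :=
  match t with
  | TVar x => NLeaf (var_index x)
  | TZero => NLeaf 1
  | TOne => NLeaf 0
  | TAdd t1 t2 => NBin TokAdd (tree_term t1) (tree_term t2)
  | TMul t1 t2 => NBin TokMul (tree_term t1) (tree_term t2)
  end.

Definition tree_atom (c : comparison) (e : node) : node :=
  match c with
  | CLt => NBin TokAdd (NLeaf 0) (NBin TokMul NSq e)
  | CGt => NBin TokAdd (NLeaf 2) (NBin TokMul NSq e)
  | CLe => NBin TokAdd NSq e
  | CGe => NBin TokAdd NSq (NBin TokMul (NLeaf 2) e)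
  | CEq => e
  end.

Fixpoint tree_formula (phi : rformula V) : node :=
  match phi with
  | FAtom c t => tree_atom c (tree_term t)
  | FAnd phi1 phi2 => NBin TokAnd (tree_formula phi1) (tree_formula phi2)
  | FOr phi1 phi2 => NBin TokMul (tree_formula phi1) (tree_formula phi2)
  end.

Lemma node_ok_term t : node_ok (n + m + 3) (tree_term t).
Proof.
elim: t => [[j|k]|||t1 h1 t2 h2|t1 h1 t2 h2] /=; rewrite ?h1 ?h2 //.
- by have := ltn_ord j; lia.
- by have := ltn_ord k; lia.
- by rewrite addn3.
- by rewrite addn3.
Qed.

Lemma node_ok_formula phi : node_ok (n + m + 3) (tree_formula phi).
Proof.
elim: phi => [c t|phi1 h1 phi2 h2|phi1 h1 phi2 h2] /=; rewrite ?h1 ?h2 //.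
by case: c => /=; rewrite ?node_ok_term ?addn3.
Qed.

Let enc_t := enc_term (@enc_variable n m).
Let enc_f := enc_formula (@enc_variable n m).

(** The slack of 2, together with the three or more bits in front of the term of an atom, pays for
    the up to four extra tokens of an inequality. *)
Lemma size_toks_term t : size (toksr (tree_term t)) + 2 <= size (enc_t t).
Proof.
elim: t => [[j|k]|||t1 h1 t2 h2|t1 h1 t2 h2] //=; move: h1 h2;
  rewrite /enc_t !size_cat /=; lia.
Qed.

Lemma size_toks_formula phi : size (toksr (tree_formula phi)) <= size (enc_f phi).
Proof.
elim: phi => [c t|phi1 h1 phi2 h2|phi1 h1 phi2 h2] /=.
- by have := size_toks_term t; rewrite /enc_t; case: c => /=; rewrite ?size_cat /=; lia.
- by move: h1 h2; rewrite /enc_f !size_cat /=; lia.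
- by move: h1 h2; rewrite /enc_f !size_cat /=; lia.
Qed.

Lemma run1_add k l st : run1 n m (k + l) st = obind (run1 n m l) (run1 n m k st).
Proof. by elim: k st => //= k IH st; case: step1 => //= st'; rewrite IH. Qed.

Lemma run1_seq k l st st' st'' : run1 n m k st = Some st' -> run1 n m l st' = Some st'' ->
  run1 n m (k + l) st = Some st''.
Proof. by rewrite run1_add => -> . Qed.

Lemma step_var_unary (i start bound c f : nat) r tk : i < bound ->
  step_var (enc_unary i ++ r) start bound c f tk = Some (r, c, f, Leaf (i + start) :: tk).
Proof. by move=> ib; rewrite /step_var /enc_unary -catA spl_una ib. Qed.

(** One round handles one constructor, so the rounds are bounded by the length of the encoding and
    [L] of them suffice. *)
Lemma run1_term t : exists2 k, k <= size (enc_t t) & forall r c f tk,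
  run1 n m k (enc_t t ++ r, c.+1, f, tk) = Some (r, c, f, toksr (tree_term t) ++ tk).
Proof.
elim: t => [[j|k]|||t1 [k1 l1 h1] t2 [k2 l2 h2]|t1 [k1 l1 h1] t2 [k2 l2 h2]] /=.
- by exists 1 => // r c f tk; rewrite /= step_var_unary.
- by exists 1 => // r c f tk; rewrite /= step_var_unary.
- by exists 1.
- by exists 1.
- exists (1 + (k1 + k2)); first by rewrite /enc_t /= !size_cat; move: l1 l2; rewrite /enc_t; lia.
  move=> r c f tk; apply: (@run1_seq 1 _ _ (enc_t t1 ++ enc_t t2 ++ r, c.+2, f, TokAdd :: tk)).
    by rewrite /= catA.
  by rewrite -!catA; apply: run1_seq (h1 _ _ _ _) (h2 _ _ _ _).
- exists (1 + (k1 + k2)); first by rewrite /enc_t /= !size_cat; move: l1 l2; rewrite /enc_t; lia.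
  move=> r c f tk; apply: (@run1_seq 1 _ _ (enc_t t1 ++ enc_t t2 ++ r, c.+2, f, TokMul :: tk)).
    by rewrite /= catA.
  by rewrite -!catA; apply: run1_seq (h1 _ _ _ _) (h2 _ _ _ _).
Qed.

Lemma run1_formula phi : exists2 k, k <= size (enc_f phi) & forall r f tk,
  run1 n m k (enc_f phi ++ r, 0, f.+1, tk) = Some (r, 0, f, toksr (tree_formula phi) ++ tk).
Proof.
elim: phi => [c t|t1 [k1 l1 h1] t2 [k2 l2 h2]|t1 [k1 l1 h1] t2 [k2 l2 h2]] /=.
- have [k l h] := run1_term t; exists (1 + k).
    by case: c => /=; move: l; rewrite /enc_t; lia.
  move=> r f tk; case: c => /=; rewrite -?catA; exact: h.
- exists (1 + (k1 + k2)); first by rewrite /enc_f /= !size_cat; move: l1 l2; rewrite /enc_f; lia.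
  move=> r f tk; apply: (@run1_seq 1 _ _ (enc_f t1 ++ enc_f t2 ++ r, 0, f.+2, TokAnd :: tk)).
    by rewrite /= catA.
  by rewrite -!catA; apply: run1_seq (h1 _ _ _) (h2 _ _ _).
- exists (1 + (k1 + k2)); first by rewrite /enc_f /= !size_cat; move: l1 l2; rewrite /enc_f; lia.
  move=> r f tk; apply: (@run1_seq 1 _ _ (enc_f t1 ++ enc_f t2 ++ r, 0, f.+2, TokMul :: tk)).
    by rewrite /= catA.
  by rewrite -!catA; apply: run1_seq (h1 _ _ _) (h2 _ _ _).
Qed.

Lemma run1_done k tk : run1 n m k ([::], 0, 0, tk) = Some ([::], 0, 0, tk).
Proof. by elim: k. Qed.

(** The invariant for soundness of the parser, traced backwards from the final state, where nothing
    is pending, to the initial one, where the word must then be a single formula. *)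
Definition decodes (u : word) (c f : nat) : Prop :=
  exists (ts : seq (rterm V)) (fs : seq (rformula V)),
    [/\ size ts = c, size fs = f &
        u = flatten [seq enc_t t | t <- ts] ++ flatten [seq enc_f phi | phi <- fs]].

Lemma step_var_decodes u start bound c f tk st :
  step_var u start bound c f tk = Some st ->
  exists2 i, i < bound & u = enc_unary i ++ st.1.1.1 /\ (st.1.1.2, st.1.2) = (c, f).
Proof.
rewrite /step_var; have [uE _] := splP u; case: (spl u) uE => k [|[] r] //= ->.
case: ifP => // kb [<-] /=; exists k => //; split=> //.
by rewrite /enc_unary -catA.
Qed.

(** A step strips one constructor from the input; applying that constructor to what the rest decodes
    to undoes the step. *)
Lemma step1_decodes st st' : step1 n m st = Some st' ->
  decodes st'.1.1.1 st'.1.1.2 st'.1.2 -> decodes st.1.1.1 st.1.1.2 st.1.2.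
Proof.
have tm (t : rterm V) u' u c f : enc_t t ++ u' = u -> decodes u' c f -> decodes u c.+1 f.
  by move=> <- [ts [fs [sc sf ->]]]; exists (t :: ts), fs; split; rewrite /= ?sc // catA.
have tm2 (op : rterm V -> rterm V -> rterm V) p u' u c f :
    (forall t1 t2, enc_t (op t1 t2) = p ++ enc_t t1 ++ enc_t t2) -> p ++ u' = u ->
    decodes u' c.+2 f -> decodes u c.+1 f.
  move=> opE <- [[|t1 [|t2 ts]] [fs [//= sc sf ->]]]; case: sc => sc.
  by exists (op t1 t2 :: ts), fs; split; rewrite /= ?sc // opE -!catA.
have fm (c : comparison) u' u f : false :: enc_comparison c ++ u' = u ->
    decodes u' 1 f -> decodes u 0 f.+1.
  move=> <- [[|t [|t2 ts]] [fs [//= _ sf ->]]].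
  by exists [::], (FAtom c t :: fs); split; rewrite /= ?sf // cats0 -!catA.
have fm2 (op : rformula V -> rformula V -> rformula V) p u' u f :
    (forall t1 t2, enc_f (op t1 t2) = p ++ enc_f t1 ++ enc_f t2) -> p ++ u' = u ->
    decodes u' 0 f.+2 -> decodes u 0 f.+1.
  move=> opE <- [[|t ts] [[|f1 [|f2 fs]] [//= _ sf ->]]]; case: sf => sf.
  by exists [::], (op f1 f2 :: fs); split; rewrite /= ?sf // opE -!catA.
case: st => [[[u c] f] tk] /=; case: c => [|c].
  case: f => [|f]; first by case=> <-.
  case: u => [|[] [|[] [|[] [|[] u]]]] //= [<-] /=;
    first [ exact: (fm2 (@FAnd V) [:: true; false]) | exact: (fm2 (@FOr V) [:: true; true])
          | exact: (fm CLt) | exact: (fm CLe) | exact: (fm CEq) | exact: (fm CGe) | exact: (fm CGt) ].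
case: u => [|[] [|[] u]] //=.
- by case=> <- /=; apply: (tm2 (@TMul V) [:: true; true]).
- by case=> <- /=; apply: (tm2 (@TAdd V) [:: true; false]).
- by case: u => [|[] u] //= [<-] /=; [apply: (tm TOne) | apply: (tm TZero)].
- case: u => [|[] u] //= /step_var_decodes[i ib [-> [-> ->]]].
    exact: (tm (TVar (inr (Ordinal ib)))).
  exact: (tm (TVar (inl (Ordinal ib)))).
Qed.

Lemma run1_decodes k st st' : run1 n m k st = Some st' ->
  decodes st'.1.1.1 st'.1.1.2 st'.1.2 -> decodes st.1.1.1 st.1.1.2 st.1.2.
Proof.
elim: k st => [|k IH] st /=; first by case=> ->.
by case E : step1 => [st1|] //= /IH H /H; apply: step1_decodes.
Qed.

End Trees.

Definition sentence_toks (S : sentence) : seq tok := toksr (tree_formula (s_matrix S)).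

Lemma una_nseq k : nseq k true = una k. Proof. by []. Qed.

Lemma parse_sentence L S : size (enc_sentence S) <= L ->
  parse_word L (enc_sentence S) = Some (s_forall S, s_exists S, sentence_toks S).
Proof.
rewrite /parse_word /enc_sentence /enc_unary -!catA !una_nseq spl_una spl_una => szL.
have [k l h] := run1_formula (s_matrix S).
have kL : k <= L.
  by move: szL l; rewrite !size_cat /=; lia.
rewrite -(subnKC kL) -[enc_formula _ _]cats0.
by rewrite (run1_seq (h [::] 0 [::]) (run1_done _ _ _ _)) cats0.
Qed.

Lemma parse_Some L w r : parse_word L w = Some r -> exists S, w = enc_sentence S.
Proof.
rewrite /parse_word; have [wE _] := splP w; case: (spl w) wE => n [|[] r1] //= ->.
have [rE _] := splP r1; case: (spl r1) rE => m [|[] u] //= ->.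
case E : run1 => [[[[[|? ?] [|?]] [|?]] tk]|] //= _.
have [|[|t ts] [[|phi [|phi2 fs]] [//= _ _ uE]]] := run1_decodes E; first by exists [::], [::].
by exists (Sentence phi); rewrite /enc_sentence /enc_unary /= -!catA /= uE cats0.
Qed.

(** * Truth of the system obtained from a sentence *)

Section GateTruth.
Local Open Scope ring_scope.
Variable R : realType.
Implicit Types (v : nat -> R) (g : gstate).

Definition op_val (t : tok) (x y : R) : R :=
  match t with TokAdd => x + y | TokMul => x * y | _ => x * x + y * y end.

Fixpoint takes v (e : node) (r : R) : Prop :=
  match e with
  | NLeaf i => r = v i
  | NSq => exists a, r = a * a
  | NBin op e1 e2 => exists x y, [/\ takes v e1 x, takes v e2 y & r = op_val op x y]
  end.

(** For disjunctions: when one factor of a product is 0, the other still needs some value. *)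
Lemma takes_total v e : exists r, takes v e r.
Proof.
elim: e => [i||op e1 [x h1] e2 [y h2]] /=; first by exists (v i).
- by exists (0 * 0), 0.
- by exists (op_val op x y), x, y.
Qed.

Lemma takes_agree F v v' e r : node_ok F e -> agree F v v' -> takes v e r -> takes v' e r.
Proof.
move=> ok ag; elim: e r ok => [i||op e1 IH1 e2 IH2] r //=; first by move=> /ag ->.
by move=> /and3P[_ /IH1 h1 /IH2 h2] [x [y [/h1 ? /h2 ? ->]]]; exists x, y.
Qed.

Definition op_acmds (t : tok) : seq acmd :=
  match t with TokAdd => add_acmds | TokMul => mul_acmds | _ => and_acmds end.

Lemma two_opsE g a b : [/\ (two_ops g a b).1 10%N = a, (two_ops g a b).1 11%N = b,
  (two_ops g a b).1 5%N = g.1 5%N, (two_ops g a b).1 6%N = g.1 6%N & (two_ops g a b).1 7%N = g.1 7%N].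
Proof. by []. Qed.

Lemma op_spec op g a b : good g -> (a < g.1 5%N)%N -> (b < g.1 5%N)%N ->
  let g' := arun (op_acmds op) (two_ops g a b) in
  ext [::] g g' (fun v => v (g'.1 12%N) = op_val op (v a) (v b)) /\ (g'.1 12%N < g'.1 5%N)%N.
Proof.
move=> G ha hb; case: (G) => h6 h7 _ F3 _.
have [e10 e11 e5 e6 e7] := two_opsE g a b.
have E0 : ext [::] g (two_ops g a b) (fun _ : nat -> R => True) by apply: ext_regs => //; rewrite /= !eqxx.
set g0 := two_ops g a b in e10 e11 e5 e6 e7 E0 *; have G0 : good g0 by case: E0.
have c6 : (g.1 6%N < g.1 5%N)%N by rewrite h6; lia.
have c7 : (g.1 7%N < g.1 5%N)%N by rewrite h7; lia.
have astepE a' b' c' g1 : [/\ (astep g1 (ADef a' b' c' 12)).1 12%N = g1.1 5%N,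
  (astep g1 (ADef a' b' c' 12)).1 5%N = (g1.1 5%N).+1 & (astep g1 (ADef a' b' c' 12)).1 11%N = g1.1 11%N].
  by case: (g1).
have mulP : forall op', op' = TokMul -> let g' := arun (op_acmds op') g0 in
  ext [::] g g' (fun v => v (g'.1 12%N) = op_val op' (v a) (v b)) /\ (g'.1 12%N < g'.1 5%N)%N.
  move=> op' ->; cbv zeta; rewrite -[arun _ g0]/(astep g0 (ADef 10 11 7 12)); have [-> -> _] := astepE 10%N 11%N 7%N g0.
  split=> //; have E1 := @ext_def R [::] g0 10 11 7 12 G0.
  rewrite e10 e11 e7 e5 ha hb c7 in E1; have {}E1 := E1 isT isT isT.
  apply: (ext_weak (keep := [::])) (ext_trans F3 E0 E1) => // v [_ v1 _] [_].
  by rewrite e5 h7 v1 addr0.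
have andP' : forall op', op' = TokAnd -> let g' := arun and_acmds g0 in
  ext [::] g g' (fun v => v (g'.1 12%N) = v a * v a + v b * v b) /\ (g'.1 12%N < g'.1 5%N)%N.
  move=> op' _; cbv zeta; rewrite -[arun _ g0]/(astep (astep g0 (ADef 10 10 7 12)) (ADef 11 11 12 12)); have [q12 q5 q11] := astepE 10%N 10%N 7%N g0.
  have E1 := @ext_def R [::] g0 10 10 7 12 G0.
  rewrite e10 e7 e5 ha c7 in E1; have {}E1 := E1 isT isT isT.
  set g1 := astep g0 _ in q12 q5 q11 E1 *; have G1 : good g1 by case: E1.
  rewrite e5 e11 in q12 q5 q11.
  have [-> -> _] := astepE 11%N 11%N 12%N g1; split=> //.
  have E2 := @ext_def R [::] g1 11 11 12 12 G1.
  rewrite q11 q12 q5 ltnS (ltnW hb) ltnSn in E2; have {}E2 := E2 isT isT isT.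
  have F3' : (3 <= g0.1 5%N)%N by rewrite e5.
  apply: (ext_weak (keep := [::])) (ext_trans F3 E0 (ext_trans F3' E1 E2)) => // v [_ v1 _] [_ [e1 e2]].
  by rewrite q5 e2 e1 h7 v1 addr0 addrC.
case: op => [i||||]; try exact: (andP' TokAnd erefl); last first.
  exact: (mulP TokMul erefl).
cbv zeta; rewrite -[arun _ g0]/(astep g0 (ADef 10 6 11 12)); have [-> -> _] := astepE 10%N 6%N 11%N g0.
split=> //; have E1 := @ext_def R [::] g0 10 6 11 12 G0.
rewrite e10 e11 e6 e5 ha hb c6 in E1; have {}E1 := E1 isT isT isT.
apply: (ext_weak (keep := [::])) (ext_trans F3 E0 E1) => // v [v0 _ _] [_].
by rewrite e5 h6 v0 mulr1.
Qed.

Lemma arities_ok_cat t1 t2 gs :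
  arities_ok (t1 ++ t2) gs = arities_ok t1 gs && arities_ok t2 (foldl gate gs t1).
Proof. by elim: t1 gs => //= t t1 IH gs; rewrite IH andbA. Qed.

(** Each [NSq] gets a variable of its own, so the choices made in two subtrees are independent and
    every value that the expression can take is realised by some extension. The right subtree is
    evaluated first, as in [toksr]. *)
Lemma tree_spec e g st : good g -> node_ok (g.1 5%N) e ->
  exists (g' : gstate) (i : nat),
  [/\ foldl gate (g, st) (toksr e) = (g', i :: st), arities_ok (toksr e) (g, st),
      (g.1 5%N <= g'.1 5%N)%N /\ good g', (i < g'.1 5%N)%N &
  (forall v, cst3 v -> sat v g'.2 -> sat v g.2 /\ takes v e (v i)) /\
  (forall v r, cst3 v -> sat v g.2 -> takes v e r ->
     exists2 v', agree (g.1 5%N) v v' & sat v' g'.2 /\ v' i = r)].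
Proof.
elim: e g st => [i||op e1 IH1 e2 IH2] g st G /=.
- move=> iF; exists (rupd (arun [:: ASet 12 6] g).1 12 i, (arun [:: ASet 12 6] g).2), i.
  case: g G iF => rho qs [/= h6 h7 h8 h5 hq] iF; split=> //.
  by split=> // v r cv sv ->; exists v.
- move=> _; set g' := arun _ g; exists g', (g'.1 12%N).
  case: g G @g' => rho qs [/= h6 h7 h8 h5 hq]; rewrite /arun /= /rupd /=; split=> //.
  + split; first by lia.
    split=> //=; first by lia.
    have -> : all (quad_lt (rho 5%N).+2) qs by apply: quad_lt_le hq; lia.
    by rewrite h7 ?andbT; repeat (apply/andP; split); lia.
  + split=> [v [v0 v1 v2] | v r [v0 v1 v2] sv [a rE]].
      by rewrite h7 v1 addr0 => -[<- sv]; split=> //; exists (v (rho 5%N)).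
    have [q0 q1 q2 ag] := set3E v (rho 5%N) a r 0.
    exists (set3 v (rho 5%N) a r 0) => //; split=> //; split; last exact: sat_agree ag sv.
    by rewrite h7 q0 q1 ag ?v1 ?addr0 //; lia.
- move=> /and3P[bop ok1 ok2]; have F3 : (3 <= g.1 5%N)%N by case: G.
  have [g2 [i2 [f2 a2 [l2 G2] b2 [s2 c2]]]] := IH2 g st G ok2.
  have mono F F' e : (F <= F')%N -> node_ok F e -> node_ok F' e.
    move=> FF; elim: e => [k||o x hx y hy] //=; first by move=> kF; apply: leq_trans FF.
    by move=> /and3P[-> /hx -> /hy ->].
  have [g1 [i1 [f1 a1 [l1 G1] b1 [s1 c1]]]] := IH1 g2 (i2 :: st) G2 (mono _ _ _ l2 ok1).
  have b2' : (i2 < g1.1 5%N)%N by apply: leq_trans l1.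
  have [E b] := op_spec op G1 b1 b2'; case: E => l3 G3 _ s3 c3.
  set g3 := arun _ _ in b l3 G3 s3 c3.
  exists g3, (g3.1 12%N); split=> //.
  + by rewrite !foldl_cat f2 f1 /=; case: (op) bop @g3 {b l3 G3 s3 c3}.
  + by rewrite !arities_ok_cat f2 f1 a2 a1 /=; case: (op) bop.
  + by split=> //; apply: leq_trans l3; apply: leq_trans l1.
  + split=> [v cv /(s3 v cv)[/(s1 v cv)[/(s2 v cv)[sv t2] t1] t3] | v r cv sv [x [y [t1 t2 rE]]]].
      by split=> //; exists (v i1), (v i2).
    have [v2 ag2 [sv2 e2']] := c2 v y cv sv t2.
    have cv2 := agree_cst3 F3 ag2 cv; have F32 : (3 <= g2.1 5%N)%N by apply: leq_trans l2.
    have [v1 ag1 [sv1 e1']] := c1 v2 x cv2 sv2 (takes_agree ok1 ag2 t1).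
    have cv1 := agree_cst3 F32 ag1 cv2; have F31 : (3 <= g1.1 5%N)%N by apply: leq_trans l1.
    have [v3 ag3 sv3] := c3 v1 cv1 sv1.
    have cv3 := agree_cst3 F31 ag3 cv1.
    exists v3.
      move=> k kF; rewrite ag3 ?ag1 ?ag2 //; first by apply: leq_trans l2.
      by apply: leq_trans l1; apply: leq_trans l2.
    split=> //; have [_ ->] := s3 v3 cv3 sv3.
    by rewrite !ag3 // e1' ag1 // e2' rE.
Qed.

Section Semantics.
Variables (n m : nat) (v : nat -> R) (e : 'I_n + 'I_m -> R).
Hypotheses (cv : cst3 v) (ve : forall x, e x = v (var_index x)).

Lemma takes_term t r : takes v (tree_term t) r <-> r = eval_term e t.
Proof.
case: cv => v0 v1 v2.
elim: t r => [x|||t1 h1 t2 h2|t1 h1 t2 h2] r /=; rewrite ?ve ?v0 ?v1 //.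
- split=> [[x [y [/h1 -> /h2 -> ->]]] // | ->].
  by exists (eval_term e t1), (eval_term e t2); split=> //; [apply/h1 | apply/h2].
- split=> [[x [y [/h1 -> /h2 -> ->]]] // | ->].
  by exists (eval_term e t1), (eval_term e t2); split=> //; [apply/h1 | apply/h2].
Qed.

Lemma takes_atom c t : takes v (tree_atom c (tree_term t)) 0 <-> compare0 c (eval_term e t).
Proof.
case: cv => v0 v1 v2; set x := eval_term e t.
have xt : takes v (tree_term t) x by apply/takes_term.
have mulP l : (exists x0 y, [/\ x0 = l, exists x1 y0, [/\ exists a, x1 = a * a, takes v (tree_term t) y0 & y = x1 * y0] &
    0 = x0 + y]) <-> exists a, 0 = l + a * a * x.
  split=> [[_ [_ [-> [_ [y [[a ->] /takes_term -> ->]]] E]]]|[a E]]; first by exists a.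
  by exists l, (a * a * x); split=> //; exists (a * a), x; split=> //; exists a.
have sqP (y : R) : 0 <= y -> exists a, y = a * a.
  by move=> y0; exists (Num.sqrt y); rewrite -expr2 sqr_sqrtr.
case: c => /=.
- rewrite v0 mulP; split=> [[a E]|x0]; first by nra.
  (* Solving [1 + a^2 x = 0] for [a^2]. *)
  have [|a aE] := sqP (- x^-1); first by rewrite oppr_ge0 invr_le0 ltW.
  by exists a; rewrite -aE mulNr mulVf ?subrr // lt_eqF.
- split=> [[_ [y [[a ->] /takes_term -> E]]]|x0]; first by rewrite -/x in E; nra.
  have [|a aE] := sqP (- x); first by rewrite oppr_ge0.
  by exists (a * a), x; split=> //; [exists a | rewrite -aE addNr].
- by split=> [/takes_term /esym|/esym E] //; apply/takes_term.
- split=> [[_ [_ [[a ->] [_ [y [-> /takes_term -> ->]]] E]]]|x0]; first by rewrite v2 -/x in E; nra.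
  have [a aE] := sqP x x0.
  exists (a * a), (- x); split; [by exists a | | by rewrite -aE subrr].
  by exists (-1), x; rewrite v2 mulN1r.
- rewrite v2 mulP; split=> [[a E]|x0]; first by nra.
  have [|a aE] := sqP (x^-1); first by rewrite invr_ge0 ltW.
  by exists a; rewrite -aE mulVf ?addNr // gt_eqF.
Qed.

Lemma takes_formula phi : takes v (tree_formula phi) 0 <-> holds e phi.
Proof.
elim: phi => [c t|phi1 h1 phi2 h2|phi1 h1 phi2 h2] /=; first exact: takes_atom.
- split=> [[x [y [t1 t2 E]]]|[/h1 t1 /h2 t2]]; last first.
    by exists 0, 0; split=> //=; rewrite mulr0 addr0.
  have x0 : x = 0 by apply/eqP; rewrite -sqrf_eq0 expr2; apply/eqP; move: E => /=; nra.
  have y0 : y = 0 by apply/eqP; rewrite -sqrf_eq0 expr2; apply/eqP; move: E => /=; nra.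
  by rewrite x0 in t1; rewrite y0 in t2; split; [apply/h1 | apply/h2].
- split=> [[x [y [t1 t2 /= /esym/eqP]]]|].
    by rewrite mulf_eq0 => /orP[/eqP x0|/eqP y0]; [left; apply/h1; rewrite -x0 | right; apply/h2; rewrite -y0].
  case=> [/h1 t1|/h2 t2].
    by have [y t2] := takes_total v (tree_formula phi2); exists 0, y; rewrite /= mul0r.
  by have [x t1] := takes_total v (tree_formula phi1); exists x, 0; rewrite /= mulr0.
Qed.

End Semantics.

Definition sentence_system (S : sentence) : system :=
  toks_system (s_forall S) (s_exists S) (sentence_toks S).

Lemma sat_gate v gs t : sat v (gate gs t).1.2 -> sat v gs.1.2.
Proof.
case: gs => g st; have bg l : sat v (bin_gate l (g, st)).1.2 -> sat v g.2.
  by case: st => [|a [|b st]] //= /sat_arun.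
by case: t => [i||||] /=; try exact: bg; apply: sat_arun.
Qed.

Lemma gates0_spec n m : [/\ good (gates0 n m).1, (gates0 n m).1.1 5%N = (n + m + 3)%N &
  (gates0 n m).1.2 = [:: (2, 0, 0, 1); (0, 1, 1, 1)]%N].
Proof. by rewrite addn3; split. Qed.

Lemma sentence_systemP S :
  [/\ wf_system (sentence_system S),
      exists x, (foldl gate (gates0 (s_forall S) (s_exists S)) (sentence_toks S)).2 = [:: x],
      arities_ok (sentence_toks S) (gates0 (s_forall S) (s_exists S)) &
      true_system R (sentence_system S) <-> true_sentence R S].
Proof.
case: S => n m phi; rewrite /sentence_system /toks_system /sentence_toks /=.
have satI v : v 0%N = 1 -> sat v (foldl gate (gates0 n m) (toksr (tree_formula phi))).1.2 -> cst3 v.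
  move=> v0 sv; apply: (@cst3_quads R v [::]) => //; have [_ _ <-] := gates0_spec n m.
  by elim: (toksr _) (gates0 n m) sv => //= t l IH gs /IH /sat_gate.
have [G0 h5 h2] := gates0_spec n m.
have ok : node_ok ((gates0 n m).1.1 5%N) (tree_formula phi) by rewrite h5; apply: node_ok_formula.
have [g' [i [fE ar [l G'] b [s c]]]] := tree_spec [::] G0 ok.
rewrite -[((gates0 n m).1, [::])]/(gates0 n m) in fE ar; rewrite h2 h5 in l s c.
rewrite fE /= in satI *; split=> //.
- case: G' => _ _ _ F3 q; rewrite /wf_system /= q andbT.
  by repeat (apply/andP; split); lia.
- by exists i.
- split=> [T x|T x].
    have [v [/= v0 vx [q sv]]] := T (fun j => if insub j : option 'I_n is Some o then x 0 o else 0).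
    have cv := satI v v0 sv; have [_ t] := s v cv sv.
    have vi : v i = 0 by move: q; rewrite v0; lra.
    exists (\row_(k < m) v (k + (n + 3))%N); rewrite vi in t.
    apply/(takes_formula cv) => //; case=> [j|k] /=; last by rewrite mxE.
    by rewrite vx // insubT /= => [|jn]; [exact: ltn_ord | congr (x _ _); apply: val_inj].
  have [y H] := T (\row_(j < n) x j).
  (* The universal values followed by the existential witnesses; [start_val] shifts the sequence by
     3 to make room for the constants. *)
  pose z k := if (k < n)%N then x k else if insub (k - n)%N : option 'I_m is Some o then y 0 o else 0.
  have c0 : cst3 (start_val z) by [].
  have s0 : sat (start_val z) [:: (2, 0, 0, 1); (0, 1, 1, 1)]%N.
    by rewrite /=; do !split=> //; rewrite ?mulr0 ?mulr1 ?addr0 ?addNr.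
  have [|v' ag [sv' e0]] := c (start_val z) 0 c0 s0.
    apply/(takes_formula c0); last exact: H.
    case=> [j|k] /=; first by rewrite mxE addn3 /= /z ltn_ord.
    have -> : (k + (n + 3) = (k + n).+3)%N by lia.
    rewrite /= /z ltnNge leq_addl /= addnK insubT //= => kn; congr (y _ _); exact: val_inj.
  exists v'; split=> /=.
  + by rewrite ag //; lia.
  + by move=> j jn; rewrite ag; [rewrite addn3 /= /z jn | lia].
  + by rewrite e0 mulr0 addr0.
Qed.

Lemma bad_system_false : ~ true_system R bad_system.
Proof. by move=> /(_ (fun=> 0))[v [/= v0 _ [q _]]]; move: q; rewrite v0 => q; lra. Qed.

End GateTruth.

Lemma leaf_le_toks F e : node_ok F e -> all (leaf_le F) (toksr e).
Proof.
elim: e => [i||op e1 h1 e2 h2] //=; first by move=> /ltnW ->.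
by move=> /and3P[bop /h1 a1 /h2 a2]; rewrite !all_cat a1 a2 /=; case: op bop.
Qed.

Lemma exec_parse_sentence (R : realType) L S : 64 * size (enc_sentence S) + 64 <= L ->
  exec L parse_program (program_init (enc_sentence S)) 0 = enc_system (sentence_system S).
Proof.
move=> szL; rewrite exec_parse // parse_sentence; last lia.
have [_ [x st] ar _] := sentence_systemP R S.
apply: (exec_gen ar _ st).
  apply: sub_all (leaf_le_toks (node_ok_formula (s_matrix S))) => -[] //= i; lia.
move: szL; have := size_toks_formula (s_matrix S); rewrite -/(sentence_toks S).
rewrite /enc_sentence /enc_unary !size_cat !size_nseq /=; lia.
Qed.

Lemma exec_parse_bad L w : 64 * size w + 64 <= L -> (forall S, w <> enc_sentence S) ->
  exec L parse_program (program_init w) 0 = enc_system bad_system.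
Proof.
move=> szL nS; rewrite exec_parse //; case E : parse_word => [[[n m] tk]|] //.
by have [S /nS] := parse_Some E.
Qed.

(** * The reductions *)

Definition run (K : nat) (c : cmd) (w : word) : word :=
  exec (K * size w + K) c (program_init w) 0.

Lemma polytime_run B K c f : 1 < B -> regs_lt B c -> polytime f ->
  polytime (fun w => run K c (f w)).
Proof. by move=> B1 rc pf; apply: (polytime_comp_program (K := K) B1 rc pf). Qed.

(** The factor is chosen so that the loop bound covers every number that the program handles and
    every iteration that it has to make. *)
Definition instance_to_system := run 64 system_program.
Definition system_to_sentence := run 1 sentence_program.
Definition sentence_to_system := run 64 parse_program.
Definition system_to_instance := run 4 instance_program.

Lemma instance_to_systemE I :
  instance_to_system (enc_instance I) = enc_system (instance_system I).
Proof. exact: exec_system_program. Qed.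

Lemma system_to_sentenceE s : wf_system s ->
  system_to_sentence (enc_system s) = enc_sentence (system_sentence s).
Proof.
move=> wf; rewrite enc_system_sentence //; apply: exec_sentence_program.
by rewrite mul1n leq_addr.
Qed.

Lemma system_to_instanceE s : wf_system s ->
  system_to_instance (enc_system s) = enc_instance (system_instance s).
Proof.
move=> wf; rewrite enc_system_instance //; apply: exec_instance_program => //.
by rewrite leq_add2r leq_pmull.
Qed.

Section Reductions.
Variable R : realType.

(* The encodings need not be shown injective: equal encodings are translated
   into the same system, hence have the same truth value. *)
Lemma enc_instance_surjective I I' : enc_instance I = enc_instance I' ->
  surjective_instance R I -> surjective_instance R I'.
Proof.
move=> E; have := congr1 instance_to_system E; rewrite !instance_to_systemE.
move=> /enc_system_inj sE; have [_ <-] := instance_systemP R I.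
by have [_ <-] := instance_systemP R I'; rewrite sE.
Qed.

Lemma sentence_to_systemE S :
  sentence_to_system (enc_sentence S) = enc_system (sentence_system S).
Proof. exact: (exec_parse_sentence R). Qed.

Lemma enc_sentence_true S S' : enc_sentence S = enc_sentence S' ->
  true_sentence R S -> true_sentence R S'.
Proof.
move=> E; have := congr1 sentence_to_system E; rewrite !sentence_to_systemE.
move=> /enc_system_inj sE; have [_ _ _ <-] := sentence_systemP R S.
by have [_ _ _ <-] := sentence_systemP R S'; rewrite sE.
Qed.

(** The reduction does not look at the promise [C], so a single proof serves both problems. *)
Lemma surjectivity_in_Pi2R C : in_Pi2R R (surjectivity_restricted R C).
Proof.
exists (fun w => system_to_sentence (instance_to_system w)).
  apply: (polytime_run (B := 10)) => //; first exact: regs_sentence_program.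
  exact: (@polytime_run 19 64 system_program id isT regs_system_program polytime_id).
move=> _ [I [-> _ _]]; split=> //=.
have [wf T] := instance_systemP R I.
rewrite instance_to_systemE system_to_sentenceE //; split=> [[I' [E S]]|[S E TS]].
  exists (system_sentence (instance_system I)) => //.
  by apply/true_system_sentence => //; apply/T; apply: enc_instance_surjective S.
have [H _] : true_sentence R (system_sentence (instance_system I)) <->
    true_system R (instance_system I) by apply: true_system_sentence.
by exists I; split=> //; apply/T; apply: H; apply: (enc_sentence_true (esym E) TS).
Qed.

(** Stated for every word, because [true_sentences] carries no promise: a word that encodes no
    sentence is rejected, and [bad_system] is false. *)
Lemma sentence_to_system_correct w :
  exists s, [/\ sentence_to_system w = enc_system s, wf_system s &
    true_system R s <-> accepts (true_sentences R) w].
Proof.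
have [[S ->]|nS] := pselect (exists S, w = enc_sentence S).
  have [wf _ _ T] := sentence_systemP R S; exists (sentence_system S); split=> //.
    exact: sentence_to_systemE.
  rewrite T /=; split=> [TS|[S' E TS]]; first by exists S.
  exact: enc_sentence_true TS.
exists bad_system; split=> //.
  by apply: exec_parse_bad => // S E; apply: nS; exists S.
by split=> [/bad_system_false|[S E _]] //; case: nS; exists S.
Qed.

Lemma surjectivity_degree_hard Q : in_Pi2R R Q -> reduces Q (surjectivity_degree R 8).
Proof.
move=> [f pf fP]; exists (fun w => system_to_instance (sentence_to_system (f w))).
  apply: (polytime_run (B := 17)) => //; first exact: regs_instance_program.
  by apply: (polytime_run (B := 25)) => //; exact: regs_parse_program.
move=> w /fP[_ fw]; have [s [sE wf T]] := sentence_to_system_correct (f w).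
rewrite sE system_to_instanceE //; split.
  exists (system_instance s); split=> //; first exact: system_instance_well_defined.
  exact: system_instance_degree.
rewrite fw -T -surjective_system_instance //=; split=> [S|[I [E S]]].
  by exists (system_instance s).
exact: enc_instance_surjective S.
Qed.

End Reductions.

Theorem theorem22 (R : realType) :
  Pi2R_complete R (surjectivity R) /\ Pi2R_complete R (surjectivity_degree R 8).
Proof.
split; split; try exact: surjectivity_in_Pi2R; last exact: surjectivity_degree_hard.
(* The same reduction serves for hardness in general, as acceptance does not depend on the degree
   bound and the promise is only weakened. *)
move=> Q /surjectivity_degree_hard[f pf fP]; exists f => // w /fP[[I [fw wd _]] acc].
by split=> //; exists I.
Qed.
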